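(* Let $\theta\in(0,1)$ be irrational with $w(\theta)>1$ (possibly $w(\theta)=\infty$). Then: (a) $\mathcal U_\tau[\theta]=\mathbb T$ if $0<\tau<1/w(\theta)$; (b) $\mathcal U_\tau[\theta]=\{i\theta\in\mathbb T: i\ge 1\}$ if $\tau>w(\theta)$; (c) if $1/w(\theta)<\tau<1$, then $$\dim_H\mathcal U_\tau[\theta]=\liminf_{k\to\infty}\frac{\log\Big(n_k^{1/\tau+1}\prod_{j=1}^{k-1}n_j^{1/\tau}\|n_j\theta\|\Big)}{\log\big(n_k\|n_k\theta\|^{-1}\big)},$$ where $(n_k)_{k\ge1}$ is the increasing enumeration of the set of convergent denominators $q_m$ of $\theta$ satisfying $q_m\|q_m\theta\|^\tau<1$; (d) if $1<\tau<w(\theta)$, then $$\dim_H\mathcal U_\tau[\theta]=\liminf_{k\to\infty}\frac{-\log\Big(\prod_{j=1}^{k-1}n_j\|n_j\theta\|^{1/\tau}\Big)}{\log\big(n_k\|n_k\theta\|^{-1}\big)},$$ where $(n_k)_{k\ge1}$ is the increasing enumeration of the set of convergent denominators $q_m$ of $\theta$ satisfying $q_m^\tau\|q_m\theta\|<2$.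
   Context: $\mathbb T=\mathbb R/\mathbb Z$; points of $\mathbb T$ are identified with their fractional parts. $\|t\|$ denotes the distance from a real $t$ to the nearest integer. For an irrational $\theta\in(0,1)$ with continued fraction expansion $\theta=[0;a_1,a_2,\dots]$, $p_k/q_k$ are the convergents, with $q_0=1,p_0=0$, $q_1=a_1$, $q_{k+1}=a_{k+1}q_k+q_{k-1}$. The irrationality exponent is $w(\theta)=\sup\{s>0:\liminf_{j\to\infty}j^s\|j\theta\|=0\}$ (equivalently $w(\theta)=\limsup_{k}\log q_{k+1}/\log q_k$); always $w(\theta)\ge1$. For $\tau>0$, $\mathcal U_\tau[\theta]$ is the set of $y\in\mathbb T$ such that there exists $Q_0$ with the property that for every real $Q\ge Q_0$ there is an integer $1\le n\le Q$ with $\|n\theta-y\|<Q^{-\tau}$. $\dim_H$ is Hausdorff dimension. *)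

(* Defs.v *)
From Stdlib Require Import Reals Lra Lia ZArith Arith.
Open Scope R_scope.

Definition frac (t : R) : R := t - IZR (Int_part t).
Definition dZ (t : R) : R := Rmin (frac t) (1 - frac t).

Definition irrational (x : R) : Prop :=
  ~ exists (p : Z) (q : nat), (0 < q)%nat /\ x * INR q = IZR p.

Fixpoint gauss (theta : R) (k : nat) : R :=
  match k with
  | O => theta
  | S k => frac (1 / gauss theta k)
  end.

(** a_{k+1} *)
Definition cf_a (theta : R) (k : nat) : nat :=
  Z.to_nat (Int_part (1 / gauss theta k)).

(** (q_k, q_{k-1}) with q_0 = 1, q_{-1} = 0, q_{k+1} = a_{k+1} q_k + q_{k-1}. *)
Fixpoint qpair (theta : R) (k : nat) : nat * nat :=
  match k with
  | O => (1%nat, 0%nat)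
  | S k => let '(q, qp) := qpair theta k in (cf_a theta k * q + qp, q)%nat
  end.

Definition cf_q (theta : R) (k : nat) : nat := fst (qpair theta k).

(** Irrationality exponent w(theta) = sup A, A = {s > 0 : liminf_j j^s ||j theta|| = 0}
    (the sequence is nonnegative, so liminf = 0 means: arbitrarily small values
    infinitely often). w may be +infinity, so we only use comparisons with it. *)
Definition irr_set (theta : R) (s : R) : Prop :=
  0 < s /\ forall eps, 0 < eps -> forall N : nat,
    exists j : nat, (N <= j)%nat /\ (1 <= j)%nat /\
      Rpower (INR j) s * dZ (INR j * theta) < eps.

Definition w_gt (theta x : R) : Prop := exists s, irr_set theta s /\ x < s.
Definition w_lt (theta x : R) : Prop :=
  exists b, b < x /\ forall s, irr_set theta s -> s <= b.

Definition U_set (theta tau : R) (y : R) : Prop :=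
  0 <= y < 1 /\
  exists Q0 : R, forall Q : R, Q0 <= Q ->
    exists n : nat, (1 <= n)%nat /\ INR n <= Q /\
      dZ (INR n * theta - y) < Rpower Q (- tau).

(** Hausdorff measure zero on T with the metric ||x - y||:
    H^s(E) = 0 iff for all eps, delta > 0 there is a countable cover
    (U_i) of E by sets of diameter <= r_i <= delta with sum r_i^s <= eps. *)
Definition H_null (s : R) (E : R -> Prop) : Prop :=
  forall eps delta, 0 < eps -> 0 < delta ->
    exists (r : nat -> R) (U : nat -> R -> Prop),
      (forall i, 0 < r i <= delta) /\
      (forall i x y, U i x -> U i y -> dZ (x - y) <= r i) /\
      (forall x, E x -> exists i, U i x) /\
      (forall N, sum_f_R0 (fun i => Rpower (r i) s) N <= eps).

Definition is_dimH (E : R -> Prop) (d : R) : Prop :=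
  (forall s, 0 <= s -> H_null s E -> d <= s) /\
  (forall t, (forall s, 0 <= s -> H_null s E -> t <= s) -> t <= d).

Definition is_liminf (u : nat -> R) (l : R) : Prop :=
  forall eps, 0 < eps ->
    (exists N, forall k, (N <= k)%nat -> l - eps < u k) /\
    (forall N, exists k, (N <= k)%nat /\ u k < l + eps).

Fixpoint prod1 (f : nat -> R) (m : nat) : R :=
  match m with
  | O => 1
  | S m => prod1 f m * f (S m)
  end.

Definition enumerates (P : nat -> Prop) (n : nat -> nat) : Prop :=
  (forall k, (1 <= k)%nat -> (n k < n (S k))%nat) /\
  (forall x, P x <-> exists k, (1 <= k)%nat /\ n k = x).

Definition S_c (theta tau : R) (x : nat) : Prop :=
  exists m, x = cf_q theta m /\ INR x * Rpower (dZ (INR x * theta)) tau < 1.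

Definition S_d (theta tau : R) (x : nat) : Prop :=
  exists m, x = cf_q theta m /\ Rpower (INR x) tau * dZ (INR x * theta) < 2.

(* Main.v *)
(** For a convergent denominator q with D = ||q theta||, put l = (D/q)^(tau/(tau+1)). At the
    scale Q = (q/D)^(1/(tau+1)) one has Q^(-tau) = l = (Q/q) D, so a point that is approximated
    at this scale lies within 2 l of some i theta with i <= q; conversely the points
    (i + j q) theta take care of all the scales q <= Q < q' (q' the next denominator) for every
    point on the correct side of i theta at distance at most a constant times l. If tau < 1 and
    q D^tau >= 1, every point is approximated for q <= Q < q'; if tau > 1 and q^tau D >= 2, the
    approximating index cannot change between Q = q and Q = q'. Hence U_tau is a Cantor-like set
    whose level-k pieces have length about l_k, and where a piece of level k contains about
    l_k / g_{k+1} evenly spaced pieces of level k+1, with g_{k+1} = 1/n_{k+1} when tau < 1 and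
    g_{k+1} = ||n_k theta|| when tau > 1. Since n_k grows faster than any geometric sequence,
    constant factors at each level do not influence the dimension. *)

Require Import Defs.
From Stdlib Require Import Reals.
From Stdlib Require Import Lra Lia ZArith Arith List Cantor Classical ClassicalEpsilon.
Import ListNotations.
Open Scope R_scope.

(** * Distance to the nearest integer *)

(** Both dimension formulas come out of one statement, [cantor_dimension], about sizes l_k, gaps g_k
    and a virtual number of pieces H_k with H_{k+1} = H_k l_k / g_{k+1}: the dimension is the liminf
    of log H_k / log (1 / l_k). In both ranges of tau, l_k and H_k are explicit products raised to
    the power tau/(tau+1), up to sign, so this exponent cancels in the quotient. The upper bound
    counts pieces. For the lower bound no measure is built: given a cover of small total weight, one
    descends through the tree, always to a child that sees little of the cover, and ends at a limit
    point that no set of the cover can contain. The obstacle is that a point of the limit set must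
    be approximated at every real scale Q, not only at the crossing scales. This dictates the choice
    of children: for tau < 1 they lie on the side of i theta towards which multiples of q move, for
    tau > 1 they are themselves points (i + j q) theta reached by that walk. Pieces of the subtree
    are shrunk by a constant c_0 to leave room for these conditions. *)

Lemma frac_range (t : R) : 0 <= frac t < 1.
Proof. unfold frac; destruct (base_Int_part t); lra. Qed.

Lemma frac_unique (t f : R) (z : Z) : t = IZR z + f -> 0 <= f < 1 -> frac t = f.
Proof.
  intros E H. assert (z = Int_part t) by (apply Int_part_spec; lra).
  unfold frac; subst z; lra.
Qed.

Lemma dZ_le_abs (t : R) (z : Z) : dZ t <= Rabs (t - IZR z).
Proof.
  unfold dZ. pose proof (frac_range t) as H.
  assert (E : t = IZR (Int_part t) + frac t) by (unfold frac; ring).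
  destruct (Z_le_gt_dec z (Int_part t)) as [h|h].
  - apply IZR_le in h. rewrite Rabs_right by lra.
    eapply Rle_trans; [apply Rmin_l|]; lra.
  - assert (h' : (Int_part t + 1 <= z)%Z) by lia.
    apply IZR_le in h'. rewrite plus_IZR in h'. rewrite Rabs_left by lra.
    eapply Rle_trans; [apply Rmin_r|]; lra.
Qed.

Lemma dZ_attained (t : R) : exists z : Z, dZ t = Rabs (t - IZR z).
Proof.
  pose proof (frac_range t) as H.
  assert (E : t = IZR (Int_part t) + frac t) by (unfold frac; ring).
  unfold dZ, Rmin. destruct (Rle_dec (frac t) (1 - frac t)).
  - exists (Int_part t). rewrite Rabs_right; lra.
  - exists (Int_part t + 1)%Z. rewrite plus_IZR, Rabs_left; lra.
Qed.

Lemma dZ_nonneg (t : R) : 0 <= dZ t.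
Proof. destruct (dZ_attained t) as [z ->]; apply Rabs_pos. Qed.

Lemma dZ_le (t : R) : dZ t <= Rabs t.
Proof. pose proof (dZ_le_abs t 0) as H. now rewrite Rminus_0_r in H. Qed.

Lemma dZ_eq_abs (t : R) (z : Z) : Rabs (t - IZR z) <= / 2 -> dZ t = Rabs (t - IZR z).
Proof.
  intros H. apply Rle_antisym; [apply dZ_le_abs|].
  destruct (dZ_attained t) as [w E]. rewrite E.
  destruct (Z.eq_dec w z) as [->|n]; [lra|].
  assert (h : (w + 1 <= z \/ z + 1 <= w)%Z) by lia.
  revert H; unfold Rabs; destruct h as [h|h]; apply IZR_le in h; rewrite plus_IZR in h;
    repeat destruct Rcase_abs; lra.
Qed.

Lemma dZ_small (t : R) : Rabs t <= / 2 -> dZ t = Rabs t.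
Proof.
  intros H. rewrite (dZ_eq_abs t 0); rewrite Rminus_0_r; trivial.
Qed.

Lemma dZ_plus (a b : R) : dZ (a + b) <= dZ a + dZ b.
Proof.
  destruct (dZ_attained a) as [z ->], (dZ_attained b) as [w ->].
  eapply Rle_trans; [apply (dZ_le_abs _ (z + w))|].
  rewrite plus_IZR. replace (a + b - (IZR z + IZR w)) with ((a - IZR z) + (b - IZR w)) by ring.
  apply Rabs_triang.
Qed.

Lemma dZ_shift (t : R) (z : Z) : dZ (t + IZR z) = dZ t.
Proof.
  assert (H : forall u (w : Z), dZ (u + IZR w) <= dZ u).
  { intros u w. destruct (dZ_attained u) as [v ->].
    eapply Rle_trans; [apply (dZ_le_abs _ (v + w))|].
    rewrite plus_IZR. right; f_equal; ring. }
  apply Rle_antisym; [apply H|].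
  replace t with ((t + IZR z) + IZR (- z)) at 1 by (rewrite opp_IZR; ring). apply H.
Qed.

Lemma dZ_congr (a b : R) (z : Z) : a = b + IZR z -> dZ a = dZ b.
Proof. intros ->; apply dZ_shift. Qed.

Lemma dZ_opp (t : R) : dZ (- t) = dZ t.
Proof.
  assert (H : forall u, dZ (- u) <= dZ u).
  { intros u. destruct (dZ_attained u) as [v ->].
    eapply Rle_trans; [apply (dZ_le_abs _ (- v))|].
    rewrite opp_IZR, <- Rabs_Ropp. right; f_equal; ring. }
  apply Rle_antisym; [apply H|]. rewrite <- (Ropp_involutive t) at 1; apply H.
Qed.

Lemma dZ_minus_sym (a b : R) : dZ (a - b) = dZ (b - a).
Proof. rewrite <- dZ_opp; f_equal; ring. Qed.

Lemma dZ_triang (a b c : R) : dZ (a - c) <= dZ (a - b) + dZ (b - c).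
Proof. replace (a - c) with ((a - b) + (b - c)) by ring. apply dZ_plus. Qed.

Lemma dZ_frac (a b : R) : dZ (frac a - frac b) = dZ (a - b).
Proof.
  apply (dZ_congr _ _ (Int_part b - Int_part a)). rewrite minus_IZR; unfold frac; ring.
Qed.

Lemma dZ_0_frac (a b : R) : dZ (a - b) = 0 -> frac a = frac b.
Proof.
  intros H. destruct (dZ_attained (a - b)) as [z E]. rewrite H in E.
  symmetry in E. assert (E' : a - b - IZR z = 0).
  { destruct (Req_dec (a - b - IZR z) 0) as [|n]; trivial.
    apply Rabs_no_R0 in n; contradiction. }
  apply (frac_unique a (frac b) (Int_part b + z)); [|apply frac_range].
  rewrite plus_IZR; unfold frac; lra.
Qed.

Lemma frac_id (y : R) : 0 <= y < 1 -> frac y = y.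
Proof. intros H; apply (frac_unique y y 0); lra. Qed.

(** * Continued fractions *)

(** This product of Gauss iterates is |q_k theta - p_k|, see [cf_signed_err]. Unlike the distance to
    the nearest integer it obeys the recurrences from k = 0 on, also when theta > 1/2. *)
Fixpoint cf_err (theta : R) (k : nat) : R :=
  match k with
  | O => theta
  | S k => gauss theta (S k) * cf_err theta k
  end.

(* (p_k, p_{k-1}), with p_0 = 0 and p_{-1} = 1. *)
Fixpoint ppair (theta : R) (k : nat) : Z * Z :=
  match k with
  | O => (0%Z, 1%Z)
  | S k => let '(p, pp) := ppair theta k in
           (Z.of_nat (cf_a theta k) * p + pp, p)%Z
  end.

Definition cf_p (theta : R) (k : nat) : Z := fst (ppair theta k).

Lemma irrational_inv (x : R) : irrational x -> x <> 0 -> irrational (1 / x).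
Proof.
  intros H nz [p [q [hq E]]]. apply H.
  assert (E' : INR q = IZR p * x) by (rewrite <- E; field; trivial).
  assert (q0 : 0 < INR q) by (apply lt_0_INR; trivial).
  assert (p0 : p <> 0%Z) by (intros ->; lra).
  destruct (Z_lt_le_dec 0 p) as [h|h].
  - exists (Z.of_nat q), (Z.to_nat p). split; [lia|].
    rewrite INR_IZR_INZ, Z2Nat.id by lia. rewrite <- INR_IZR_INZ. lra.
  - exists (- Z.of_nat q)%Z, (Z.to_nat (- p)). split; [lia|].
    rewrite INR_IZR_INZ, Z2Nat.id by lia. rewrite !opp_IZR, <- INR_IZR_INZ. lra.
Qed.

Lemma irrational_frac (x : R) : irrational x -> irrational (frac x).
Proof.
  intros H [p [q [hq E]]]. apply H. exists (p + Int_part x * Z.of_nat q)%Z, q.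
  split; trivial. rewrite plus_IZR, mult_IZR, <- INR_IZR_INZ, <- E. unfold frac; ring.
Qed.

Lemma irrational_neq (x : R) (z : Z) : irrational x -> x <> IZR z.
Proof. intros H ->. apply H. exists z, 1%nat. split; [lia|]. simpl; ring. Qed.

Lemma gauss_spec (theta : R) (k : nat) :
  0 < theta < 1 -> irrational theta -> 0 < gauss theta k < 1 /\ irrational (gauss theta k).
Proof.
  intros H I. induction k as [|k [[IH0 IH1] IH2]]; [auto|].
  simpl. assert (J : irrational (frac (1 / gauss theta k))).
  { apply irrational_frac, irrational_inv; trivial; lra. }
  split; trivial. pose proof (frac_range (1 / gauss theta k)).
  pose proof (irrational_neq _ 0 J). lra.
Qed.

Lemma cf_a_spec (theta : R) (k : nat) :
  0 < theta < 1 -> irrational theta ->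
  (1 <= cf_a theta k)%nat /\ 1 / gauss theta k = INR (cf_a theta k) + gauss theta (S k).
Proof.
  intros H I. destruct (gauss_spec theta k H I) as [[g0 g1] _].
  assert (G : 1 < 1 / gauss theta k).
  { apply (Rmult_lt_reg_r (gauss theta k)); [lra|]. unfold Rdiv.
    rewrite Rmult_assoc, Rinv_l by lra. lra. }
  assert (Z1 : (1 <= Int_part (1 / gauss theta k))%Z).
  { destruct (base_Int_part (1 / gauss theta k)).
    assert (0 < Int_part (1 / gauss theta k))%Z by (apply lt_IZR; lra). lia. }
  unfold cf_a. split; [lia|].
  rewrite INR_IZR_INZ, Z2Nat.id by lia. simpl. unfold frac; ring.
Qed.

Lemma cf_q_SS (theta : R) (k : nat) :
  cf_q theta (S (S k)) = (cf_a theta (S k) * cf_q theta (S k) + cf_q theta k)%nat.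
Proof. unfold cf_q; simpl. destruct (qpair theta k); reflexivity. Qed.

Lemma cf_p_SS (theta : R) (k : nat) :
  cf_p theta (S (S k)) = (Z.of_nat (cf_a theta (S k)) * cf_p theta (S k) + cf_p theta k)%Z.
Proof. unfold cf_p; simpl. destruct (ppair theta k); reflexivity. Qed.

Lemma cf_q_1 (theta : R) : cf_q theta 1 = cf_a theta 0.
Proof. unfold cf_q; simpl; lia. Qed.

Lemma cf_p_1 (theta : R) : cf_p theta 1 = 1%Z.
Proof. unfold cf_p; simpl; lia. Qed.

Lemma cf_q_mono_pos (theta : R) (k : nat) :
  0 < theta < 1 -> irrational theta ->
  (1 <= cf_q theta k)%nat /\ (cf_q theta k <= cf_q theta (S k))%nat.
Proof.
  intros H I. induction k as [|k [IH1 IH2]].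
  - rewrite cf_q_1. destruct (cf_a_spec theta 0 H I). unfold cf_q; simpl; lia.
  - rewrite cf_q_SS. destruct (cf_a_spec theta (S k) H I). nia.
Qed.

Lemma cf_q_pos (theta : R) (k : nat) :
  0 < theta < 1 -> irrational theta -> (1 <= cf_q theta k)%nat.
Proof. intros H I; apply (cf_q_mono_pos theta k H I). Qed.

Lemma cf_q_lt (theta : R) (k : nat) :
  0 < theta < 1 -> irrational theta -> (cf_q theta (S k) < cf_q theta (S (S k)))%nat.
Proof.
  intros H I. rewrite cf_q_SS. destruct (cf_a_spec theta (S k) H I).
  pose proof (cf_q_pos theta k H I). nia.
Qed.

Lemma cf_q_le (theta : R) (j k : nat) :
  0 < theta < 1 -> irrational theta -> (j <= k)%nat -> (cf_q theta j <= cf_q theta k)%nat.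
Proof.
  intros H I. induction 1 as [|k _ IH]; trivial.
  destruct (cf_q_mono_pos theta k H I); lia.
Qed.

Lemma cf_q_strict (theta : R) (j k : nat) :
  0 < theta < 1 -> irrational theta -> (1 <= j)%nat -> (j < k)%nat ->
  (cf_q theta j < cf_q theta k)%nat.
Proof.
  intros H I h1 h2. destruct j as [|j]; [lia|].
  pose proof (cf_q_lt theta j H I). pose proof (cf_q_le theta (S (S j)) k H I h2). lia.
Qed.

Lemma cf_q_ge_index (theta : R) (k : nat) :
  0 < theta < 1 -> irrational theta -> (k <= cf_q theta k)%nat.
Proof.
  intros H I. induction k as [|k IH]; [lia|]. destruct k as [|k].
  - apply cf_q_pos; trivial.
  - pose proof (cf_q_lt theta k H I). lia.
Qed.

Lemma cf_q_lt_inv (theta : R) (j k : nat) :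
  0 < theta < 1 -> irrational theta -> (cf_q theta j < cf_q theta k)%nat -> (j < k)%nat.
Proof.
  intros H I h. destruct (le_lt_dec k j) as [l|l]; trivial.
  pose proof (cf_q_le theta k j H I l). lia.
Qed.

Lemma cf_err_pos (theta : R) (k : nat) :
  0 < theta < 1 -> irrational theta -> 0 < cf_err theta k.
Proof.
  intros H I. induction k; [simpl; lra|]. cbn [cf_err].
  destruct (gauss_spec theta (S k) H I). nra.
Qed.

Lemma cf_err_lt (theta : R) (k : nat) :
  0 < theta < 1 -> irrational theta -> cf_err theta (S k) < cf_err theta k.
Proof.
  intros H I. cbn [cf_err]. pose proof (cf_err_pos theta k H I).
  destruct (gauss_spec theta (S k) H I). nra.
Qed.

Lemma cf_err_rec (theta : R) (k : nat) :
  0 < theta < 1 -> irrational theta ->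
  cf_err theta (S (S k)) = cf_err theta k - INR (cf_a theta (S k)) * cf_err theta (S k).
Proof.
  intros H I. destruct (cf_a_spec theta (S k) H I) as [_ E].
  destruct (gauss_spec theta (S k) H I) as [G _].
  change (cf_err theta (S (S k))) with (gauss theta (S (S k)) * cf_err theta (S k)).
  replace (gauss theta (S (S k))) with (1 / gauss theta (S k) - INR (cf_a theta (S k))) by lra.
  change (cf_err theta (S k)) with (gauss theta (S k) * cf_err theta k).
  field. lra.
Qed.

Lemma cf_err_1 (theta : R) :
  0 < theta < 1 -> irrational theta -> cf_err theta 1 = 1 - INR (cf_a theta 0) * theta.
Proof.
  intros H I. destruct (cf_a_spec theta 0 H I) as [_ E].
  cbn [cf_err]. replace (gauss theta 1) with (1 / theta - INR (cf_a theta 0)).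
  - field. lra.
  - change (gauss theta 0) with theta in E. lra.
Qed.

Lemma nat_two_step (P : nat -> Prop) :
  P 0%nat -> P 1%nat -> (forall k, P k -> P (S k) -> P (S (S k))) -> forall k, P k.
Proof.
  intros H0 H1 HS k. enough (P k /\ P (S k)) by tauto.
  induction k as [|k [A B]]; split; auto.
Qed.

Lemma cf_signed_err (theta : R) (k : nat) :
  0 < theta < 1 -> irrational theta ->
  INR (cf_q theta k) * theta - IZR (cf_p theta k) = (-1) ^ k * cf_err theta k.
Proof.
  intros H I. induction k as [| |k IH1 IH2] using nat_two_step.
  - unfold cf_q, cf_p; simpl; lra.
  - rewrite cf_q_1, cf_p_1, cf_err_1 by trivial. simpl; ring.
  - rewrite cf_q_SS, cf_p_SS, cf_err_rec by trivial.
    rewrite plus_INR, mult_INR, plus_IZR, mult_IZR, <- INR_IZR_INZ.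
    cbn [pow] in *. nra.
Qed.

Lemma cf_det (theta : R) (k : nat) :
  (cf_p theta (S k) * Z.of_nat (cf_q theta k)
   - cf_p theta k * Z.of_nat (cf_q theta (S k)) = (-1) ^ Z.of_nat k)%Z.
Proof.
  induction k as [|k IH].
  - rewrite cf_p_1. reflexivity.
  - rewrite cf_p_SS, cf_q_SS, Nat2Z.inj_succ, Z.pow_succ_r by lia. rewrite <- IH.
    rewrite Nat2Z.inj_add, Nat2Z.inj_mul. ring.
Qed.

(** The determinant identity in terms of errors: the signed errors alternate, so the two products
    add up instead of cancelling. As the second summand is positive and at most the first, 1 / (2
    q_{k+1}) <= |q_k theta - p_k| < 1 / q_{k+1} follows. *)
Lemma cf_err_q (theta : R) (k : nat) :
  0 < theta < 1 -> irrational theta ->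
  INR (cf_q theta (S k)) * cf_err theta k + INR (cf_q theta k) * cf_err theta (S k) = 1.
Proof.
  intros H I. induction k as [|k IH].
  - rewrite cf_q_1, cf_err_1 by trivial. unfold cf_q; simpl; ring.
  - rewrite cf_q_SS, cf_err_rec, plus_INR, mult_INR by trivial. lra.
Qed.

Lemma cf_err_upper (theta : R) (k : nat) :
  0 < theta < 1 -> irrational theta -> INR (cf_q theta (S k)) * cf_err theta k < 1.
Proof.
  intros H I. pose proof (cf_err_q theta k H I). pose proof (cf_err_pos theta (S k) H I).
  pose proof (lt_0_INR _ (cf_q_pos theta k H I)). nra.
Qed.

Lemma cf_err_lower (theta : R) (k : nat) :
  0 < theta < 1 -> irrational theta -> 1 <= 2 * INR (cf_q theta (S k)) * cf_err theta k.
Proof.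
  intros H I. pose proof (cf_err_q theta k H I). pose proof (cf_err_pos theta (S k) H I).
  pose proof (cf_err_lt theta k H I).
  destruct (cf_q_mono_pos theta k H I) as [A B].
  pose proof (lt_0_INR _ A). pose proof (le_INR _ _ B). nra.
Qed.

(** For k >= 1 one has q_{k+1} >= k + 1 >= 2, so the error is below 1/2 and p_k is the nearest
    integer. At k = 0 this fails when theta > 1/2, which is why indices start at 1 from here on. *)
Lemma dZ_cf_q (theta : R) (k : nat) :
  0 < theta < 1 -> irrational theta -> (1 <= k)%nat ->
  dZ (INR (cf_q theta k) * theta) = cf_err theta k.
Proof.
  intros H I hk. pose proof (cf_err_pos theta k H I) as P.
  assert (A : Rabs (INR (cf_q theta k) * theta - IZR (cf_p theta k)) = cf_err theta k).
  { rewrite cf_signed_err, Rabs_mult, pow_1_abs, Rmult_1_l by trivial. apply Rabs_right; lra. }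
  rewrite <- A. apply dZ_eq_abs. rewrite A.
  pose proof (cf_err_upper theta k H I).
  assert (h : (2 <= cf_q theta (S k))%nat) by (pose proof (cf_q_ge_index theta (S k) H I); lia).
  apply le_INR in h. simpl (INR 2) in h. nra.
Qed.

(* Writing (j, p) in the unimodular basis (q_k, p_k), (q_{k+1}, p_{k+1}), the two
   contributions to j theta - p have the same sign. *)
Lemma cf_best_approx (theta : R) (k j : nat) :
  0 < theta < 1 -> irrational theta -> (1 <= j)%nat -> (j < cf_q theta (S k))%nat ->
  cf_err theta k <= dZ (INR j * theta).
Proof.
  intros H I h1 h2. destruct (dZ_attained (INR j * theta)) as [p ->].
  pose proof (cf_det theta k) as D.
  set (q0 := Z.of_nat (cf_q theta k)) in *. set (q1 := Z.of_nat (cf_q theta (S k))) in *.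
  set (p0 := cf_p theta k) in *. set (p1 := cf_p theta (S k)) in *.
  set (e := ((-1) ^ Z.of_nat k)%Z) in *.
  assert (He : (e * e = 1)%Z).
  { unfold e. rewrite <- Z.pow_mul_l. apply Z.pow_1_l; lia. }
  set (a := (e * (Z.of_nat j * p1 - p * q1))%Z). set (b := (e * (p * q0 - Z.of_nat j * p0))%Z).
  assert (Ej : (Z.of_nat j = a * q0 + b * q1)%Z).
  { transitivity (Z.of_nat j * (e * e))%Z; [rewrite He; ring|]. rewrite <- D at 2.
    unfold a, b; ring. }
  assert (Ep : (p = a * p0 + b * p1)%Z).
  { transitivity (p * (e * e))%Z; [rewrite He; ring|]. rewrite <- D at 2. unfold a, b; ring. }
  clearbody a b.
  assert (Q0 : (1 <= q0)%Z) by (unfold q0; pose proof (cf_q_pos theta k H I); lia).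
  assert (Q1 : (1 <= q1)%Z) by (unfold q1; lia).
  assert (J : (1 <= Z.of_nat j < q1)%Z) by (unfold q1; lia).
  assert (S0 := cf_signed_err theta k H I). assert (S1 := cf_signed_err theta (S k) H I).
  pose proof (cf_err_pos theta k H I). pose proof (cf_err_pos theta (S k) H I).
  assert (V : INR j * theta - IZR p
     = (-1) ^ k * (IZR a * cf_err theta k - IZR b * cf_err theta (S k))).
  { rewrite INR_IZR_INZ, Ej, Ep, !plus_IZR, !mult_IZR.
    unfold q0, q1, p0, p1. rewrite <- !INR_IZR_INZ. cbn [pow] in S1. nra. }
  rewrite V, Rabs_mult, pow_1_abs, Rmult_1_l.
  destruct (Z.lt_trichotomy b 0) as [hb|[hb|hb]].
  - assert (ha : (1 <= a)%Z) by nia. assert (hb' : (b <= 0)%Z) by lia.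
    apply IZR_le in ha; apply IZR_le in hb'. rewrite Rabs_right; nra.
  - subst b. assert (ha : (1 <= a)%Z) by nia. apply IZR_le in ha. rewrite Rabs_right; nra.
  - assert (ha : (a <= -1)%Z) by nia. assert (hb' : (0 <= b)%Z) by lia.
    apply IZR_le in ha; apply IZR_le in hb'. rewrite Rabs_left; nra.
Qed.

Lemma cf_separation (theta : R) (k i j : nat) :
  0 < theta < 1 -> irrational theta ->
  (1 <= i <= cf_q theta (S k))%nat -> (1 <= j <= cf_q theta (S k))%nat -> i <> j ->
  cf_err theta k <= dZ (INR i * theta - INR j * theta).
Proof.
  intros H I hi hj n. destruct (le_lt_dec i j) as [h|h].
  - rewrite dZ_minus_sym, <- Rmult_minus_distr_r, <- minus_INR by lia.
    apply cf_best_approx; trivial; lia.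
  - rewrite <- Rmult_minus_distr_r, <- minus_INR by lia.
    apply cf_best_approx; trivial; lia.
Qed.

Lemma dZ_mult_pos (theta : R) (j : nat) :
  irrational theta -> (1 <= j)%nat -> 0 < dZ (INR j * theta).
Proof.
  intros I h. destruct (dZ_nonneg (INR j * theta)) as [|E]; trivial. exfalso.
  destruct (dZ_attained (INR j * theta)) as [z E']. rewrite <- E in E'.
  apply I. exists z, j. split; [lia|].
  destruct (Req_dec (INR j * theta - IZR z) 0) as [e|e]; [lra|].
  apply Rabs_no_R0 in e. lra.
Qed.

Lemma pow_m1_cases (k : nat) : (-1) ^ k = 1 \/ (-1) ^ k = -1.
Proof. induction k as [|k [IH|IH]]; simpl; rewrite ?IH; lra. Qed.

(* The residue c is i p_k with i = +- c q_{k-1} modulo q_k. *)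
Lemma cf_grid (theta : R) (k : nat) (c : Z) :
  0 < theta < 1 -> irrational theta -> (1 <= k)%nat ->
  exists (i : nat) (z : Z) (t : R), (1 <= i <= cf_q theta k)%nat /\
    INR i * theta - IZR z = IZR c / INR (cf_q theta k) + (-1) ^ k * t /\
    0 < t <= cf_err theta k.
Proof.
  intros H I hk. destruct k as [|k]; [lia|].
  pose proof (cf_det theta k) as D. set (e := ((-1) ^ Z.of_nat k)%Z) in *.
  assert (He : (e * e = 1)%Z).
  { unfold e. rewrite <- Z.pow_mul_l. apply Z.pow_1_l; lia. }
  set (N := cf_q theta (S k)) in *. set (P := cf_p theta (S k)) in *.
  assert (N1 : (1 <= N)%nat) by (apply cf_q_pos; trivial).
  (* The shift by 1 makes the index r + 1 run over 1, ..., q rather than 0, ..., q - 1, since index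
     0 is not allowed. *)
  set (w := (e * c * Z.of_nat (cf_q theta k) - 1)%Z).
  pose proof (Z.mod_pos_bound w (Z.of_nat N) ltac:(lia)) as B.
  pose proof (Z_div_mod_eq_full w (Z.of_nat N)) as E.
  set (r := (w mod Z.of_nat N)%Z) in *. set (d := (w / Z.of_nat N)%Z) in *.
  exists (Z.to_nat (r + 1)), (e * c * cf_p theta k - d * P)%Z,
    (INR (Z.to_nat (r + 1)) * cf_err theta (S k) / INR N).
  assert (iE : INR (Z.to_nat (r + 1)) = IZR (r + 1)).
  { rewrite INR_IZR_INZ, Z2Nat.id by lia. trivial. }
  assert (Np : 0 < INR N) by (apply lt_0_INR; lia).
  pose proof (cf_err_pos theta (S k) H I) as Pe.
  assert (R1 : 1 <= IZR (r + 1) <= INR N).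
  { rewrite INR_IZR_INZ. split; apply IZR_le; lia. }
  split; [lia|]. split.
  - pose proof (cf_signed_err theta (S k) H I) as Se. fold N P in Se.
    assert (Zc : ((r + 1) * P = c + (e * c * cf_p theta k - d * P) * Z.of_nat N)%Z).
    { assert (r + 1 = e * c * Z.of_nat (cf_q theta k) - Z.of_nat N * d)%Z as -> by (unfold w in E; lia).
      transitivity (c * (e * e) + (e * c * cf_p theta k - d * P) * Z.of_nat N)%Z;
        [|rewrite He; ring]. rewrite <- D at 3. ring. }
    set (z := (e * c * cf_p theta k - d * P)%Z) in *.
    apply (f_equal IZR) in Zc. rewrite plus_IZR, !mult_IZR, <- INR_IZR_INZ in Zc.
    rewrite iE. set (s := (-1) ^ S k) in *. set (x := IZR (r + 1)) in *.
    replace (IZR c) with (x * IZR P - IZR z * INR N) by lra.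
    replace (IZR P) with (INR N * theta - s * cf_err theta (S k)) by lra.
    field. lra.
  - rewrite iE. split.
    + apply Rdiv_lt_0_compat; nra.
    + apply (Rmult_le_reg_r (INR N)); trivial. field_simplify; [|lra]. nra.
Qed.

(** The points i theta are displaced from the grid of the c / q_k by less than 1 / q_k, all towards
    the same side. Rounding y to the grid in the opposite direction puts y and the displaced point
    into the same cell, hence the bound 1 / q_k without a factor 2. *)
Lemma cf_covering (theta : R) (k : nat) (y : R) :
  0 < theta < 1 -> irrational theta -> (1 <= k)%nat ->
  exists n : nat, (1 <= n <= cf_q theta k)%nat /\
    dZ (INR n * theta - y) < / INR (cf_q theta k).
Proof.
  intros H I hk. set (N := INR (cf_q theta k)).
  assert (Np : 0 < N) by (apply lt_0_INR, cf_q_pos; trivial).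
  assert (eN : cf_err theta k < / N).
  { pose proof (cf_err_upper theta k H I). destruct (cf_q_mono_pos theta k H I) as [_ h].
    apply le_INR in h. fold N in h. pose proof (cf_err_pos theta k H I).
    apply (Rmult_lt_reg_l N); trivial. rewrite Rinv_r by lra. nra. }
  destruct (pow_m1_cases k) as [s|s].
  - destruct (base_Int_part (y * N)) as [b1 b2]. set (c := Int_part (y * N)) in *.
    destruct (cf_grid theta k c H I hk) as [i [z [t [hi [E ht]]]]].
    exists i; split; trivial. eapply Rle_lt_trans; [apply (dZ_le_abs _ z)|].
    replace (INR i * theta - y - IZR z) with (INR i * theta - IZR z - y) by ring.
    rewrite E, s. fold N. assert (IZR c / N <= y < IZR c / N + / N).
    { split; [apply (Rmult_le_reg_r N)|apply (Rmult_lt_reg_r N)]; trivial;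
        field_simplify; lra. }
    apply Rabs_def1; lra.
  - destruct (base_Int_part (- (y * N))) as [b1 b2]. set (c := Int_part (- (y * N))) in *.
    destruct (cf_grid theta k (- c) H I hk) as [i [z [t [hi [E ht]]]]].
    exists i; split; trivial. eapply Rle_lt_trans; [apply (dZ_le_abs _ z)|].
    replace (INR i * theta - y - IZR z) with (INR i * theta - IZR z - y) by ring.
    rewrite E, s, opp_IZR. fold N. assert (- IZR c / N - / N < y <= - IZR c / N).
    { split; [apply (Rmult_lt_reg_r N)|apply (Rmult_le_reg_r N)]; trivial;
        field_simplify; lra. }
    apply Rabs_def1; lra.
Qed.

(** * Finite sums and counting *)

Fixpoint lsum {A : Type} (f : A -> R) (l : list A) : R :=
  match l with
  | [] => 0
  | a :: l => f a + lsum f l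
  end.

Lemma lsum_nonneg {A : Type} (f : A -> R) (l : list A) :
  (forall a, In a l -> 0 <= f a) -> 0 <= lsum f l.
Proof.
  induction l as [|a l IH]; simpl; intros H; [lra|].
  assert (0 <= f a) by auto. assert (0 <= lsum f l) by auto. lra.
Qed.

Lemma lsum_le {A : Type} (f g : A -> R) (l : list A) :
  (forall a, In a l -> f a <= g a) -> lsum f l <= lsum g l.
Proof.
  induction l as [|a l IH]; simpl; intros H; [lra|].
  assert (f a <= g a) by auto. assert (lsum f l <= lsum g l) by auto. lra.
Qed.

Lemma lsum_const {A : Type} (c : R) (l : list A) : lsum (fun _ => c) l = c * INR (length l).
Proof.
  induction l as [|a l IH]; [simpl; ring|].
  cbn [length lsum]. rewrite S_INR, IH. ring.
Qed.

Lemma lsum_app {A : Type} (f : A -> R) (l1 l2 : list A) :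
  lsum f (l1 ++ l2) = lsum f l1 + lsum f l2.
Proof. induction l1 as [|a l IH]; simpl; rewrite ?IH; ring. Qed.

Lemma lsum_map {A B : Type} (h : A -> B) (f : B -> R) (l : list A) :
  lsum f (map h l) = lsum (fun a => f (h a)) l.
Proof. induction l as [|a l IH]; simpl; rewrite ?IH; trivial. Qed.

Lemma lsum_incl {A : Type} (f : A -> R) (l1 l2 : list A) :
  (forall a, 0 <= f a) -> NoDup l1 -> incl l1 l2 -> lsum f l1 <= lsum f l2.
Proof.
  intros P. revert l2. induction l1 as [|a l1 IH]; intros l2 N I.
  - apply lsum_nonneg; auto.
  - inversion N as [|a' l1' Na N1]; subst.
    destruct (in_split a l2) as [u [v E]]; [apply I; left; trivial|]. subst l2.
    assert (J : incl l1 (u ++ v)).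
    { intros b hb. assert (hb' : In b (u ++ a :: v)) by (apply I; right; trivial).
      apply in_app_or in hb'. apply in_or_app. destruct hb' as [|[->|]]; auto. contradiction. }
    specialize (IH _ N1 J). rewrite lsum_app in *. simpl. lra.
Qed.

Lemma lsum_scal {A : Type} (c : R) (f : A -> R) (l : list A) :
  lsum (fun a => c * f a) l = c * lsum f l.
Proof. induction l as [|a l IH]; simpl; rewrite ?IH; ring. Qed.

Lemma lsum_seq (f : nat -> R) (N : nat) : lsum f (seq 0 (S N)) = sum_f_R0 f N.
Proof.
  induction N as [|N IH]; [simpl; ring|].
  rewrite seq_S, lsum_app, IH. simpl. ring.
Qed.

Lemma lsum_sum_swap {A : Type} (F : A -> nat -> R) (l : list A) (N : nat) :
  lsum (fun a => sum_f_R0 (F a) N) l = sum_f_R0 (fun i => lsum (fun a => F a i) l) N.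
Proof.
  induction l as [|a l IH]; simpl.
  - rewrite sum_cte. ring.
  - rewrite IH. rewrite <- plus_sum. trivial.
Qed.

Lemma lsum_prod {A B : Type} (f : A -> B -> R) (l1 : list A) (l2 : list B) :
  lsum (fun p => f (fst p) (snd p)) (list_prod l1 l2) = lsum (fun a => lsum (f a) l2) l1.
Proof.
  induction l1 as [|a l1 IH]; simpl; trivial.
  rewrite lsum_app, IH, lsum_map. trivial.
Qed.

Lemma flat_map_length_le {A B : Type} (f : A -> list B) (l : list A) (c : R) :
  (forall a, In a l -> INR (length (f a)) <= c) ->
  INR (length (flat_map f l)) <= c * INR (length l).
Proof.
  induction l as [|a l IH]; intros H; [simpl; lra|].
  cbn [flat_map length]. rewrite length_app, plus_INR, S_INR.
  assert (INR (length (f a)) <= c) by (apply H; left; trivial).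
  assert (INR (length (flat_map f l)) <= c * INR (length l)).
  { apply IH. intros b hb; apply H; right; trivial. }
  lra.
Qed.

(** Pigeonhole: the integer part of [f a / gam] determines a, and it lies in an integer interval
    with at most 2 rho / gam + 2 elements. *)
Lemma separated_count {A : Type} (f : A -> R) (ls : list A) (x rho gam : R) :
  0 < gam -> 0 <= rho -> NoDup ls ->
  (forall a b, In a ls -> In b ls -> a <> b -> gam <= Rabs (f a - f b)) ->
  (forall a, In a ls -> Rabs (f a - x) <= rho) ->
  INR (length ls) <= 2 * rho / gam + 2.
Proof.
  intros Hg Hr ND Hs Hx.
  set (lo := Int_part ((x - rho) / gam)). set (hi := Int_part ((x + rho) / gam)).
  destruct (base_Int_part ((x - rho) / gam)) as [lo1 lo2].
  destruct (base_Int_part ((x + rho) / gam)) as [hi1 hi2]. fold lo in lo1, lo2. fold hi in hi1, hi2.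
  assert (Hlh : (lo <= hi)%Z).
  { assert ((x - rho) / gam <= (x + rho) / gam).
    { apply Rmult_le_compat_r; [apply Rlt_le, Rinv_0_lt_compat|]; lra. }
    assert (lo < hi + 1)%Z by (apply lt_IZR; rewrite plus_IZR; lra). lia. }
  set (h := fun a => Z.to_nat (Int_part (f a / gam) - lo)).
  assert (Hh : forall a, In a ls -> (lo <= Int_part (f a / gam) <= hi)%Z).
  { intros a ha. specialize (Hx a ha). destruct (base_Int_part (f a / gam)) as [b1 b2].
    assert (B : x - rho <= f a <= x + rho) by (revert Hx; unfold Rabs; destruct Rcase_abs; lra).
    assert ((x - rho) / gam <= f a / gam <= (x + rho) / gam).
    { split; apply Rmult_le_compat_r; try (apply Rlt_le, Rinv_0_lt_compat); lra. }
    assert (lo < Int_part (f a / gam) + 1)%Z by (apply lt_IZR; rewrite plus_IZR; lra).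
    assert (Int_part (f a / gam) < hi + 1)%Z by (apply lt_IZR; rewrite plus_IZR; lra). lia. }
  assert (ND' : NoDup (map h ls)).
  { apply NoDup_map_NoDup_ForallPairs; trivial. intros a b ha hb E.
    destruct (classic (a = b)) as [|n]; trivial. exfalso.
    specialize (Hs a b ha hb n). pose proof (Hh a ha). pose proof (Hh b hb).
    assert (E' : Int_part (f a / gam) = Int_part (f b / gam)) by (unfold h in E; lia).
    destruct (base_Int_part (f a / gam)) as [a1 a2], (base_Int_part (f b / gam)) as [b1 b2].
    rewrite E' in a1, a2.
    assert (fa : f a = f a / gam * gam) by (field; lra).
    assert (fb : f b = f b / gam * gam) by (field; lra).
    assert (-1 < f a / gam - f b / gam < 1) by lra.
    assert (- gam < f a - f b < gam) by nra.
    revert Hs; unfold Rabs; destruct Rcase_abs; lra. }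
  assert (I : incl (map h ls) (seq 0 (Z.to_nat (hi - lo + 1)))).
  { intros n hn. apply in_map_iff in hn. destruct hn as [a [<- ha]].
    apply in_seq. pose proof (Hh a ha). unfold h. lia. }
  pose proof (NoDup_incl_length ND' I) as L. rewrite length_map, length_seq in L.
  apply le_INR in L. rewrite (INR_IZR_INZ (Z.to_nat _)), Z2Nat.id in L by lia.
  rewrite plus_IZR, minus_IZR in L.
  assert (2 * rho / gam = (x + rho) / gam - (x - rho) / gam) by (field; lra). lra.
Qed.

(** * Hausdorff null sets *)

Lemma pow_half_sum (c : R) (N : nat) : 0 <= c ->
  sum_f_R0 (fun i => c * (/ 2) ^ S i) N <= c.
Proof.
  intros hc. assert (E : sum_f_R0 (fun i => c * (/ 2) ^ S i) N = c - c * (/ 2) ^ S N).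
  { induction N as [|N IH]; [simpl; field|].
    cbn [sum_f_R0]. rewrite IH. cbn [pow]. field. }
  rewrite E. assert (0 <= c * (/ 2) ^ S N) by (apply Rmult_le_pos; trivial; apply pow_le; lra).
  lra.
Qed.

Lemma H_null_union (s : R) (E : nat -> R -> Prop) :
  (forall K, H_null s (E K)) -> H_null s (fun x => exists K, E K x).
Proof.
  intros H eps delta he hd.
  assert (C : forall K, exists rU : (nat -> R) * (nat -> R -> Prop),
    (forall i, 0 < fst rU i <= delta) /\
    (forall i x y, snd rU i x -> snd rU i y -> dZ (x - y) <= fst rU i) /\
    (forall x, E K x -> exists i, snd rU i x) /\
    (forall N, sum_f_R0 (fun i => Rpower (fst rU i) s) N <= eps * (/ 2) ^ S K)).
  { intros K. destruct (H K (eps * (/ 2) ^ S K) delta) as [r [U HU]]; trivial.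
    - apply Rmult_lt_0_compat; trivial. apply pow_lt; lra.
    - exists (r, U); exact HU. }
  set (F := fun K => proj1_sig (constructive_indefinite_description _ (C K))).
  assert (HF := fun K => proj2_sig (constructive_indefinite_description _ (C K))).
  change (forall K,
    (forall i, 0 < fst (F K) i <= delta) /\
    (forall i x y, snd (F K) i x -> snd (F K) i y -> dZ (x - y) <= fst (F K) i) /\
    (forall x, E K x -> exists i, snd (F K) i x) /\
    (forall N, sum_f_R0 (fun i => Rpower (fst (F K) i) s) N <= eps * (/ 2) ^ S K)) in HF.
  clearbody F.
  exists (fun n => fst (F (fst (Cantor.of_nat n))) (snd (Cantor.of_nat n))),
    (fun n => snd (F (fst (Cantor.of_nat n))) (snd (Cantor.of_nat n))).
  split; [|split; [|split]].
  - intros i. apply HF.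
  - intros i. apply HF.
  - intros x [K hx]. destruct (HF K) as [_ [_ [h _]]]. destruct (h x hx) as [i hi].
    exists (Cantor.to_nat (K, i)). rewrite Cantor.cancel_of_to. exact hi.
  - intros N. rewrite <- lsum_seq.
    set (f := fun p : nat * nat => Rpower (fst (F (fst p)) (snd p)) s).
    rewrite <- (lsum_map Cantor.of_nat f).
    (* A pair with code at most N has both components at most N. The partial sum is thus dominated
       by a sum over a square, whose K-th row is at most eps 2^(-K-1). *)
    apply Rle_trans with (lsum f (list_prod (seq 0 (S N)) (seq 0 (S N)))).
    + apply lsum_incl.
      * intros a; unfold f, Rpower; apply Rlt_le, exp_pos.
      * apply NoDup_map_NoDup_ForallPairs; [|apply seq_NoDup].
        intros a b _ _; apply Cantor.of_nat_inj.
      * intros [a b] h. apply in_map_iff in h. destruct h as [n [En hn]].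
        apply in_seq in hn. pose proof (Cantor.to_nat_non_decreasing a b).
        rewrite <- En, Cantor.cancel_to_of in H0.
        apply in_prod; apply in_seq; lia.
    + unfold f. rewrite (lsum_prod (fun a b => Rpower (fst (F a) b) s)).
      rewrite lsum_seq. apply Rle_trans with (sum_f_R0 (fun i => eps * (/ 2) ^ S i) N).
      * apply sum_Rle. intros n _. rewrite lsum_seq. apply HF.
      * apply pow_half_sum; lra.
Qed.

(** [H_null] asks for a sequence of sets with positive radii. The surplus indices get empty sets
    with radii w_i^(1/s), whose s-th powers sum to at most eps/2; this takes s > 0. *)
Lemma H_null_finite_covers (s : R) (E : R -> Prop) : 0 < s ->
  (forall eps delta, 0 < eps -> 0 < delta ->
     exists (M : nat) (r : R) (V : nat -> R -> Prop), 0 < r <= delta /\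
       (forall i x y, V i x -> V i y -> dZ (x - y) <= r) /\
       (forall x, E x -> exists i, (i < M)%nat /\ V i x) /\
       INR M * Rpower r s <= eps) ->
  H_null s E.
Proof.
  intros hs H eps delta he hd.
  destruct (H (eps / 2) delta) as [M [r [V [hr [hV [hc hM]]]]]]; [lra|trivial|].
  set (w := fun i => eps / 2 * (/ 2) ^ S i).
  assert (wp : forall i, 0 < w i) by (intros i; apply Rmult_lt_0_compat; [lra|apply pow_lt; lra]).
  exists (fun i => if lt_dec i M then r else Rmin delta (Rpower (w i) (/ s))),
    (fun i x => (i < M)%nat /\ V i x).
  split; [|split; [|split]].
  - intros i. destruct (lt_dec i M); trivial. split; [|apply Rmin_l].
    apply Rmin_glb_lt; trivial. apply exp_pos.
  - intros i x y [h1 h2] [h3 h4]. destruct (lt_dec i M); [|contradiction]. apply (hV i); trivial.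
  - intros x hx. destruct (hc x hx) as [i hi]. exists i; trivial.
  - intros N.
    apply Rle_trans with
      (sum_f_R0 (fun i => (if lt_dec i M then Rpower r s else 0) + w i) N).
    + apply sum_Rle. intros i _. specialize (wp i). destruct (lt_dec i M); [lra|].
      rewrite Rplus_0_l.
      apply Rle_trans with (Rpower (Rpower (w i) (/ s)) s).
      * apply Rle_Rpower_l; [lra|]. split; [|apply Rmin_r].
        apply Rmin_glb_lt; trivial. apply exp_pos.
      * rewrite Rpower_mult, Rinv_l, Rpower_1 by lra. lra.
    + rewrite plus_sum.
      assert (A : forall n, sum_f_R0 (fun i => if lt_dec i M then Rpower r s else 0) n
                 <= INR (min (S n) M) * Rpower r s).
      { assert (P : 0 < Rpower r s) by apply exp_pos.
        induction n as [|n IH]; cbn [sum_f_R0].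
        - destruct (lt_dec 0 M).
          + replace (Nat.min 1 M) with 1%nat by lia. simpl; lra.
          + replace (Nat.min 1 M) with 0%nat by lia. simpl; lra.
        - destruct (lt_dec (S n) M).
          + replace (Nat.min (S (S n)) M) with (S (Nat.min (S n) M)) by lia.
            rewrite S_INR. lra.
          + replace (Nat.min (S (S n)) M) with (Nat.min (S n) M) by lia. lra. }
      specialize (A N). pose proof (pow_half_sum (eps / 2) N ltac:(lra)) as B. fold w in B.
      assert (INR (min (S N) M) * Rpower r s <= INR M * Rpower r s).
      { apply Rmult_le_compat_r; [apply Rlt_le, exp_pos|]. apply le_INR; lia. }
      change (sum_f_R0 w N <= eps / 2) in B. lra.
Qed.

Lemma H_null_subset (s : R) (E F : R -> Prop) :
  (forall x, E x -> F x) -> H_null s F -> H_null s E.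
Proof.
  intros S H eps delta he hd. destruct (H eps delta he hd) as [r [U [h1 [h2 [h3 h4]]]]].
  exists r, U. repeat split; auto; apply h1.
Qed.

(** Subtracting from each [a i] the integer closest to [a i - x] moves the circle points near x to
    real points near x. Distances on the line dominate those on the circle, so the lifts stay
    separated and [separated_count] applies. *)
Lemma circle_neighbours_count (a : nat -> R) (B : nat) (x rho gam : R) :
  0 < gam -> 0 <= rho ->
  (forall i j, (1 <= i <= B)%nat -> (1 <= j <= B)%nat -> i <> j -> gam <= dZ (a i - a j)) ->
  INR (length (filter (fun i => if Rle_dec (dZ (a i - x)) rho then true else false) (seq 1 B)))
    <= 2 * rho / gam + 2.
Proof.
  intros hg hr hs.
  set (z := fun i => proj1_sig (constructive_indefinite_description _ (dZ_attained (a i - x)))).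
  assert (hz : forall i, dZ (a i - x) = Rabs (a i - x - IZR (z i))).
  { intros i. unfold z. destruct constructive_indefinite_description; trivial. }
  clearbody z.
  assert (HI : forall i, In i (filter (fun i => if Rle_dec (dZ (a i - x)) rho then true else false)
     (seq 1 B)) -> (1 <= i <= B)%nat /\ dZ (a i - x) <= rho).
  { intros i hi. apply filter_In in hi. destruct hi as [h1 h2]. apply in_seq in h1.
    destruct Rle_dec; [|discriminate]. split; trivial; lia. }
  apply (separated_count (fun i => a i - IZR (z i)) _ x); trivial.
  - apply NoDup_filter, seq_NoDup.
  - intros i j hi hj n. apply HI in hi, hj.
    eapply Rle_trans; [apply (hs i j); tauto|].
    eapply Rle_trans; [apply (dZ_le_abs _ (z i - z j))|].
    rewrite minus_IZR. right; f_equal; ring.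
  - intros i hi. apply HI in hi. destruct hi as [_ hi]. rewrite hz in hi.
    replace (a i - IZR (z i) - x) with (a i - x - IZR (z i)) by ring. trivial.
Qed.

(** Descent by levels: if y is within 2 l_k of a centre and within 2 l_{k+1} of a centre of the next
    level, these centres are within 4 l_k of each other. Each kept centre therefore needs at most 16
    l_k / g_{k+1} + 2 successors, and the 2 is absorbed by 1 <= C l_k / g_{k+1}. The quotients l_k /
    g_{k+1} multiply up to H_k / H_K. *)
Lemma cover_lists (a l g H : nat -> R) (B : nat -> nat) (C : R) (K : nat) (E : R -> Prop) :
  0 <= C ->
  (forall k, (K <= k)%nat -> 0 < l k /\ 0 < g k /\ l (S k) <= l k /\ g (S k) <= C * l k) ->
  (forall k i j, (K <= k)%nat -> (1 <= i <= B k)%nat -> (1 <= j <= B k)%nat -> i <> j ->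
     g k / 2 <= dZ (a i - a j)) ->
  (forall k, (K <= k)%nat -> 0 < H k /\ H (S k) = H k * (l k / g (S k))) ->
  (forall y, E y -> forall k, (K <= k)%nat ->
     exists i, (1 <= i <= B k)%nat /\ dZ (y - a i) <= 2 * l k) ->
  forall k, (K <= k)%nat -> exists I : list nat,
    (forall y, E y -> exists i, In i I /\ dZ (y - a i) <= 2 * l k) /\
    INR (length I) * H K <= INR (B K) * (16 + 2 * C) ^ (k - K) * H k.
Proof.
  intros hC hlg hsep hH hE k hk. induction hk as [|k hk [I [I1 I2]]].
  - exists (seq 1 (B K)). split.
    + intros y hy. destruct (hE y hy K (Nat.le_refl K)) as [i [hi1 hi2]].
      exists i; split; trivial. apply in_seq; lia.
    + rewrite length_seq, Nat.sub_diag. simpl. lra.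
  - destruct (hlg k hk) as [l0 [g0 [l1 g1]]].
    destruct (hlg (S k) ltac:(lia)) as [l0' [g0' _]].
    destruct (hH k hk) as [H0 H1]. destruct (hH K (Nat.le_refl K)) as [HK _].
    set (f := fun i => filter
      (fun j => if Rle_dec (dZ (a j - a i)) (4 * l k) then true else false) (seq 1 (B (S k)))).
    exists (flat_map f I). split.
    + intros y hy. destruct (I1 y hy) as [i [hi1 hi2]].
      destruct (hE y hy (S k) ltac:(lia)) as [j [hj1 hj2]].
      exists j; split; trivial. apply in_flat_map. exists i; split; trivial.
      apply filter_In. split; [apply in_seq; lia|].
      destruct Rle_dec as [|n]; trivial. exfalso; apply n.
      pose proof (dZ_triang (a j) y (a i)) as T. rewrite (dZ_minus_sym (a j) y) in T. lra.
    + assert (F : forall i, In i I -> INR (length (f i)) <= (16 + 2 * C) * (l k / g (S k))).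
      { intros i _. eapply Rle_trans;
          [apply (circle_neighbours_count a (B (S k)) (a i) (4 * l k) (g (S k) / 2)); try lra|].
        - intros u v hu hv n. apply hsep; trivial; lia.
        - assert (1 <= C * (l k / g (S k))).
          { apply (Rmult_le_reg_r (g (S k))); trivial. field_simplify; lra. }
          replace (2 * (4 * l k) / (g (S k) / 2)) with (16 * (l k / g (S k))) by (field; lra). lra. }
      apply flat_map_length_le in F.
      replace (S k - K)%nat with (S (k - K)) by lia. cbn [pow]. rewrite H1.
      assert (P : 0 < l k / g (S k)) by (apply Rdiv_lt_0_compat; trivial).
      apply Rle_trans with ((16 + 2 * C) * (l k / g (S k)) * (INR (length I) * H K)).
      * rewrite <- Rmult_assoc. apply Rmult_le_compat_r; lra.
      * eapply Rle_trans; [apply Rmult_le_compat_l; [|exact I2]|].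
        -- apply Rmult_le_pos; lra.
        -- right; ring.
Qed.

(** The level from which y is trapped depends on y. The set is therefore split into countably many
    parts with a common starting level, and a single good level k suffices to cover each part. *)
Lemma cover_null (a l g H : nat -> R) (B : nat -> nat) (C s : R) (K : nat) (E : R -> Prop) :
  0 <= C -> 0 < s ->
  (forall k, (K <= k)%nat -> 0 < l k /\ 0 < g k /\ l (S k) <= l k /\ g (S k) <= C * l k) ->
  (forall k i j, (K <= k)%nat -> (1 <= i <= B k)%nat -> (1 <= j <= B k)%nat -> i <> j ->
     g k / 2 <= dZ (a i - a j)) ->
  (forall k, (K <= k)%nat -> 0 < H k /\ H (S k) = H k * (l k / g (S k))) ->
  (forall y, E y -> exists K1, forall k, (K1 <= k)%nat ->
     exists i, (1 <= i <= B k)%nat /\ dZ (y - a i) <= 2 * l k) ->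
  (forall eps K1, 0 < eps -> exists k, (K1 <= k)%nat /\
     l k <= eps /\ (16 + 2 * C) ^ k * H k * Rpower (l k) s <= eps) ->
  H_null s E.
Proof.
  intros hC hs hlg hsep hH hE hsm.
  apply (H_null_subset s E (fun y => exists K1, forall k, (max K K1 <= k)%nat ->
     exists i, (1 <= i <= B k)%nat /\ dZ (y - a i) <= 2 * l k)).
  { intros y hy. destruct (hE y hy) as [K1 h]. exists K1. intros k hk. apply h. lia. }
  apply H_null_union. intros K1. apply H_null_finite_covers; trivial.
  intros eps delta he hd. set (K' := max K K1).
  assert (HK' : 0 < H K') by (apply hH; lia).
  set (b := INR (B K') / H K').
  assert (b0 : 0 <= b).
  { apply Rmult_le_pos; [apply pos_INR|]. apply Rlt_le, Rinv_0_lt_compat; trivial. }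
  assert (P4 : 0 < Rpower 4 s) by apply exp_pos.
  (* The sets have diameter at most 4 l_k, and the cost of the cover is at most b 4^s eta. The
     summand 1 keeps the denominator positive even if b = 0. *)
  set (eta := Rmin (delta / 4) (eps / ((b + 1) * Rpower 4 s))).
  assert (D : 0 < (b + 1) * Rpower 4 s) by nra.
  assert (eta0 : 0 < eta).
  { apply Rmin_glb_lt; [lra|]. apply Rdiv_lt_0_compat; trivial. }
  destruct (hsm eta K' eta0) as [k [hk [lk sk]]].
  destruct (cover_lists a l g H B C K' (fun y => forall k, (K' <= k)%nat ->
     exists i, (1 <= i <= B k)%nat /\ dZ (y - a i) <= 2 * l k)) with (k := k)
    as [I [I1 I2]]; trivial.
  { intros j hj; apply hlg; lia. }
  { intros j u v hj; apply hsep; lia. }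
  { intros j hj; apply hH; lia. }
  destruct (hlg k ltac:(lia)) as [l0 _]. destruct (hH k ltac:(lia)) as [Hk0 _].
  exists (length I), (4 * l k), (fun n y => dZ (y - a (nth n I 0%nat)) <= 2 * l k).
  split; [|split; [|split]].
  - assert (eta <= delta / 4) by apply Rmin_l. lra.
  - intros i x y hx hy. pose proof (dZ_triang x (a (nth i I 0%nat)) y) as T.
    rewrite (dZ_minus_sym (a _) y) in T. lra.
  - intros x hx. destruct (I1 x hx) as [i [hi1 hi2]].
    apply (In_nth I i 0%nat) in hi1. destruct hi1 as [n [hn1 hn2]].
    exists n; split; trivial. rewrite hn2; trivial.
  - rewrite <- Rpower_mult_distr by lra.
    assert (L : INR (length I) <= b * ((16 + 2 * C) ^ k * H k)).
    { apply (Rmult_le_reg_r (H K')); trivial. eapply Rle_trans; [exact I2|].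
      unfold b. replace (INR (B K') / H K' * ((16 + 2 * C) ^ k * H k) * H K')
        with (INR (B K') * (16 + 2 * C) ^ k * H k) by (field; lra).
      apply Rmult_le_compat_r; [lra|]. apply Rmult_le_compat_l; [apply pos_INR|].
      apply Rle_pow; [lra|lia]. }
    assert (Pl : 0 < Rpower (l k) s) by apply exp_pos.
    apply Rle_trans with (b * Rpower 4 s * ((16 + 2 * C) ^ k * H k * Rpower (l k) s)).
    { replace (b * Rpower 4 s * ((16 + 2 * C) ^ k * H k * Rpower (l k) s)) with
        (b * ((16 + 2 * C) ^ k * H k) * (Rpower 4 s * Rpower (l k) s)) by ring.
      apply Rmult_le_compat_r; nra. }
    apply Rle_trans with (b * Rpower 4 s * (eps / ((b + 1) * Rpower 4 s))).
    { apply Rmult_le_compat_l; [nra|]. eapply Rle_trans; [exact sk|]. apply Rmin_r. }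
    apply Rle_trans with ((b + 1) * Rpower 4 s * (eps / ((b + 1) * Rpower 4 s))).
    { apply Rmult_le_compat_r; [apply Rlt_le, Rdiv_lt_0_compat; trivial|]. nra. }
    right; field; nra.
Qed.

(** * Mass distribution on Cantor-like sets *)

Definition ind (P : Prop) : R := if excluded_middle_informative P then 1 else 0.

Lemma ind_true (P : Prop) : P -> ind P = 1.
Proof. intros h; unfold ind; destruct excluded_middle_informative; tauto. Qed.

Lemma ind_false (P : Prop) : ~ P -> ind P = 0.
Proof. intros h; unfold ind; destruct excluded_middle_informative; tauto. Qed.

Lemma ind_nonneg (P : Prop) : 0 <= ind P.
Proof. unfold ind; destruct excluded_middle_informative; lra. Qed.

(** The radius is 2 L and not L because, by [nested_limit], the limit of a branch stays within 2 L_k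
    of its k-th node. Nodes are real numbers, so the sets on the circle are pulled back by
    [frac]. *)
Definition meets (U : nat -> R -> Prop) (i : nat) (x L : R) : Prop :=
  exists y, U i (frac y) /\ Rabs (y - x) <= 2 * L.

Lemma lsum_ind {A : Type} (P : A -> Prop) (l : list A) :
  lsum (fun a => ind (P a)) l =
  INR (length (filter (fun a => if excluded_middle_informative (P a) then true else false) l)).
Proof.
  induction l as [|a l IH]; [reflexivity|].
  cbn [lsum filter]. rewrite IH. unfold ind. destruct excluded_middle_informative.
  - cbn [length]. rewrite S_INR. ring.
  - ring.
Qed.

Lemma sum_f_R0_term_le (f : nat -> R) (i : nat) :
  (forall n, 0 <= f n) -> f i <= sum_f_R0 f i.
Proof.
  intros P. destruct i as [|i]; cbn [sum_f_R0]; [lra|].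
  pose proof (cond_pos_sum f i P). lra.
Qed.

Lemma sum_f_R0_le_index (f : nat -> R) (i j : nat) :
  (forall n, 0 <= f n) -> (i <= j)%nat -> sum_f_R0 f i <= sum_f_R0 f j.
Proof.
  intros P. induction 1 as [|j _ IH]; [lra|]. cbn [sum_f_R0]. specialize (P (S j)). lra.
Qed.

Lemma exists_common_bound {A : Type} (Q : A -> nat -> Prop) (l : list A) :
  (forall a i j, (i <= j)%nat -> Q a i -> Q a j) ->
  (forall a, In a l -> exists n, Q a n) -> exists N, forall a, In a l -> Q a N.
Proof.
  intros M. induction l as [|a l IH]; intros H; [exists 0%nat; simpl; tauto|].
  destruct IH as [N hN]; [intros b hb; apply H; right; trivial|].
  destruct (H a) as [n hn]; [left; trivial|].
  exists (max n N). intros b [<-|hb].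
  - apply (M a n); trivial; lia.
  - apply (M b N); auto; lia.
Qed.

(** Two children met by the same set are at distance at most r_i + 4 L' <= r_i + 2 gam / 5, so a set
    with r_i < gam / 2 meets at most one. Otherwise [separated_count] gives at most 2 r_i / gam +
    2.8, which is below 8 r_i / gam. The bound L <= 1/8 keeps all points involved within 1/2 of each
    other, where circle and line distance agree. *)
Lemma met_children_count (U : nat -> R -> Prop) (r : nat -> R) (i : nat) (x L L' gam : R)
  (ls : list R) :
  0 < gam -> 0 < L <= / 8 -> 0 < L' -> 10 * L' <= gam -> 2 * L' <= L -> 0 < r i ->
  (forall u v, U i u -> U i v -> dZ (u - v) <= r i) ->
  NoDup ls -> (forall a b, In a ls -> In b ls -> a <> b -> gam <= Rabs (a - b)) ->
  (forall a, In a ls -> Rabs (a - x) <= L) ->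
  lsum (fun a => ind (meets U i a L')) ls <= (if Rlt_dec (r i) (gam / 2) then 1 else 8 * (r i / gam)).
Proof.
  intros hg hL hL' h10 h2 hr hU ND sep near. rewrite lsum_ind.
  set (F := filter (fun a => if excluded_middle_informative (meets U i a L') then true else false) ls).
  assert (HF : forall a, In a F -> In a ls /\ meets U i a L').
  { intros a ha. apply filter_In in ha. destruct ha as [h1 h2'].
    destruct excluded_middle_informative; [tauto|discriminate]. }
  assert (ND' : NoDup F) by (apply NoDup_filter; trivial).
  assert (close : forall a b, In a F -> In b F -> Rabs (a - b) <= r i + 4 * L').
  { intros a b ha hb. destruct (HF a ha) as [ha1 [u [hu1 hu2]]].
    destruct (HF b hb) as [hb1 [v [hv1 hv2]]].
    pose proof (near a ha1) as na. pose proof (near b hb1) as nb.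
    assert (D : dZ (u - v) = Rabs (u - v)).
    { apply dZ_small. revert hu2 hv2 na nb; unfold Rabs; repeat destruct Rcase_abs; lra. }
    pose proof (hU _ _ hu1 hv1) as d. rewrite dZ_frac, D in d.
    revert hu2 hv2 d; unfold Rabs; repeat destruct Rcase_abs; lra. }
  clearbody F. destruct (Rlt_dec (r i) (gam / 2)) as [h|h].
  - destruct F as [|a [|b F]]; [simpl; lra|simpl; lra|]. exfalso.
    assert (n : a <> b) by (inversion ND' as [|? ? na _]; subst; intros ->; apply na; left; trivial).
    assert (ha : In a (a :: b :: F)) by (left; trivial).
    assert (hb : In b (a :: b :: F)) by (right; left; trivial).
    pose proof (close a b ha hb). destruct (HF a ha), (HF b hb).
    pose proof (sep a b ltac:(trivial) ltac:(trivial) n). lra.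
  - assert (hr' : / 2 <= r i / gam).
    { apply (Rmult_le_reg_r gam); trivial. field_simplify; lra. }
    destruct F as [|a F]; [simpl; lra|].
    apply Rle_trans with (2 * (r i + 4 * L') / gam + 2).
    + apply (separated_count (fun u => u) (a :: F) a); trivial; [lra| |].
      * intros u v hu hv n. apply sep; trivial; apply HF; trivial.
      * intros u hu. apply close; trivial; left; trivial.
    + assert (L' / gam <= / 10).
      { apply (Rmult_le_reg_r gam); trivial. field_simplify; lra. }
      replace (2 * (r i + 4 * L') / gam) with (2 * (r i / gam) + 8 * (L' / gam)) by (field; lra).
      lra.
Qed.

(* Weight the sets with r_i < gam/2 (which meet at most one child) by r_i^s m/(2c) and the
   others by 1: the total weight seen by the m children is at most m/2, so some child sees
   less than 1, hence none of the large sets. *)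
Lemma light_child (U : nat -> R -> Prop) (r : nat -> R) (s c beta gam L L' x : R) (ls : list R) :
  0 <= s <= 1 -> 0 < c -> 0 < beta <= 1 ->
  0 < gam -> 0 < L <= / 8 -> 0 < L' -> 10 * L' <= gam -> 2 * L' <= L ->
  (forall i, 0 < r i) -> (forall i u v, U i u -> U i v -> dZ (u - v) <= r i) ->
  ls <> [] -> NoDup ls ->
  (forall a b, In a ls -> In b ls -> a <> b -> gam <= Rabs (a - b)) ->
  (forall a, In a ls -> Rabs (a - x) <= L) ->
  beta * L <= INR (length ls) * gam -> 16 * c <= beta * Rpower L s ->
  (forall N, sum_f_R0 (fun i => ind (meets U i x L) * Rpower (r i) s) N <= c) ->
  exists a, In a ls /\ forall N,
    sum_f_R0 (fun i => ind (meets U i a L') * Rpower (r i) s) N <= 2 * c / INR (length ls).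
Proof.
  intros hs hc hb hg hL hL' h10 h2 hr hU ne ND sep near hm hcL W.
  set (m := INR (length ls)) in *.
  assert (hm0 : 0 < m).
  { apply lt_0_INR. destruct ls; [contradiction|simpl; lia]. }
  assert (rp : forall i, 0 < Rpower (r i) s) by (intros; apply exp_pos).
  assert (md : 0 < m / (2 * c)) by (apply Rdiv_lt_0_compat; lra).
  set (wt := fun i => if Rlt_dec (r i) (gam / 2) then Rpower (r i) s * (m / (2 * c)) else 1).
  assert (wp : forall i, 0 < wt i).
  { intros i; unfold wt; destruct Rlt_dec; [|lra]. apply Rmult_lt_0_compat; auto. }
  assert (tp : forall a i, 0 <= ind (meets U i a L') * wt i).
  { intros a i. apply Rmult_le_pos; [apply ind_nonneg|]. specialize (wp i); lra. }
  assert (G : exists a, In a ls /\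
     forall N, sum_f_R0 (fun i => ind (meets U i a L') * wt i) N < 1).
  { apply NNPP; intros NG.
    assert (B : exists N, forall a, In a ls ->
       1 <= sum_f_R0 (fun i => ind (meets U i a L') * wt i) N).
    { apply (exists_common_bound
        (fun a N => 1 <= sum_f_R0 (fun i => ind (meets U i a L') * wt i) N)).
      - intros a i j hij h. eapply Rle_trans; [exact h|]. apply sum_f_R0_le_index; auto.
      - intros a ha. apply NNPP; intros h. apply NG. exists a; split; trivial.
        intros N. apply Rnot_le_lt. intros h'. apply h. exists N; trivial. }
    destruct B as [N B].
    apply lsum_le in B. rewrite lsum_const, lsum_sum_swap, Rmult_1_l in B. fold m in B.
    assert (T : sum_f_R0 (fun i => lsum (fun a => ind (meets U i a L') * wt i) ls) N
      <= sum_f_R0 (fun i => ind (meets U i x L) * Rpower (r i) s * (m / (2 * c))) N).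
    { apply sum_Rle. intros i _. rewrite (Rmult_comm _ (m / (2 * c))).
      replace (lsum (fun a => ind (meets U i a L') * wt i) ls)
        with (wt i * lsum (fun a => ind (meets U i a L')) ls).
      2:{ rewrite <- lsum_scal. apply Rle_antisym; apply lsum_le; intros; right; ring. }
      destruct (classic (meets U i x L)) as [hx|hx].
      - rewrite (ind_true _ hx), Rmult_1_l.
        pose proof (met_children_count U r i x L L' gam ls hg hL hL' h10 h2 (hr i) (hU i)
          ND sep near) as cnt.
        unfold wt. destruct (Rlt_dec (r i) (gam / 2)) as [h|h].
        + assert (0 < Rpower (r i) s * (m / (2 * c))) by (apply Rmult_lt_0_compat; auto).
          nra.
        (* A set with r_i >= L meets at most all m children, and r_i^s >= L^s pays for that. For gam
           / 2 <= r_i < L the count 8 r_i / gam is compared with r_i^s through r_i^(1-s) <= L^(1-s),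
           which is where s <= 1 enters. *)
        + rewrite Rmult_1_l. destruct (Rle_lt_dec L (r i)) as [h'|h'].
          * apply Rle_trans with m.
            -- unfold m. rewrite lsum_ind. apply le_INR, filter_length_le.
            -- assert (Rpower L s <= Rpower (r i) s) by (apply Rle_Rpower_l; lra).
               assert (0 < Rpower L s) by apply exp_pos.
               apply (Rmult_le_reg_r (2 * c)); [lra|].
               replace (m / (2 * c) * Rpower (r i) s * (2 * c)) with (m * Rpower (r i) s)
                 by (field; lra).
               apply Rmult_le_compat_l; [lra|]. nra.
          * eapply Rle_trans; [exact cnt|].
            assert (Er : r i = Rpower (r i) s * Rpower (r i) (1 - s)).
            { rewrite <- Rpower_plus. replace (s + (1 - s)) with 1 by ring.
              rewrite Rpower_1; auto. }
            assert (EL : L = Rpower L s * Rpower L (1 - s)).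
            { rewrite <- Rpower_plus. replace (s + (1 - s)) with 1 by ring.
              rewrite Rpower_1; lra. }
            assert (M : Rpower (r i) (1 - s) <= Rpower L (1 - s)).
            { apply Rle_Rpower_l; [lra|]. split; [auto|lra]. }
            assert (P1 : 0 < Rpower L (1 - s)) by apply exp_pos.
            assert (Q1 : 16 * c * Rpower L (1 - s) <= m * gam).
            { eapply Rle_trans; [|exact hm]. rewrite EL at 2. rewrite <- Rmult_assoc.
              apply Rmult_le_compat_r; lra. }
            assert (Q2 : 16 * c * r i <= m * gam * Rpower (r i) s).
            { rewrite Er at 1. specialize (rp i).
              apply Rle_trans with (16 * c * Rpower L (1 - s) * Rpower (r i) s).
              - replace (16 * c * (Rpower (r i) s * Rpower (r i) (1 - s)))
                  with (16 * c * Rpower (r i) (1 - s) * Rpower (r i) s) by ring.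
                apply Rmult_le_compat_r; [lra|]. apply Rmult_le_compat_l; lra.
              - apply Rmult_le_compat_r; lra. }
            apply (Rmult_le_reg_r (2 * c * gam)); [nra|].
            replace (8 * (r i / gam) * (2 * c * gam)) with (16 * c * r i) by (field; lra).
            replace (m / (2 * c) * Rpower (r i) s * (2 * c * gam)) with
              (m * gam * Rpower (r i) s) by (field; lra). trivial.
      - rewrite (ind_false _ hx), Rmult_0_l, Rmult_0_r.
        assert (Z : lsum (fun a => ind (meets U i a L')) ls <= lsum (fun _ => 0) ls).
        { apply lsum_le. intros a ha. rewrite ind_false; [lra|].
          intros [y [hy1 hy2]]. apply hx. exists y; split; trivial.
          pose proof (near a ha) as na.
          revert hy2 na; unfold Rabs; repeat destruct Rcase_abs; lra. }
        rewrite lsum_const in Z. specialize (wp i). nra. }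
    rewrite <- scal_sum in T.
    pose proof (Rmult_le_compat_l _ _ _ (Rlt_le _ _ md) (W N)) as WN.
    replace (m / (2 * c) * c) with (m / 2) in WN by (field; lra).
    lra. }
  destruct G as [a [ha G]]. exists a; split; trivial. intros N.
  assert (E : sum_f_R0 (fun i => ind (meets U i a L') * Rpower (r i) s) N <=
    sum_f_R0 (fun i => ind (meets U i a L') * wt i * (2 * c / m)) N).
  { apply sum_Rle. intros i _. destruct (classic (meets U i a L')) as [h|h].
    - rewrite (ind_true _ h), !Rmult_1_l.
      assert (wt i < 1).
      { eapply Rle_lt_trans; [|apply (G i)].
        eapply Rle_trans; [|apply sum_f_R0_term_le; auto].
        rewrite (ind_true _ h). lra. }
      unfold wt in *. destruct Rlt_dec; [|lra]. right; field; lra.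
    - rewrite (ind_false _ h). lra. }
  rewrite <- scal_sum in E. specialize (G N).
  assert (0 < 2 * c / m) by (apply Rdiv_lt_0_compat; lra). nra.
Qed.

(** The intervals of radius 2 L_k around x_k are nested, because L_k + 2 L_{k+1} <= 2 L_k. The limit
    is the supremum of their left end points. *)
Lemma nested_limit (x L : nat -> R) (K : nat) :
  (forall k, (K <= k)%nat -> 0 < L k /\ 2 * L (S k) <= L k /\ Rabs (x (S k) - x k) <= L k) ->
  exists y, forall k, (K <= k)%nat -> Rabs (y - x k) <= 2 * L k.
Proof.
  intros h.
  assert (M : forall j k, (K <= j)%nat -> (j <= k)%nat ->
     x j - 2 * L j <= x k - 2 * L k /\ x k + 2 * L k <= x j + 2 * L j).
  { intros j k hj. induction 1 as [|k hk IH]; [lra|].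
    destruct (h k ltac:(lia)) as [_ [h1 h2]].
    revert h2; unfold Rabs; destruct Rcase_abs; lra. }
  assert (O : forall j k, (K <= j)%nat -> (K <= k)%nat -> x j - 2 * L j <= x k + 2 * L k).
  { intros j k hj hk. destruct (le_lt_dec j k) as [l|l].
    - destruct (M j k hj l), (h k hk). lra.
    - destruct (M k j hk ltac:(lia)), (h j hj). lra. }
  destruct (completeness (fun z => exists j, (K <= j)%nat /\ z = x j - 2 * L j)) as [y [y1 y2]].
  - exists (x K + 2 * L K). intros z [j [hj ->]]. apply O; lia.
  - exists (x K - 2 * L K), K. split; [lia|trivial].
  - exists y. intros k hk.
    assert (x k - 2 * L k <= y) by (apply y1; exists k; auto).
    assert (y <= x k + 2 * L k) by (apply y2; intros z [j [hj ->]]; apply O; auto).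
    apply Rabs_le; lra.
Qed.

Lemma dependent_choice_from (K : nat) (P : nat -> R -> Prop) (Q : nat -> R -> R -> Prop) (x0 : R) :
  P K x0 ->
  (forall k x, (K <= k)%nat -> P k x -> exists x', P (S k) x' /\ Q k x x') ->
  exists x : nat -> R, forall k, (K <= k)%nat -> P k (x k) /\ Q k (x k) (x (S k)).
Proof.
  intros h0 hS.
  (* The default 0 is never taken along the sequence: [hS] gives a successor to every x with
     [P k x]. *)
  set (next := fun k x => match excluded_middle_informative (exists x', P (S k) x' /\ Q k x x') with
    | left h => proj1_sig (constructive_indefinite_description _ h) | right _ => 0 end).
  assert (hn : forall k x, (K <= k)%nat -> P k x -> P (S k) (next k x) /\ Q k x (next k x)).
  { intros k x hk hx. unfold next. destruct excluded_middle_informative as [h|h].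
    - exact (proj2_sig (constructive_indefinite_description _ h)).
    - destruct (h (hS k x hk hx)). }
  clearbody next.
  set (p := fix p j := match j with O => x0 | S j => next (K + j)%nat (p j) end).
  assert (hp : forall j, P (K + j)%nat (p j)).
  { induction j as [|j IH]; [rewrite Nat.add_0_r; trivial|].
    rewrite Nat.add_succ_r. apply hn; [lia|trivial]. }
  exists (fun k => p (k - K)%nat). intros k hk.
  pose proof (hp (k - K)%nat) as h. replace (K + (k - K))%nat with k in h by lia.
  split; trivial. replace (S k - K)%nat with (S (k - K)) by lia.
  cbn [p]. replace (K + (k - K))%nat with k by lia. apply hn; trivial.
Qed.

(** Suppose a cover has total weight at most c_K. Repeated use of [light_child] gives a branch whose
    node x_k sees weight at most c_k, where c_k < L_k^s. The limit of the branch belongs to E, hence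
    to some U_i, and this U_i meets every node of the branch. So r_i^s <= c_k whenever r_i >= L_k,
    which is impossible; thus r_i < L_k for all k, against L_k becoming arbitrarily small. *)
Lemma cantor_not_null (E : R -> Prop) (l g H : nat -> R) (Node : nat -> R -> Prop)
  (Child : nat -> R -> R -> Prop) (c0 c1 A s : R) (K : nat) :
  0 <= s <= 1 -> 0 < c0 -> 0 < c1 -> 0 < A ->
  (forall k, (K <= k)%nat -> 0 < l k /\ 0 < g k /\ c0 * l k <= / 8 /\
     2 * l (S k) <= l k /\ 20 * c0 * l k <= g k) ->
  (forall k, (K <= k)%nat -> 0 < H k /\ H (S k) = H k * (l k / g (S k))) ->
  (forall eps, 0 < eps -> exists k, (K <= k)%nat /\ l k < eps) ->
  (exists x, Node K x) ->
  (forall k x, (K <= k)%nat -> Node k x -> exists ls, ls <> [] /\ NoDup ls /\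
     c1 * (l k / g (S k)) <= INR (length ls) /\
     (forall a b, In a ls -> In b ls -> a <> b -> g (S k) / 2 <= Rabs (a - b)) /\
     (forall a, In a ls -> Node (S k) a /\ Child k x a /\ Rabs (a - x) <= c0 * l k)) ->
  (forall x : nat -> R, (forall k, (K <= k)%nat -> Node k (x k) /\ Child k (x k) (x (S k)) /\
       Rabs (x (S k) - x k) <= c0 * l k) ->
     forall y, (forall k, (K <= k)%nat -> Rabs (y - x k) <= 2 * (c0 * l k)) -> E (frac y)) ->
  (forall k, (K <= k)%nat -> A * (2 / c1) ^ k <= H k * Rpower (l k) s) ->
  ~ H_null s E.
Proof.
  intros hs hc0 hc1 hA hlg hH hl0 [x0 hx0] hch hlim hdim hnull.
  set (L := fun k => c0 * l k).
  assert (Lp : forall k, (K <= k)%nat -> 0 < L k).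
  { intros k hk. destruct (hlg k hk). apply Rmult_lt_0_compat; trivial. }
  (* At least c1 l_k / g_{k+1} children with spacing g_{k+1} / 2 fill a length of c1 l_k / 2, that
     is c1 / (2 c0) times L_k. *)
  set (beta := Rmin 1 (c1 / (2 * c0))).
  assert (hb : 0 < beta <= 1).
  { split; [|apply Rmin_l]. apply Rmin_glb_lt; [lra|]. apply Rdiv_lt_0_compat; lra. }
  assert (pc0 : 0 < Rpower c0 s) by apply exp_pos.
  set (A0 := beta * Rpower c0 s * A / 16).
  assert (hA0 : 0 < A0).
  { unfold A0. apply Rdiv_lt_0_compat; [|lra]. repeat apply Rmult_lt_0_compat; lra. }
  (* The weight budget of level k. Passing to a light child multiplies it by 2 / m <= (2 / c1)
     g_{k+1} / l_k = (2 / c1) H_k / H_{k+1}; the factor A0 is such that 16 c_k <= beta L_k^s. *)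
  set (c := fun k => A0 * (2 / c1) ^ k / H k).
  assert (d0 : 0 < 2 / c1) by (apply Rdiv_lt_0_compat; lra).
  assert (cp : forall k, (K <= k)%nat -> 0 < c k).
  { intros k hk. destruct (hH k hk). apply Rdiv_lt_0_compat; trivial.
    apply Rmult_lt_0_compat; trivial. apply pow_lt; trivial. }
  assert (cL : forall k, (K <= k)%nat -> 16 * c k <= beta * Rpower (L k) s).
  { intros k hk. destruct (hH k hk) as [Hp _]. destruct (hlg k hk) as [lp _].
    unfold L. rewrite <- Rpower_mult_distr by lra.
    apply (Rmult_le_reg_r (H k)); trivial. unfold c.
    replace (16 * (A0 * (2 / c1) ^ k / H k) * H k) with
      (beta * Rpower c0 s * (A * (2 / c1) ^ k)) by (unfold A0; field; lra).
    replace (beta * (Rpower c0 s * Rpower (l k) s) * H k) with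
      (beta * Rpower c0 s * (H k * Rpower (l k) s)) by ring.
    apply Rmult_le_compat_l; [nra|]. auto. }
  destruct (hnull (c K) 1 (cp K (Nat.le_refl K)) ltac:(lra)) as [r [U [hr [hU [hcov hsum]]]]].
  assert (rp : forall i, 0 < r i) by (intros i; apply hr).
  set (W := fun k x => forall N,
    sum_f_R0 (fun i => ind (meets U i x (L k)) * Rpower (r i) s) N <= c k).
  destruct (dependent_choice_from K (fun k x => Node k x /\ W k x)
    (fun k x x' => Child k x x' /\ Rabs (x' - x) <= c0 * l k) x0) as [x hx].
  - split; trivial. intros N. eapply Rle_trans; [|apply (hsum N)].
    apply sum_Rle. intros i _. assert (0 < Rpower (r i) s) by apply exp_pos.
    unfold ind; destruct excluded_middle_informative; lra.
  - intros k x hk [hN hW]. destruct (hch k x hk hN) as [ls [h1 [h2 [h3 [h4 h5]]]]].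
    destruct (hlg k hk) as [lp [_ [l8 [l2 _]]]].
    destruct (hlg (S k) ltac:(lia)) as [lp' [gp' [_ [_ l20]]]].
    assert (q : 0 < l k / g (S k)) by (apply Rdiv_lt_0_compat; trivial).
    destruct (light_child U r s (c k) beta (g (S k) / 2) (L k) (L (S k)) x ls) as [a [ha hWa]];
      trivial.
    + apply cp; trivial.
    + lra.
    + split; [apply Lp; trivial|trivial].
    + apply Lp; lia.
    + unfold L; lra.
    + unfold L; nra.
    + intros a ha. apply h5; trivial.
    + apply Rle_trans with (c1 / (2 * c0) * L k).
      * apply Rmult_le_compat_r; [apply Rlt_le, Lp; trivial|]. apply Rmin_r.
      * unfold L. apply Rle_trans with (c1 * (l k / g (S k)) * (g (S k) / 2)).
        -- right; field; lra.
        -- apply Rmult_le_compat_r; lra.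
    + apply cL; trivial.
    + destruct (h5 a ha) as [n1 [n2 n3]]. exists a. split; [split|]; auto.
      intros N. eapply Rle_trans; [apply hWa|].
      destruct (hH k hk) as [Hp HS]. assert (ck := cp k hk).
      apply Rle_trans with (2 * c k / (c1 * (l k / g (S k)))).
      * apply Rmult_le_compat_l; [lra|]. apply Rinv_le_contravar; [nra|trivial].
      * right. unfold c. cbn [pow]. rewrite HS. field. lra.
  - destruct (nested_limit x L K) as [y hy].
    { intros k hk. destruct (hx k hk) as [_ [_ h]]. destruct (hlg k hk) as [_ [_ [_ [h2 _]]]].
      split; [auto|split; [unfold L; nra|exact h]]. }
    destruct (hcov (frac y)) as [i hi].
    { apply (hlim x); trivial. intros k hk. destruct (hx k hk) as [[? _] [? ?]]. auto. }
    assert (Hs : forall k, (K <= k)%nat -> r i < L k).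
    { intros k hk. apply Rnot_le_lt. intros hle. destruct (hx k hk) as [[_ hW] _].
      assert (hm : meets U i (x k) (L k)) by (exists y; auto).
      assert (Rpower (r i) s <= c k).
      { eapply Rle_trans; [|apply (hW i)].
        eapply Rle_trans; [|apply sum_f_R0_term_le].
        - rewrite (ind_true _ hm). lra.
        - intros n. apply Rmult_le_pos; [apply ind_nonneg|]. apply Rlt_le, exp_pos. }
      assert (Rpower (L k) s <= Rpower (r i) s) by (apply Rle_Rpower_l; [lra|]; split; auto).
      assert (0 < Rpower (L k) s) by apply exp_pos.
      pose proof (cL k hk). nra. }
    destruct (hl0 (r i / c0)) as [k [hk hlk]].
    { apply Rdiv_lt_0_compat; trivial. }
    specialize (Hs k hk). unfold L in Hs.
    apply (Rmult_lt_compat_l c0) in hlk; trivial.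
    replace (c0 * (r i / c0)) with (r i) in hlk by (field; lra). lra.
Qed.

(** * Dimension of a Cantor-like set *)

Lemma Rpower_pos (x y : R) : 0 < Rpower x y.
Proof. apply exp_pos. Qed.

Lemma ln_neg (x : R) : 0 < x < 1 -> ln x < 0.
Proof. intros h. rewrite <- ln_1. apply ln_increasing; lra. Qed.

Lemma ln_le_mono (x y : R) : 0 < x -> x <= y -> ln x <= ln y.
Proof. intros h [h1|h1]; [left; apply ln_increasing; trivial|subst; lra]. Qed.

Lemma ln_le_cancel (x y : R) : 0 < x -> 0 < y -> ln x <= ln y -> x <= y.
Proof. intros hx hy [h|h]; [left; apply ln_lt_inv; trivial|right; apply ln_inv; trivial]. Qed.

Lemma log_ratio_le_iff (h l t : R) : 0 < h -> 0 < l < 1 ->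
  (ln h / (- ln l) <= t <-> h <= Rpower l (- t)).
Proof.
  intros hh hl. pose proof (ln_neg l hl) as N. split; intros H.
  - apply ln_le_cancel; trivial; [apply Rpower_pos|]. rewrite ln_Rpower.
    apply (Rmult_le_compat_r (- ln l)) in H; [|lra].
    replace (ln h / - ln l * - ln l) with (ln h) in H by (field; lra). lra.
  - apply ln_le_mono in H; trivial. rewrite ln_Rpower in H.
    apply (Rmult_le_reg_r (- ln l)); [lra|].
    replace (ln h / - ln l * - ln l) with (ln h) by (field; lra). lra.
Qed.

Lemma log_ratio_ge_iff (h l t : R) : 0 < h -> 0 < l < 1 ->
  (t <= ln h / (- ln l) <-> Rpower l (- t) <= h).
Proof.
  intros hh hl. pose proof (ln_neg l hl) as N. split; intros H.
  - apply ln_le_cancel; trivial; [apply Rpower_pos|]. rewrite ln_Rpower.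
    apply (Rmult_le_compat_r (- ln l)) in H; [|lra].
    replace (ln h / - ln l * - ln l) with (ln h) in H by (field; lra). lra.
  - apply ln_le_mono in H; [|apply Rpower_pos]. rewrite ln_Rpower in H.
    apply (Rmult_le_reg_r (- ln l)); [lra|].
    replace (ln h / - ln l * - ln l) with (ln h) by (field; lra). lra.
Qed.

(** Any power of l_k, however small its exponent, absorbs any factor C^k. The exponent e will be the
    gap between two candidate dimensions and C the loss per level. *)
Definition superexp_small (l : nat -> R) : Prop :=
  forall C e, 0 < C -> 0 < e -> exists K, forall k, (K <= k)%nat -> C ^ k * Rpower (l k) e <= 1.

Lemma superexp_small_eps (l : nat -> R) (C e eps : R) :
  superexp_small l -> 0 < C -> 0 < e -> 0 < eps ->
  exists K, forall k, (K <= k)%nat -> C ^ k * Rpower (l k) e <= eps.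
Proof.
  intros h hC he heps. destruct (h (2 * C) e ltac:(lra) he) as [K1 h1].
  destruct (pow_lt_1_zero (/ 2) ltac:(rewrite Rabs_right; lra) eps heps) as [K2 h2].
  exists (max K1 K2). intros k hk. specialize (h1 k ltac:(lia)). specialize (h2 k ltac:(lia)).
  rewrite Rabs_right in h2 by (apply Rle_ge, pow_le; lra).
  rewrite Rpow_mult_distr in h1.
  assert (p2 : 0 < 2 ^ k) by (apply pow_lt; lra).
  assert (E : (/ 2) ^ k * 2 ^ k = 1) by (rewrite <- Rpow_mult_distr, Rinv_l, pow1; lra).
  assert (0 < (/ 2) ^ k) by (apply pow_lt; lra).
  apply Rle_trans with ((/ 2) ^ k); [|lra].
  replace (C ^ k * Rpower (l k) e) with ((/ 2) ^ k * (2 ^ k * C ^ k * Rpower (l k) e)).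
  - rewrite <- (Rmult_1_r ((/ 2) ^ k)) at 2. apply Rmult_le_compat_l; lra.
  - replace ((/ 2) ^ k * (2 ^ k * C ^ k * Rpower (l k) e)) with
      ((/ 2) ^ k * 2 ^ k * (C ^ k * Rpower (l k) e)) by ring. rewrite E; ring.
Qed.

Lemma superexp_small_lt (l : nat -> R) (K : nat) (eps : R) :
  superexp_small l -> (forall k, (K <= k)%nat -> 0 < l k) -> 0 < eps ->
  exists K', (K <= K')%nat /\ forall k, (K' <= k)%nat -> l k < eps.
Proof.
  intros h hp heps. destruct (superexp_small_eps l 1 1 (eps / 2) h) as [K1 h1]; try lra.
  exists (max K K1). split; [lia|]. intros k hk. specialize (h1 k ltac:(lia)).
  rewrite pow1, Rpower_1 in h1 by (apply hp; lia). lra.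
Qed.

(** [is_dimH] describes the infimum of the exponents s >= 0 with a null measure. It is a real number
    as soon as one such exponent is known. *)
Lemma dimension_of_nulls (E : R -> Prop) (s0 : R) : 0 <= s0 -> H_null s0 E ->
  exists d, is_dimH E d.
Proof.
  intros h0 h.
  destruct (completeness (fun x => exists s, 0 <= s /\ H_null s E /\ x = - s)) as [m [m1 m2]].
  - exists 0. intros x [s [hs [_ ->]]]. lra.
  - exists (- s0), s0. auto.
  - exists (- m). split.
    + intros s hs hn. assert (- s <= m) by (apply m1; exists s; auto). lra.
    + intros t ht. assert (m <= - t); [|lra].
      apply m2. intros x [s [hs [hn ->]]]. specialize (ht s hs hn). lra.
Qed.

(** Here u_k <= t means H_k <= l_k^(-t). If this happens infinitely often, the covers by pieces of
    those levels make E null for every positive s > t; if u_k >= t eventually, E is not null for s <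
    t in [0, 1]. The geometric factors in both directions are absorbed by l_k^|s - t|. The remaining
    restrictions on s are removed by the a priori bounds [lower] and [upper]. *)
Lemma cantor_dimension (E : R -> Prop) (a l g H u : nat -> R) (B : nat -> nat)
  (Node : nat -> R -> Prop) (Child : nat -> R -> R -> Prop) (c0 c1 C : R) (K : nat) :
  0 < c0 -> 0 < c1 -> 1 <= C -> superexp_small l ->
  (forall k, (K <= k)%nat -> 0 < l k /\ 0 < g k /\ c0 * l k <= / 8 /\
     2 * l (S k) <= l k /\ 20 * c0 * l k <= g k /\ g (S k) <= C * l k /\ l k <= C * g k) ->
  (forall k, (K <= k)%nat -> 0 < H k /\ H (S k) = H k * (l k / g (S k))) ->
  (forall k, (K <= k)%nat -> u k = ln (H k) / (- ln (l k))) ->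
  (forall k i j, (K <= k)%nat -> (1 <= i <= B k)%nat -> (1 <= j <= B k)%nat -> i <> j ->
     g k / 2 <= dZ (a i - a j)) ->
  (forall y, E y -> exists K1, forall k, (K1 <= k)%nat ->
     exists i, (1 <= i <= B k)%nat /\ dZ (y - a i) <= 2 * l k) ->
  (forall k, (K <= k)%nat -> exists x, Node k x) ->
  (forall k x, (K <= k)%nat -> Node k x -> exists ls, ls <> [] /\ NoDup ls /\
     c1 * (l k / g (S k)) <= INR (length ls) /\
     (forall a b, In a ls -> In b ls -> a <> b -> g (S k) / 2 <= Rabs (a - b)) /\
     (forall a, In a ls -> Node (S k) a /\ Child k x a /\ Rabs (a - x) <= c0 * l k)) ->
  (forall K1 (x : nat -> R), (K <= K1)%nat ->
     (forall k, (K1 <= k)%nat -> Node k (x k) /\ Child k (x k) (x (S k)) /\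
       Rabs (x (S k) - x k) <= c0 * l k) ->
     forall y, (forall k, (K1 <= k)%nat -> Rabs (y - x k) <= 2 * (c0 * l k)) -> E (frac y)) ->
  exists d, is_dimH E d /\ is_liminf u d.
Proof.
  intros hc0 hc1 hC hsm hlg hH hu hsep hcov hnode hch hlim.
  destruct (superexp_small_lt l K 1 hsm) as [K0 [hK0 l1]];
    [intros k hk; apply hlg; trivial|lra|].
  assert (lp : forall k, (K0 <= k)%nat -> 0 < l k < 1).
  { intros k hk. split; [apply hlg; lia|auto]. }
  assert (Hp : forall k, (K0 <= k)%nat -> 0 < H k) by (intros; apply hH; lia).
  assert (null : forall s t, 0 < s -> t < s ->
    (forall K1, exists k, (K1 <= k)%nat /\ u k <= t) -> H_null s E).
  { intros s t hs hts hio.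
    apply (cover_null a l g H B C s K); trivial; try lra.
    - intros k hk. destruct (hlg k hk) as [? [? [? [? [? [? ?]]]]]].
      destruct (hlg (S k) ltac:(lia)). repeat split; trivial; lra.
    - intros eps K1 heps.
      destruct (superexp_small_eps l (16 + 2 * C) (s - t) eps hsm) as [K2 h2]; try lra.
      destruct (superexp_small_lt l K eps hsm) as [K3 [_ h3]]; trivial.
      { intros k hk; apply hlg; trivial. }
      destruct (hio (max (max K0 K1) (max K2 K3))) as [k [hk huk]].
      exists k. split; [lia|]. split; [left; apply h3; lia|].
      eapply Rle_trans; [|apply (h2 k); lia].
      rewrite hu in huk by lia. apply log_ratio_le_iff in huk; [|apply Hp; lia|apply lp; lia].
      replace (s - t) with (- t + s) by ring. rewrite Rpower_plus, <- Rmult_assoc.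
      apply Rmult_le_compat_r; [apply Rlt_le, Rpower_pos|].
      apply Rmult_le_compat_l; [apply pow_le; lra|trivial]. }
  assert (notnull : forall s t K1, 0 <= s <= 1 -> s < t ->
    (forall k, (K1 <= k)%nat -> t <= u k) -> ~ H_null s E).
  { intros s t K1 hs hst hev.
    destruct (superexp_small_eps l (2 / c1) (t - s) 1 hsm) as [K2 h2]; try lra.
    { apply Rdiv_lt_0_compat; lra. }
    set (K' := max K0 (max K1 K2)).
    apply (cantor_not_null E l g H Node Child c0 c1 1 s K'); trivial; try lra.
    - intros k hk. destruct (hlg k ltac:(lia)) as [? [? [? [? [? _]]]]]. auto.
    - intros k hk. apply hH; lia.
    - intros eps heps. destruct (superexp_small_lt l K' eps hsm) as [K3 [h3 h3']]; trivial.
      { intros k hk; apply hlg; lia. }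
      exists K3. auto.
    - apply hnode; lia.
    - intros k x hk. apply hch; lia.
    - intros x. apply hlim; lia.
    - intros k hk. specialize (h2 k ltac:(lia)). specialize (hev k ltac:(lia)).
      rewrite hu in hev by lia. apply log_ratio_ge_iff in hev; [|apply Hp; lia|apply lp; lia].
      rewrite Rmult_1_l.
      apply Rle_trans with (Rpower (l k) (- t) * Rpower (l k) s).
      + rewrite <- Rpower_plus.
        apply (Rmult_le_reg_r (Rpower (l k) (t - s))); [apply Rpower_pos|].
        rewrite <- Rpower_plus. replace (- t + s + (t - s)) with 0 by ring.
        rewrite Rpower_O by (apply lp; lia). trivial.
      + apply Rmult_le_compat_r; [apply Rlt_le, Rpower_pos|trivial]. }
  (* From l_{k+1} <= C g_{k+1} the total length H_k l_k grows at most geometrically. This bounds u_k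
     by 1 up to a small error, so that exponent 2 is null and the exponents given to [notnull] are
     at most 1. *)
  assert (upper : forall eta, 0 < eta -> exists K1, forall k, (K1 <= k)%nat -> u k <= 1 + eta).
  { intros eta he.
    assert (G : forall k, (K0 <= k)%nat -> H k * l k <= H K0 * l K0 * C ^ k).
    { intros k hk. induction hk as [|k hk IH].
      - rewrite <- (Rmult_1_r (H K0 * l K0)) at 1. pose proof (pow_R1_Rle C K0 hC).
        specialize (Hp K0 ltac:(lia)). destruct (lp K0 ltac:(lia)).
        apply Rmult_le_compat_l; [nra|trivial].
      - destruct (hH k ltac:(lia)) as [H0 ->]. destruct (hlg k ltac:(lia)) as [l0 _].
        destruct (hlg (S k) ltac:(lia)) as [l0' [g0 [_ [_ [_ [_ lC]]]]]].
        cbn [pow]. apply Rle_trans with (C * (H k * l k)); [|nra].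
        apply (Rmult_le_reg_r (g (S k))); trivial.
        replace (H k * (l k / g (S k)) * l (S k) * g (S k)) with (H k * l k * l (S k))
          by (field; lra).
        replace (C * (H k * l k) * g (S k)) with (H k * l k * (C * g (S k))) by ring.
        apply Rmult_le_compat_l; [nra|trivial]. }
    set (b := H K0 * l K0) in *.
    assert (b0 : 0 < b) by (apply Rmult_lt_0_compat; [apply Hp|apply lp]; lia).
    destruct (superexp_small_eps l C eta (/ b) hsm) as [K1 h1]; try lra.
    { apply Rinv_0_lt_compat; trivial. }
    exists (max K0 K1). intros k hk. rewrite hu by lia.
    apply log_ratio_le_iff; [apply Hp; lia|apply lp; lia|].
    specialize (h1 k ltac:(lia)). specialize (G k ltac:(lia)).
    destruct (lp k ltac:(lia)) as [l0 _].
    apply (Rmult_le_reg_r (Rpower (l k) (1 + eta))); [apply Rpower_pos|].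
    rewrite <- Rpower_plus. replace (- (1 + eta) + (1 + eta)) with 0 by ring.
    rewrite Rpower_O by trivial. rewrite Rpower_plus, Rpower_1 by trivial.
    rewrite <- Rmult_assoc.
    apply Rle_trans with (b * (C ^ k * Rpower (l k) eta)).
    - rewrite <- Rmult_assoc. apply Rmult_le_compat_r; [apply Rlt_le, Rpower_pos|trivial].
    - replace 1 with (b * / b) by (field; lra). apply Rmult_le_compat_l; lra. }
  (* From g_{k+1} <= C l_k the count H_k decreases at most geometrically. This serves when d - eps <
     0, where [null], restricted to positive exponents, says nothing. *)
  assert (lower : forall eta, 0 < eta -> exists K1, forall k, (K1 <= k)%nat -> - eta <= u k).
  { intros eta he.
    assert (G : forall k, (K0 <= k)%nat -> H K0 <= H k * C ^ k).
    { intros k hk. induction hk as [|k hk IH].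
      - rewrite <- (Rmult_1_r (H K0)) at 1. pose proof (pow_R1_Rle C K0 hC).
        apply Rmult_le_compat_l; [apply Rlt_le, Hp; lia|trivial].
      - destruct (hH k ltac:(lia)) as [H0 ->]. destruct (hlg k ltac:(lia)) as [l0 [_ [_ [_ [_ [gC _]]]]]].
        destruct (hlg (S k) ltac:(lia)) as [_ [g0 _]].
        eapply Rle_trans; [exact IH|]. cbn [pow].
        assert (1 <= l k / g (S k) * C).
        { apply (Rmult_le_reg_r (g (S k))); trivial.
          replace (l k / g (S k) * C * g (S k)) with (C * l k) by (field; lra). lra. }
        assert (0 < C ^ k) by (apply pow_lt; lra).
        replace (H k * (l k / g (S k)) * (C * C ^ k)) with
          (H k * C ^ k * (l k / g (S k) * C)) by ring.
        rewrite <- (Rmult_1_r (H k * C ^ k)) at 1. apply Rmult_le_compat_l; [nra|trivial]. }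
    destruct (superexp_small_eps l C eta (H K0) hsm) as [K1 h1]; try lra.
    { apply Hp; lia. }
    exists (max K0 K1). intros k hk. rewrite hu by lia.
    apply log_ratio_ge_iff; [apply Hp; lia|apply lp; lia|].
    rewrite Ropp_involutive. specialize (h1 k ltac:(lia)). specialize (G k ltac:(lia)).
    assert (pC : 0 < C ^ k) by (apply pow_lt; lra).
    apply (Rmult_le_reg_l (C ^ k)); trivial. lra. }
  destruct (dimension_of_nulls E 2) as [d [d1 d2]]; [lra| |].
  { destruct (upper (/ 2) ltac:(lra)) as [K1 h1]. apply (null 2 (1 + / 2)); try lra.
    intros K2. exists (max K1 K2). split; [lia|]. apply h1; lia. }
  assert (dpos : 0 <= d) by (apply d2; trivial).
  exists d. split; [split; trivial|].
  intros eps heps. split.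
  - apply NNPP. intros no.
    assert (io : forall K1, exists k, (K1 <= k)%nat /\ u k <= d - eps).
    { intros K1. apply NNPP. intros n. apply no. exists K1. intros k hk.
      apply Rnot_le_lt. intros h. apply n. exists k; auto. }
    destruct (Rlt_le_dec (d - eps) 0) as [h|h].
    + destruct (lower ((eps - d) / 2) ltac:(lra)) as [K1 h1].
      destruct (io K1) as [k [hk huk]]. specialize (h1 k hk). lra.
    + specialize (null (d - eps / 2) (d - eps) ltac:(lra) ltac:(lra) io).
      specialize (d1 (d - eps / 2) ltac:(lra) null). lra.
  - intros N. apply NNPP. intros no.
    assert (ev : forall k, (N <= k)%nat -> d + eps <= u k).
    { intros k hk. apply Rnot_lt_le. intros h. apply no. exists k; auto. }
    assert (ex : exists s, 0 <= s /\ H_null s E /\ s < d + eps / 2).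
    { apply NNPP. intros n. assert (d + eps / 2 <= d); [|lra].
      apply d2. intros s hs hn. apply Rnot_lt_le. intros h. apply n. exists s; auto. }
    destruct ex as [s [hs [hn hsd]]].
    destruct (upper (eps / 4) ltac:(lra)) as [K1 h1].
    specialize (h1 (max N K1) ltac:(lia)). pose proof (ev (max N K1) ltac:(lia)).
    apply (notnull s (d + eps) N); trivial; lra.
Qed.

(** * Powers and growth *)

Lemma Rpower_neg_antitone (x y t : R) : 0 < t -> 0 < x -> x <= y -> Rpower y (- t) <= Rpower x (- t).
Proof.
  intros ht hx hxy. rewrite !Rpower_Ropp. apply Rinv_le_contravar; [apply Rpower_pos|].
  apply Rle_Rpower_l; lra.
Qed.

Lemma Rpower_neg_antitone_lt (x y t : R) : 0 < t -> 0 < x -> x < y -> Rpower y (- t) < Rpower x (- t).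
Proof.
  intros ht hx hxy. rewrite !Rpower_Ropp. apply Rinv_lt_contravar.
  - apply Rmult_lt_0_compat; apply Rpower_pos.
  - apply Rlt_Rpower_l; lra.
Qed.

Lemma Rpower_large (rho M : R) : 0 < rho ->
  exists K : nat, forall x, INR K <= x -> M <= Rpower x rho.
Proof.
  intros hr. destruct (INR_unbounded (Rmax 1 (Rpower (Rmax 1 M) (/ rho)))) as [K hK].
  exists K. intros x hx.
  pose proof (Rmax_l 1 (Rpower (Rmax 1 M) (/ rho))).
  pose proof (Rmax_r 1 (Rpower (Rmax 1 M) (/ rho))).
  pose proof (Rmax_l 1 M). pose proof (Rmax_r 1 M).
  apply Rle_trans with (Rmax 1 M); trivial.
  rewrite <- (Rpower_1 (Rmax 1 M)) at 1 by lra.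
  replace 1 with (/ rho * rho) at 2 by (field; lra). rewrite <- Rpower_mult.
  apply Rle_Rpower_l; [lra|]. split; [apply Rpower_pos|lra].
Qed.

Lemma fast_growth (n : nat -> nat) (rho A : R) : 1 < rho ->
  (forall k, (2 <= k)%nat -> (k <= n k)%nat /\ Rpower (INR (n k)) rho <= 4 * INR (n (S k))) ->
  exists K, forall k, (K <= k)%nat -> A * INR (n k) <= INR (n (S k)).
Proof.
  intros hr h. destruct (Rpower_large (rho - 1) (4 * A)) as [K hK]; [lra|].
  exists (max 2 K). intros k hk. destruct (h k ltac:(lia)) as [h1 h2].
  specialize (hK (INR (n k)) ltac:(apply le_INR; lia)).
  assert (0 < INR (n k)) by (apply lt_0_INR; lia).
  replace rho with ((rho - 1) + 1) in h2 by ring.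
  rewrite Rpower_plus, Rpower_1 in h2 by trivial. nra.
Qed.

(** In logarithms: n grows at least like exp (t k) for every t, and l_k <= c / n_k. With t such that
    e t = |ln C| + 1, the decay of l_k^e beats C^k by a factor exp (-k), up to a constant. *)
Lemma superexp_small_of_growth (n : nat -> nat) (l : nat -> R) (c : R) (K : nat) :
  0 < c -> (forall k, (K <= k)%nat -> (1 <= n k)%nat /\ 0 < l k /\ l k * INR (n k) <= c) ->
  (forall A, exists K', forall k, (K' <= k)%nat -> A * INR (n k) <= INR (n (S k))) ->
  superexp_small l.
Proof.
  intros hc hl hg C e hC he.
  set (t := (Rabs (ln C) + 1) / e).
  destruct (hg (exp t)) as [K1 h1]. set (K2 := max K K1).
  assert (np : forall k, (K2 <= k)%nat -> 0 < INR (n k)).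
  { intros k hk. apply lt_0_INR. destruct (hl k ltac:(lia)); lia. }
  assert (G : forall k, (K2 <= k)%nat -> t * (INR k - INR K2) <= ln (INR (n k))).
  { intros k hk. induction hk as [|k hk IH].
    - rewrite Rminus_diag, Rmult_0_r, <- ln_1. apply ln_le_mono; [lra|].
      destruct (hl K2 ltac:(lia)) as [h _]. apply le_INR in h. exact h.
    - specialize (h1 k ltac:(lia)). apply ln_le_mono in h1.
      2:{ apply Rmult_lt_0_compat; [apply exp_pos|]. apply np; trivial. }
      rewrite ln_mult, ln_exp in h1; [|apply exp_pos|apply np; trivial].
      rewrite S_INR. lra. }
  set (b := e * ln c + e * t * INR K2).
  destruct (INR_unbounded b) as [K3 h3].
  exists (max K2 K3). intros k hk. destruct (hl k ltac:(lia)) as [n1 [lp lk]].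
  specialize (G k ltac:(lia)). specialize (np k ltac:(lia)).
  assert (hk3 : INR K3 <= INR k) by (apply le_INR; lia).
  apply ln_le_cancel; [|lra|].
  { apply Rmult_lt_0_compat; [apply pow_lt; trivial|apply Rpower_pos]. }
  rewrite ln_1, ln_mult, ln_Rpower, ln_pow; trivial; [|apply pow_lt; trivial|apply Rpower_pos].
  apply ln_le_mono in lk; [|apply Rmult_lt_0_compat; trivial].
  rewrite ln_mult in lk by trivial.
  assert (et : e * t = Rabs (ln C) + 1) by (unfold t; field; lra).
  pose proof (Rle_abs (ln C)). pose proof (pos_INR k).
  assert (e * ln (l k) <= e * (ln c - t * (INR k - INR K2))) by (apply Rmult_le_compat_l; lra).
  replace (e * (ln c - t * (INR k - INR K2))) with (b - e * t * INR k) in H1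
    by (unfold b; ring).
  rewrite et in H1. nra.
Qed.

Lemma bracket (n : nat -> nat) (K : nat) (Q : R) :
  (forall k, (K <= k)%nat -> (k <= n k)%nat) -> INR (n K) <= Q ->
  exists k, (K <= k)%nat /\ INR (n k) <= Q < INR (n (S k)).
Proof.
  intros hn hQ. destruct (INR_unbounded Q) as [N hN].
  assert (G : forall j, Q < INR (n (K + j)%nat) ->
     exists k, (K <= k)%nat /\ INR (n k) <= Q < INR (n (S k))).
  { induction j as [|j IH]; intros h.
    - rewrite Nat.add_0_r in h. lra.
    - destruct (Rlt_le_dec Q (INR (n (K + j)%nat))) as [h'|h']; [auto|].
      exists (K + j)%nat. rewrite Nat.add_succ_r in h. split; [lia|split; trivial]. }
  apply (G N). eapply Rlt_le_trans; [exact hN|]. apply le_INR.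
  specialize (hn (K + N)%nat ltac:(lia)). lia.
Qed.

Lemma progression_step (i q : nat) (Q : R) : (1 <= q)%nat -> INR i <= Q ->
  exists j : nat, INR (i + j * q) <= Q < INR (i + S j * q).
Proof.
  intros hq hQ. destruct (bracket (fun j => i + j * q)%nat 0 Q) as [j [_ hj]].
  - intros k _. nia.
  - simpl. rewrite Nat.add_0_r. trivial.
  - exists j; trivial.
Qed.

(** * Intervals at a convergent *)

Lemma ln_div (x y : R) : 0 < x -> 0 < y -> ln (x / y) = ln x - ln y.
Proof.
  intros hx hy. unfold Rdiv. rewrite ln_mult, ln_Rinv; trivial.
  apply Rinv_0_lt_compat; trivial.
Qed.

Definition ell (tau q D : R) : R := Rpower (D / q) (tau / (tau + 1)).

Lemma ln_ell (tau q D : R) : 0 < q -> 0 < D ->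
  ln (ell tau q D) = tau / (tau + 1) * (ln D - ln q).
Proof. intros hq hD. unfold ell. rewrite ln_Rpower, ln_div by trivial. ring. Qed.

Lemma ell_pos (tau q D : R) : 0 < ell tau q D.
Proof. apply Rpower_pos. Qed.

(** This and the next three bounds rest on the exact identities D / ell = (q^tau D)^(1/(tau+1)), ell
    q^tau = (q^tau D)^(tau/(tau+1)), ell q = (q D^tau)^(1/(tau+1)) and q^((1-tau)/tau) D / ell = (q
    D^tau)^(1/(tau (tau+1))), proved as inequalities between logarithms. *)
Lemma ell_lower (tau q D : R) : 0 < tau -> 0 < q -> 0 < D ->
  Rpower q tau * D < 2 -> D <= 2 * ell tau q D.
Proof.
  intros ht hq hD h. apply ln_le_cancel; [trivial|pose proof (ell_pos tau q D); lra|].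
  rewrite ln_mult, ln_ell by (trivial; lra || apply ell_pos).
  apply ln_increasing in h; [|apply Rmult_lt_0_compat; [apply Rpower_pos|trivial]].
  rewrite ln_mult, ln_Rpower in h by (trivial; apply Rpower_pos).
  pose proof ln_lt_2. apply (Rmult_le_reg_l (tau + 1)); [lra|].
  replace ((tau + 1) * (ln 2 + tau / (tau + 1) * (ln D - ln q))) with
    ((tau + 1) * ln 2 + tau * (ln D - ln q)) by (field; lra). nra.
Qed.

Lemma ell_upper_pow (tau q D : R) : 0 < tau -> 0 < q -> 0 < D ->
  Rpower q tau * D < 2 -> ell tau q D <= 2 * Rpower q (- tau).
Proof.
  intros ht hq hD h. pose proof (Rpower_pos q (- tau)).
  apply ln_le_cancel; [apply ell_pos|lra|].
  rewrite ln_mult, ln_ell, ln_Rpower by (trivial; lra).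
  apply ln_increasing in h; [|apply Rmult_lt_0_compat; [apply Rpower_pos|trivial]].
  rewrite ln_mult, ln_Rpower in h by (trivial; apply Rpower_pos).
  pose proof ln_lt_2. apply (Rmult_le_reg_l (tau + 1)); [lra|].
  replace ((tau + 1) * (tau / (tau + 1) * (ln D - ln q))) with
    (tau * (ln D - ln q)) by (field; lra). nra.
Qed.

Lemma ell_upper_inv (tau q D : R) : 0 < tau -> 0 < q -> 0 < D ->
  q * Rpower D tau < 1 -> ell tau q D <= / q.
Proof.
  intros ht hq hD h.
  apply ln_le_cancel; [apply ell_pos|apply Rinv_0_lt_compat; trivial|].
  rewrite ln_Rinv, ln_ell by trivial.
  apply ln_increasing in h; [|apply Rmult_lt_0_compat; [trivial|apply Rpower_pos]].
  rewrite ln_1, ln_mult, ln_Rpower in h by (trivial; apply Rpower_pos).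
  apply (Rmult_le_reg_l (tau + 1)); [lra|].
  replace ((tau + 1) * (tau / (tau + 1) * (ln D - ln q))) with
    (tau * (ln D - ln q)) by (field; lra). nra.
Qed.

(** For tau < 1 this makes ell larger than any given multiple of D once q is large, which leaves
    room for children spaced by 1 / n_{k+1} <= 2 D. *)
Lemma ell_over_err (tau q D : R) : 0 < tau < 1 -> 0 < q -> 0 < D ->
  q * Rpower D tau < 1 -> Rpower q ((1 - tau) / tau) * D <= ell tau q D.
Proof.
  intros ht hq hD h.
  apply ln_le_cancel; [apply Rmult_lt_0_compat; [apply Rpower_pos|trivial]|apply ell_pos|].
  rewrite ln_mult, ln_ell, ln_Rpower by (trivial; apply Rpower_pos).
  apply ln_increasing in h; [|apply Rmult_lt_0_compat; [trivial|apply Rpower_pos]].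
  rewrite ln_1, ln_mult, ln_Rpower in h by (trivial; apply Rpower_pos).
  apply (Rmult_le_reg_l ((tau + 1) * tau)); [nra|].
  replace ((tau + 1) * tau * (tau / (tau + 1) * (ln D - ln q))) with
    (tau * tau * (ln D - ln q)) by (field; lra).
  replace ((tau + 1) * tau * ((1 - tau) / tau * ln q + ln D)) with
    ((tau + 1) * ((1 - tau) * ln q + tau * ln D)) by (field; lra). nra.
Qed.

(* The scale Q at which Q^(-tau) and (Q/q) D are comparable. *)
Definition cross (tau q D : R) : R := Rpower (q / D) (/ (tau + 1)).

Lemma cross_pow (tau q D : R) : 0 < tau -> 0 < q -> 0 < D ->
  Rpower (cross tau q D) (- tau) = ell tau q D.
Proof.
  intros ht hq hD. unfold cross, ell. apply ln_inv; try apply Rpower_pos.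
  rewrite !ln_Rpower, !ln_div by trivial. field. lra.
Qed.

Lemma cross_mult (tau q D : R) : 0 < tau -> 0 < q -> 0 < D ->
  cross tau q D * D = ell tau q D * q.
Proof.
  intros ht hq hD. unfold cross, ell.
  apply ln_inv; try (apply Rmult_lt_0_compat; [apply Rpower_pos|trivial]).
  rewrite !ln_mult, !ln_Rpower, !ln_div by (trivial; apply Rpower_pos). field. lra.
Qed.

Lemma cross_lower (tau q D : R) : 0 < tau -> 0 < q -> 0 < D <= 1 ->
  Rpower q (/ (tau + 1)) <= cross tau q D.
Proof.
  intros ht hq hD. unfold cross. apply Rle_Rpower_l.
  - apply Rlt_le, Rinv_0_lt_compat; lra.
  - split; trivial. apply (Rmult_le_reg_r D); [lra|]. unfold Rdiv.
    rewrite Rmult_assoc, Rinv_l by lra. nra.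
Qed.

(** t is the distance from i theta to the target and j the number of steps of length D affordable at
    scale Q. If Q is at most 5 times the crossing scale, Q^(-tau) >= 5^(-tau) ell > t. Otherwise Q <
    (j + 2) q forces (j + 2) D > 5 ell, whereas j D <= t <= ell / 2 and 2 D <= 4 ell; the 5 is there
    to exceed 4 + 1/2. *)
Lemma jump_close (tau q D i Q t : R) (j : nat) :
  0 < tau -> 0 < q -> 0 < D -> Rpower q tau * D < 2 -> i <= q -> 0 < Q ->
  Q < i + (INR j + 1) * q -> t <= Rpower 5 (- tau) / 2 * ell tau q D -> INR j * D <= t ->
  t - INR j * D < Rpower Q (- tau).
Proof.
  intros ht hq hD h hi hQ hQj htl hj.
  pose proof (ell_pos tau q D) as le. pose proof (ell_lower tau q D ht hq hD h) as lD.
  pose proof (Rpower_pos 5 (- tau)) as p5. pose proof (pos_INR j) as pj.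
  assert (p51 : Rpower 5 (- tau) <= 1).
  { rewrite <- (Rpower_O 5) by lra. apply Rle_Rpower; lra. }
  assert (cp : 0 < cross tau q D) by apply Rpower_pos.
  destruct (Rle_lt_dec Q (5 * cross tau q D)) as [hQ5|hQ5].
  - apply Rlt_le_trans with (Rpower (5 * cross tau q D) (- tau)).
    + rewrite <- Rpower_mult_distr, cross_pow by lra. nra.
    + apply Rpower_neg_antitone; lra.
  - exfalso. pose proof (cross_mult tau q D ht hq hD) as cm.
    assert (5 * ell tau q D < (INR j + 2) * D).
    { apply (Rmult_lt_reg_r q); trivial.
      replace (5 * ell tau q D * q) with (5 * cross tau q D * D) by (rewrite Rmult_assoc, cm; ring).
      assert (5 * cross tau q D < (INR j + 2) * q) by nra. nra. }
    nra.
Qed.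

Lemma dZ_mult_le (j : nat) (x : R) : dZ (INR j * x) <= INR j * dZ x.
Proof.
  induction j as [|j IH].
  - simpl INR. rewrite !Rmult_0_l. pose proof (dZ_le 0) as h. rewrite Rabs_R0 in h. trivial.
  - rewrite S_INR, !Rmult_plus_distr_r, !Rmult_1_l. pose proof (dZ_plus (INR j * x) x). lra.
Qed.

(** Write n = i + j q with 1 <= i <= q. Since j q is at most the crossing scale X, and X D = ell q,
    the j steps move the point by at most j D <= ell; the approximation itself costs X^(-tau) =
    ell. *)
Lemma trapped (theta tau y : R) (q : nat) : 0 < tau -> (1 <= q)%nat ->
  0 < dZ (INR q * theta) ->
  (exists n, (1 <= n)%nat /\ INR n <= cross tau (INR q) (dZ (INR q * theta)) /\
     dZ (INR n * theta - y) < Rpower (cross tau (INR q) (dZ (INR q * theta))) (- tau)) ->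
  exists i, (1 <= i <= q)%nat /\
    dZ (y - INR i * theta) <= 2 * ell tau (INR q) (dZ (INR q * theta)).
Proof.
  intros ht hq hD [n [n1 [nX hn]]]. set (D := dZ (INR q * theta)) in *.
  assert (qp : 0 < INR q) by (apply lt_0_INR; lia).
  rewrite cross_pow in hn by trivial.
  pose proof (Nat.div_mod (n - 1) q ltac:(lia)) as E.
  pose proof (Nat.mod_upper_bound (n - 1) q ltac:(lia)) as M.
  set (j := ((n - 1) / q)%nat) in *. set (i := S ((n - 1) mod q)).
  assert (En : n = (i + j * q)%nat) by lia.
  exists i. split; [lia|].
  assert (Ej : INR j * D <= ell tau (INR q) D).
  { apply (Rmult_le_reg_r (INR q)); trivial. rewrite <- cross_mult by trivial.
    assert (INR j * INR q <= INR n) by (rewrite <- mult_INR; apply le_INR; lia).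
    nra. }
  pose proof (dZ_triang y (INR n * theta) (INR i * theta)) as T.
  rewrite (dZ_minus_sym y (INR n * theta)) in T.
  assert (dZ (INR n * theta - INR i * theta) <= INR j * D).
  { replace (INR n * theta - INR i * theta) with (INR j * (INR q * theta)).
    - apply dZ_mult_le.
    - rewrite En, plus_INR, mult_INR. ring. }
  lra.
Qed.

(** * The extreme ranges of tau *)

Lemma w_lt_lower_bound (theta b s : R) : b < s -> 0 < s ->
  (forall t, irr_set theta t -> t <= b) ->
  exists eps (N : nat), 0 < eps /\ forall j, (N <= j)%nat -> (1 <= j)%nat ->
    eps <= Rpower (INR j) s * dZ (INR j * theta).
Proof.
  intros hb hs h. apply NNPP. intros no.
  assert (irr_set theta s) as hi; [|specialize (h s hi); lra].
  split; trivial. intros eps heps N. apply NNPP. intros n. apply no.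
  exists eps, N. split; trivial. intros j h1 h2. apply Rnot_lt_le. intros h3.
  apply n. exists j; auto.
Qed.

Lemma U_set_of_index (theta tau : R) (i : nat) :
  (1 <= i)%nat -> U_set theta tau (frac (INR i * theta)).
Proof.
  intros hi. split; [apply frac_range|]. exists (INR i). intros Q hQ.
  exists i. split; [trivial|split; [trivial|]].
  rewrite (dZ_congr _ 0 (Int_part (INR i * theta))) by (unfold frac; ring).
  pose proof (dZ_le 0) as h. rewrite Rabs_R0 in h. pose proof (Rpower_pos Q (- tau)). lra.
Qed.

(** For q_k <= Q < q_{k+1} some index up to q_k comes within 1 / q_k of y. With s between w and 1 /
    tau, the error D_k < 1 / Q is at least eps q_k^(-s), so Q^(-tau) >= D_k^tau >= eps^tau q_k^(-s
    tau), and this exceeds 1 / q_k for large k because s tau < 1. *)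
Lemma uniform_all (theta tau : R) (Hth : 0 < theta < 1) (Hirr : irrational theta) :
  0 < tau -> w_lt theta (1 / tau) -> forall y, 0 <= y < 1 -> U_set theta tau y.
Proof.
  intros ht [b [hb hs]] y hy.
  assert (it : 0 < 1 / tau) by (apply Rdiv_lt_0_compat; lra).
  set (s := (Rmax b 0 + 1 / tau) / 2).
  assert (s1 : b < s /\ 0 < s < 1 / tau).
  { pose proof (Rmax_l b 0). pose proof (Rmax_r b 0).
    assert (Rmax b 0 < 1 / tau) by (apply Rmax_lub_lt; trivial). unfold s; lra. }
  destruct (w_lt_lower_bound theta b s) as [eps [N [he hN]]]; try tauto.
  assert (st : s * tau < 1).
  { apply (Rmult_lt_reg_r (/ tau)); [apply Rinv_0_lt_compat; trivial|].
    rewrite Rmult_assoc, Rinv_r by lra. unfold Rdiv in s1. lra. }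
  destruct (Rpower_large (1 - s * tau) (Rpower eps (- tau))) as [K hK]; [lra|].
  set (K' := S (max K N)).
  split; trivial. exists (INR (cf_q theta K')). intros Q hQ.
  destruct (bracket (cf_q theta) K' Q) as [k [hk [hk1 hk2]]]; trivial.
  { intros j _. apply cf_q_ge_index; trivial. }
  destruct (cf_covering theta k y Hth Hirr ltac:(lia)) as [n [hn hd]].
  exists n. split; [lia|]. split.
  { eapply Rle_trans; [|exact hk1]. apply le_INR; lia. }
  eapply Rlt_le_trans; [exact hd|].
  set (q := INR (cf_q theta k)) in *. set (e := cf_err theta k).
  pose proof (cf_q_ge_index theta k Hth Hirr) as qi.
  assert (qp : 0 < q) by (apply lt_0_INR; lia).
  assert (ep : 0 < e) by (apply cf_err_pos; trivial).
  assert (Qp : 0 < Q) by lra.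
  specialize (hK q ltac:(apply le_INR; lia)).
  specialize (hN (cf_q theta k) ltac:(lia) ltac:(lia)).
  rewrite dZ_cf_q in hN by (trivial; lia). fold q e in hN.
  assert (eQ : e <= / Q).
  { apply (Rmult_le_reg_l Q); trivial. rewrite Rinv_r by lra.
    pose proof (cf_err_upper theta k Hth Hirr) as u. fold e in u. nra. }
  apply Rle_trans with (Rpower e tau).
  - apply (fun h => Rle_Rpower_l _ _ tau (Rlt_le _ _ ht) (conj he h)) in hN.
    rewrite <- Rpower_mult_distr, Rpower_mult in hN by (trivial; apply Rpower_pos).
    rewrite Rpower_Ropp in hK. pose proof (Rpower_pos eps tau) as pe.
    apply (Rmult_le_compat_l (Rpower eps tau)) in hK; [|lra].
    rewrite Rinv_r in hK by lra.
    assert (S : Rpower q (1 - s * tau) * Rpower q (s * tau) = q).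
    { rewrite <- Rpower_plus. replace (1 - s * tau + s * tau) with 1 by ring.
      apply Rpower_1; trivial. }
    pose proof (Rpower_pos q (1 - s * tau)) as P1. pose proof (Rpower_pos q (s * tau)) as P2.
    pose proof (Rpower_pos e tau) as P3.
    apply (Rmult_le_reg_l q); trivial. rewrite Rinv_r by lra. rewrite <- S.
    apply Rle_trans with (Rpower eps tau * Rpower q (1 - s * tau)); [trivial|].
    rewrite Rmult_assoc, (Rmult_comm (Rpower eps tau)). apply Rmult_le_compat_l; lra.
  - rewrite Rpower_Ropp.
    apply Rle_trans with (Rpower (/ Q) tau); [apply Rle_Rpower_l; lra|].
    right. apply ln_inv; [apply Rpower_pos|apply Rinv_0_lt_compat, Rpower_pos|].
    rewrite ln_Rinv, !ln_Rpower, ln_Rinv by (trivial; apply Rpower_pos). ring.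
Qed.

(* The approximating index cannot change between the scales Q and 2Q. *)
Lemma uniform_orbit (theta tau : R) (Hirr : irrational theta) :
  w_lt theta tau -> (exists s, irr_set theta s) -> forall y, U_set theta tau y <->
    exists i : nat, (1 <= i)%nat /\ y = frac (INR i * theta).
Proof.
  intros [b [hb hs]] [s0 hs0] y. split.
  2:{ intros [i [hi ->]]. apply U_set_of_index; trivial. }
  intros [hy [Q0 hQ]].
  assert (b0 : 0 < b).
  { pose proof (hs s0 hs0). destruct hs0. lra. }
  set (s := (b + tau) / 2).
  destruct (w_lt_lower_bound theta b s) as [eps [N [he hN]]]; trivial; try (unfold s; lra).
  (* The bound will be applied to differences of indices, which may be small. The finitely many j <
     N only lower the constant, since no multiple j theta with j >= 1 is an integer. *)
  assert (hN' : exists eps', 0 < eps' /\ forall j, (1 <= j)%nat ->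
    eps' <= Rpower (INR j) s * dZ (INR j * theta)).
  { clear - hN he Hirr.
    assert (G : forall M : nat, exists eps', 0 < eps' /\ forall j, (1 <= j)%nat -> (j < M)%nat ->
      eps' <= Rpower (INR j) s * dZ (INR j * theta)).
    { induction M as [|M [e1 [h1 h2]]]; [exists 1; split; [lra|intros; lia]|].
      destruct M as [|M]; [exists 1; split; [lra|intros; lia]|].
      exists (Rmin e1 (Rpower (INR (S M)) s * dZ (INR (S M) * theta))). split.
      - apply Rmin_glb_lt; trivial. apply Rmult_lt_0_compat; [apply Rpower_pos|].
        apply dZ_mult_pos; trivial; lia.
      - intros j hj1 hj2. destruct (Nat.eq_dec j (S M)) as [->|n]; [apply Rmin_r|].
        eapply Rle_trans; [apply Rmin_l|apply h2; lia]. }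
    destruct (G N) as [e1 [h1 h2]]. exists (Rmin eps e1). split; [apply Rmin_glb_lt; trivial|].
    intros j hj. destruct (le_lt_dec N j) as [h|h].
    - eapply Rle_trans; [apply Rmin_l|apply hN; trivial].
    - eapply Rle_trans; [apply Rmin_r|apply h2; trivial]. }
  clear eps N he hN. destruct hN' as [eps [he hN]].
  assert (ts : 0 < tau - s) by (unfold s; lra).
  assert (sp : 0 < s) by (unfold s; lra).
  destruct (Rpower_large (tau - s) (2 * Rpower 2 s / eps)) as [K hK]; trivial.
  set (Q1 := Rmax 1 (Rmax Q0 (INR K))).
  assert (q1 : 1 <= Q1) by apply Rmax_l.
  assert (q2 : Q0 <= Q1 /\ INR K <= Q1).
  { unfold Q1. split; (eapply Rle_trans; [|apply Rmax_r]); [apply Rmax_l|apply Rmax_r]. }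
  assert (uniq : forall Q n n', Q1 <= Q -> (1 <= n)%nat -> (1 <= n')%nat ->
    INR n <= 2 * Q -> INR n' <= 2 * Q ->
    dZ (INR n * theta - y) < Rpower Q (- tau) -> dZ (INR n' * theta - y) < Rpower Q (- tau) ->
    (n <= n')%nat -> n = n').
  { intros Q n n' hQ1 n1 n1' nQ nQ' d d' le. apply NNPP. intros ne.
    pose proof (dZ_triang (INR n' * theta) y (INR n * theta)) as T.
    rewrite (dZ_minus_sym y (INR n * theta)) in T.
    rewrite <- Rmult_minus_distr_r, <- minus_INR in T by lia.
    specialize (hN (n' - n)%nat ltac:(lia)).
    assert (jQ : INR (n' - n) <= 2 * Q).
    { eapply Rle_trans; [|exact nQ']. apply le_INR; lia. }
    assert (jp : 0 < INR (n' - n)) by (apply lt_0_INR; lia).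
    assert (R1 : Rpower (INR (n' - n)) s <= Rpower 2 s * Rpower Q s).
    { rewrite Rpower_mult_distr by lra. apply Rle_Rpower_l; lra. }
    specialize (hK Q ltac:(lra)).
    assert (S : Rpower Q s * Rpower Q (- tau) * Rpower Q (tau - s) = 1).
    { rewrite <- !Rpower_plus. replace (s + - tau + (tau - s)) with 0 by ring.
      apply Rpower_O; lra. }
    pose proof (Rpower_pos Q (tau - s)) as P1. pose proof (Rpower_pos Q s) as P2.
    pose proof (Rpower_pos Q (- tau)) as P3. pose proof (Rpower_pos 2 s) as P4.
    pose proof (Rpower_pos (INR (n' - n)) s) as P5.
    assert (U : eps < 2 * Rpower 2 s * (Rpower Q s * Rpower Q (- tau))).
    { eapply Rle_lt_trans; [exact hN|].
      apply Rle_lt_trans with (Rpower 2 s * Rpower Q s * dZ (INR (n' - n) * theta)).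
      - apply Rmult_le_compat_r; [apply dZ_nonneg|trivial].
      - assert (0 < Rpower 2 s * Rpower Q s) by nra. nra. }
    apply (Rmult_le_compat_r eps) in hK; [|lra].
    replace (2 * Rpower 2 s / eps * eps) with (2 * Rpower 2 s) in hK by (field; lra).
    assert (0 < Rpower Q s * Rpower Q (- tau)) as P6 by nra.
    assert (2 * Rpower 2 s * (Rpower Q s * Rpower Q (- tau)) <= eps).
    { apply (Rmult_le_compat_l _ _ _ (Rlt_le _ _ P6)) in hK.
      replace (Rpower Q s * Rpower Q (- tau) * (Rpower Q (tau - s) * eps))
        with (Rpower Q s * Rpower Q (- tau) * Rpower Q (tau - s) * eps) in hK by ring.
      rewrite S in hK. lra. }
    lra. }
  destruct (hQ Q1 ltac:(lra)) as [n0 [n01 [n02 n03]]].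
  assert (tp : 0 < tau) by lra.
  assert (all : forall j : nat, INR n0 <= Q1 * 2 ^ j /\
     dZ (INR n0 * theta - y) < Rpower (Q1 * 2 ^ j) (- tau)).
  { induction j as [|j [IH1 IH2]]; [simpl; rewrite Rmult_1_r; split; trivial|].
    set (Q := Q1 * 2 ^ j) in *. replace (Q1 * 2 ^ S j) with (2 * Q) by (unfold Q; simpl; ring).
    assert (hq : Q1 <= Q).
    { unfold Q. pose proof (pow_R1_Rle 2 j ltac:(lra)). nra. }
    destruct (hQ (2 * Q) ltac:(lra)) as [n [m1 [m2 m3]]].
    assert (m3' : dZ (INR n * theta - y) < Rpower Q (- tau)).
    { eapply Rlt_trans; [exact m3|]. apply Rpower_neg_antitone_lt; lra. }
    assert (E : n0 = n).
    { destruct (le_lt_dec n0 n); [|symmetry]; apply (uniq Q); trivial; lra || lia. }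
    subst n. split; trivial. }
  assert (Z : dZ (INR n0 * theta - y) = 0).
  { destruct (dZ_nonneg (INR n0 * theta - y)) as [P|]; [|auto]. exfalso.
    set (d := dZ (INR n0 * theta - y)) in *.
    destruct (Rpower_large tau (/ d) tp) as [M hM].
    destruct (Pow_x_infinity 2 ltac:(rewrite Rabs_right; lra) (INR M)) as [j hj].
    specialize (hj j (Nat.le_refl j)).
    assert (p2 : 0 < 2 ^ j) by (apply pow_lt; lra). rewrite Rabs_right in hj by lra.
    destruct (all j) as [_ h]. specialize (hM (Q1 * 2 ^ j) ltac:(nra)).
    rewrite Rpower_Ropp in h. apply Rinv_le_contravar in hM; [|apply Rinv_0_lt_compat; trivial].
    rewrite Rinv_inv in hM. lra. }
  exists n0. split; trivial. apply dZ_0_frac in Z. rewrite <- (frac_id y hy). auto.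
Qed.

(** * Convergents selected by an enumeration *)

Lemma enumerates_increasing (P : nat -> Prop) (n : nat -> nat) (j k : nat) :
  enumerates P n -> (1 <= j)%nat -> (j < k)%nat -> (n j < n k)%nat.
Proof.
  intros [h _] hj. induction 1 as [|k hk IH]; [apply h; trivial|].
  specialize (h k ltac:(lia)). lia.
Qed.

Lemma enumerates_ge (P : nat -> Prop) (n : nat -> nat) (k : nat) :
  (forall x, P x -> (1 <= x)%nat) -> enumerates P n -> (1 <= k)%nat -> (k <= n k)%nat.
Proof.
  intros hP hn. induction 1 as [|k hk IH].
  - apply hP, hn. exists 1%nat; auto.
  - pose proof (proj1 hn k hk). lia.
Qed.

(** The enumeration lists values; m recovers their indices among the convergents. Starting at k = 2
    gives n_k >= 2, which excludes the index 0, where q_0 may equal q_1 and where [dZ_cf_q] may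
    fail. *)
Definition selected (theta : R) (P : nat -> Prop) (n m : nat -> nat) : Prop :=
  forall k, (2 <= k)%nat -> (k <= n k)%nat /\ (1 <= m k)%nat /\ n k = cf_q theta (m k) /\
    (m k < m (S k))%nat /\ P (n k) /\
    (forall j, (m k < j)%nat -> (j < m (S k))%nat -> ~ P (cf_q theta j)).

Lemma enumerates_selected (theta : R) (P : nat -> Prop) (n : nat -> nat) :
  0 < theta < 1 -> irrational theta -> (forall x, P x -> exists j, x = cf_q theta j) ->
  enumerates P n -> exists m, selected theta P n m.
Proof.
  intros Hth Hirr hP hn.
  assert (P1 : forall x, P x -> (1 <= x)%nat).
  { intros x hx. destruct (hP x hx) as [j ->]. apply cf_q_pos; trivial. }
  assert (Pn : forall k, (1 <= k)%nat -> P (n k)) by (intros k hk; apply hn; exists k; auto).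
  assert (C : forall k, exists j, (1 <= k)%nat -> n k = cf_q theta j).
  { intros k. destruct (le_lt_dec 1 k) as [h|h]; [|exists 0%nat; lia].
    destruct (hP _ (Pn k h)) as [j hj]. exists j; auto. }
  set (m := fun k => proj1_sig (constructive_indefinite_description _ (C k))).
  assert (hm : forall k, (1 <= k)%nat -> n k = cf_q theta (m k)).
  { intros k. exact (proj2_sig (constructive_indefinite_description _ (C k))). }
  clearbody m. exists m. intros k hk.
  pose proof (enumerates_ge P n k P1 hn ltac:(lia)) as ge.
  pose proof (proj1 hn k ltac:(lia)) as lt.
  assert (mk : (1 <= m k)%nat).
  { destruct (m k) as [|j] eqn:E; [|lia]. pose proof (hm k ltac:(lia)) as h.
    rewrite E in h. unfold cf_q in h; simpl in h. lia. }
  assert (mlt : (m k < m (S k))%nat).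
  { apply (cf_q_lt_inv theta); trivial. rewrite <- !hm by lia. trivial. }
  repeat split; trivial; [apply hm; lia|apply Pn; lia|].
  intros j h1 h2 hj. apply hn in hj. destruct hj as [i [hi Ei]].
  pose proof (cf_q_strict theta (m k) j Hth Hirr mk h1) as s1.
  pose proof (cf_q_strict theta j (m (S k)) Hth Hirr ltac:(lia) h2) as s2.
  rewrite <- hm in s1 by lia. rewrite <- hm in s2 by lia. rewrite <- Ei in s1, s2.
  destruct (lt_eq_lt_dec i k) as [[c|c]|c].
  - pose proof (enumerates_increasing P n i k hn hi c). lia.
  - subst i. lia.
  - assert (c' : (i = S k \/ S k < i)%nat) by lia. destruct c' as [->|c']; [lia|].
    pose proof (enumerates_increasing P n (S k) i hn ltac:(lia) c'). lia.
Qed.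

(** The tree is built on the line, where sides and orders make sense; its nodes are real
    representatives of the orbit points. *)
Definition orbit_lift (theta : R) (N : nat) (x : R) : Prop :=
  exists (i : nat) (z : Z), (1 <= i <= N)%nat /\ x = INR i * theta - IZR z.

Lemma dZ_lift (theta x y : R) (i : nat) (z : Z) : x = INR i * theta - IZR z ->
  dZ (INR i * theta - frac y) <= Rabs (y - x).
Proof.
  intros ->. rewrite (dZ_congr _ (INR i * theta - y) (Int_part y)) by (unfold frac; ring).
  eapply Rle_trans; [apply (dZ_le_abs _ z)|]. rewrite <- Rabs_Ropp. right; f_equal; ring.
Qed.

Lemma separated_points (f : nat -> R) (gam : R) (m : nat) : 0 < gam ->
  (forall i j, (i < j)%nat -> gam <= Rabs (f j - f i)) ->
  NoDup (map f (seq 0 m)) /\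
  forall a b, In a (map f (seq 0 m)) -> In b (map f (seq 0 m)) -> a <> b -> gam <= Rabs (a - b).
Proof.
  intros hg hf.
  assert (h : forall i j, i <> j -> gam <= Rabs (f i - f j)).
  { intros i j n. destruct (lt_eq_lt_dec i j) as [[l|l]|l]; [|contradiction|auto].
    rewrite Rabs_minus_sym. auto. }
  split.
  - apply NoDup_map_NoDup_ForallPairs; [|apply seq_NoDup].
    intros i j _ _ e. destruct (Nat.eq_dec i j) as [|n]; trivial. exfalso.
    specialize (h i j n). rewrite e, Rminus_diag, Rabs_R0 in h. lra.
  - intros a b ha hb n. apply in_map_iff in ha, hb.
    destruct ha as [i [<- _]], hb as [j [<- _]]. apply h. intros ->. apply n; trivial.
Qed.

Lemma selected_facts (theta : R) (P : nat -> Prop) (n m : nat -> nat) (k : nat) :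
  0 < theta < 1 -> irrational theta -> selected theta P n m -> (2 <= k)%nat ->
  let D := dZ (INR (n k) * theta) in
  1 <= INR (n k) /\ 0 < D < 1 /\ D = cf_err theta (m k) /\
  INR (cf_q theta (S (m k))) <= INR (n (S k)) /\
  D * INR (cf_q theta (S (m k))) < 1 <= 2 * D * INR (cf_q theta (S (m k))).
Proof.
  intros Hth Hirr sel hk D. destruct (sel k hk) as [h1 [h2 [h3 [h4 _]]]].
  destruct (sel (S k) ltac:(lia)) as [_ [_ [h3' _]]].
  assert (E : D = cf_err theta (m k)) by (unfold D; rewrite h3, dZ_cf_q; trivial).
  rewrite E. pose proof (cf_err_pos theta (m k) Hth Hirr).
  pose proof (cf_err_upper theta (m k) Hth Hirr). pose proof (cf_err_lower theta (m k) Hth Hirr).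
  assert (1 <= INR (cf_q theta (S (m k)))).
  { apply (le_INR 1), cf_q_pos; trivial. }
  split; [apply (le_INR 1); lia|]. split; [split; nra|]. split; [trivial|].
  split; [apply le_INR; rewrite h3'; apply cf_q_le; trivial|]. split; nra.
Qed.

(** The spacing of the first q_m orbit points is the error of the preceding convergent, which is at
    least 1 / (2 q_m). *)
Lemma selected_separation (theta : R) (P : nat -> Prop) (n m : nat -> nat) (k i j : nat) :
  0 < theta < 1 -> irrational theta -> selected theta P n m -> (2 <= k)%nat ->
  (1 <= i <= n k)%nat -> (1 <= j <= n k)%nat -> i <> j ->
  / INR (n k) / 2 <= dZ (INR i * theta - INR j * theta).
Proof.
  intros Hth Hirr sel hk hi hj ne. destruct (sel k hk) as [h1 [h2 [h3 _]]].
  destruct (m k) as [|m'] eqn:E; [lia|]. rewrite h3 in *.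
  eapply Rle_trans; [|apply (cf_separation theta m'); trivial].
  pose proof (cf_err_lower theta m' Hth Hirr) as lo.
  assert (q : 0 < INR (cf_q theta (S m'))) by (apply lt_0_INR; lia).
  apply (Rmult_le_reg_r (2 * INR (cf_q theta (S m')))); [lra|].
  field_simplify; lra.
Qed.

(** The next denominator after n_k is at least 1 / (2 D), where D < 2 n_k^(-rho); so n_{k+1} >=
    n_k^rho / 4, and rho > 1 beats any constant factor. *)
Lemma selected_growth (theta : R) (P : nat -> Prop) (n m : nat -> nat) (rho A : R) :
  0 < theta < 1 -> irrational theta -> selected theta P n m -> 1 < rho ->
  (forall k, (2 <= k)%nat -> Rpower (INR (n k)) rho * dZ (INR (n k) * theta) < 2) ->
  exists K, forall k, (K <= k)%nat -> A * INR (n k) <= INR (n (S k)).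
Proof.
  intros Hth Hirr sel hr h. apply (fast_growth n rho A hr).
  intros k hk. destruct (sel k hk) as [h1 _]. split; trivial.
  specialize (h k hk).
  destruct (selected_facts theta P n m k Hth Hirr sel hk) as [n1 [[D0 D1] [_ [qn [_ lo]]]]].
  set (D := dZ (INR (n k) * theta)) in *. set (q := INR (cf_q theta (S (m k)))) in *.
  pose proof (Rpower_pos (INR (n k)) rho). apply Rle_trans with (4 * q); [|lra].
  apply (Rmult_le_reg_r D); trivial. lra.
Qed.

Lemma selected_cross_large (theta : R) (P : nat -> Prop) (n m : nat -> nat) (tau Q0 : R) :
  0 < theta < 1 -> irrational theta -> selected theta P n m -> 0 < tau ->
  exists K, (2 <= K)%nat /\ forall k, (K <= k)%nat ->
    Q0 <= cross tau (INR (n k)) (dZ (INR (n k) * theta)).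
Proof.
  intros Hth Hirr sel ht.
  destruct (Rpower_large (/ (tau + 1)) Q0) as [K hK]; [apply Rinv_0_lt_compat; lra|].
  exists (max 2 K). split; [lia|]. intros k hk. destruct (sel k ltac:(lia)) as [h1 _].
  destruct (selected_facts theta P n m k Hth Hirr sel ltac:(lia)) as [n1 [[D0 D1] _]].
  eapply Rle_trans; [apply (hK (INR (n k))); apply le_INR; lia|].
  apply cross_lower; lra.
Qed.

Lemma U_set_trapped (theta tau : R) (P : nat -> Prop) (n m : nat -> nat) (y : R) :
  0 < theta < 1 -> irrational theta -> selected theta P n m -> 0 < tau ->
  U_set theta tau y -> exists K, (2 <= K)%nat /\ forall k, (K <= k)%nat ->
    exists i, (1 <= i <= n k)%nat /\
      dZ (y - INR i * theta) <= 2 * ell tau (INR (n k)) (dZ (INR (n k) * theta)).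
Proof.
  intros Hth Hirr sel ht [_ [Q0 hQ]].
  destruct (selected_cross_large theta P n m tau Q0 Hth Hirr sel ht) as [K [hK2 hK]].
  exists K. split; trivial. intros k hk. destruct (sel k ltac:(lia)) as [h1 _].
  destruct (selected_facts theta P n m k Hth Hirr sel ltac:(lia)) as [n1 [[D0 D1] _]].
  apply trapped; trivial; [lia|]. apply hQ. auto.
Qed.

Lemma exists_sequence (Q : nat -> R -> Prop) :
  (forall j, exists x, Q j x) -> exists f : nat -> R, forall j, Q j (f j).
Proof.
  intros h. exists (fun j => proj1_sig (constructive_indefinite_description _ (h j))).
  intros j. exact (proj2_sig (constructive_indefinite_description _ (h j))).
Qed.

Lemma eventually_le (f : nat -> nat) (rho M : R) :
  (forall k, (2 <= k)%nat -> (k <= f k)%nat) -> 0 < rho ->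
  exists K, forall k, (K <= k)%nat -> M <= Rpower (INR (f k)) rho.
Proof.
  intros hf hr. destruct (Rpower_large rho M hr) as [K hK].
  exists (max 2 K). intros k hk. apply hK, le_INR. specialize (hf k ltac:(lia)). lia.
Qed.

(** * The range tau < 1 *)

(* Consecutive grid points c / n_{k+1}, starting one step away from x in the direction s. *)
Lemma grid_children (theta x L s : R) (M : nat) :
  0 < theta < 1 -> irrational theta -> (1 <= M)%nat -> s = 1 \/ s = -1 ->
  let N := INR (cf_q theta M) in
  2 * cf_err theta M * N <= 1 -> 6 <= L * N ->
  exists ls, ls <> [] /\ NoDup ls /\ L * N / 2 <= INR (length ls) /\
    (forall a b, In a ls -> In b ls -> a <> b -> / N / 2 <= Rabs (a - b)) /\
    (forall a, In a ls -> orbit_lift theta (cf_q theta M) a /\ 0 <= s * (a - x) <= L).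
Proof.
  intros Hth Hirr hM hs N he hL.
  assert (Np : 0 < N) by (apply lt_0_INR, cf_q_pos; trivial).
  assert (Nn : N <> 0) by lra.
  assert (Nh : cf_err theta M <= / N / 2).
  { apply (Rmult_le_reg_r (2 * N)); [lra|]. field_simplify; lra. }
  assert (sz : exists sz, IZR sz = s) by (destruct hs; subst s; [exists 1%Z|exists (-1)%Z]; trivial).
  destruct sz as [sz hsz].
  assert (ss : s * s = 1) by (destruct hs; subst s; ring).
  assert (cb : exists c : Z, 1 <= s * (IZR c - x * N) <= 2).
  { destruct (base_Int_part (x * N)) as [b1 b2]. destruct hs as [hs|hs].
    - exists (Int_part (x * N) + 2)%Z. rewrite plus_IZR, hs. lra.
    - exists (Int_part (x * N) - 1)%Z. rewrite minus_IZR, hs. lra. }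
  destruct cb as [c hc].
  destruct (exists_sequence (fun j a => orbit_lift theta (cf_q theta M) a /\
    exists t, 0 < t <= cf_err theta M /\ a = IZR (c + sz * Z.of_nat j) / N + (-1) ^ M * t))
    as [f hf].
  { intros j. destruct (cf_grid theta M (c + sz * Z.of_nat j) Hth Hirr hM)
      as [i [z [t [hi [e ht]]]]].
    exists (INR i * theta - IZR z). split; [exists i, z; auto|]. exists t; auto. }
  assert (posn : forall j, exists t, 0 < t <= cf_err theta M /\
    s * (f j - x) = (s * (IZR c - x * N) + INR j) / N + s * (-1) ^ M * t).
  { intros j. destruct (hf j) as [_ [t [ht e]]]. exists t. split; trivial.
    rewrite e, plus_IZR, mult_IZR, hsz, <- INR_IZR_INZ.
    replace (INR j) with (s * s * INR j) at 2 by (rewrite ss; ring). field. trivial. }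
  destruct (base_Int_part (L * N)) as [b1 b2].
  (* The offsets from x, in units of 1 / N, then run within [1, L N - 1]. The unit left at both ends
     exceeds the displacement t N <= 1/2, so all points stay on the chosen side and within L. More
     than L N - 3 points remain, at least L N / 2 since L N >= 6. *)
  set (len := Z.to_nat (Int_part (L * N) - 2)).
  assert (Ip : (4 <= Int_part (L * N))%Z).
  { assert (5 - 1 < Int_part (L * N))%Z by (apply lt_IZR; rewrite minus_IZR; lra). lia. }
  assert (lenE : INR len = IZR (Int_part (L * N)) - 2).
  { unfold len. rewrite INR_IZR_INZ, Z2Nat.id by lia. rewrite minus_IZR. trivial. }
  destruct (separated_points f (/ N / 2) len) as [sep1 sep2].
  { apply Rdiv_lt_0_compat; [apply Rinv_0_lt_compat; trivial|lra]. }
  { intros i j hij. destruct (posn i) as [t [ht e]], (posn j) as [t' [ht' e']].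
    assert (E : s * (f j - f i) = (INR j - INR i) * / N + s * (-1) ^ M * (t' - t)).
    { replace (s * (f j - f i)) with (s * (f j - x) - s * (f i - x)) by ring.
      rewrite e, e'. field. trivial. }
    assert (ji : 1 <= INR j - INR i).
    { apply le_INR in hij. rewrite S_INR in hij. lra. }
    assert (iN : 0 < / N) by (apply Rinv_0_lt_compat; trivial).
    assert (A1 : / N / 2 <= s * (f j - f i)).
    { rewrite E. assert (/ N <= (INR j - INR i) * / N) by nra.
      destruct hs as [->| ->], (pow_m1_cases M) as [->| ->]; lra. }
    eapply Rle_trans; [exact A1|]. eapply Rle_trans; [apply Rle_abs|].
    rewrite Rabs_mult. replace (Rabs s) with 1; [lra|].
    destruct hs as [->| ->]; unfold Rabs; destruct Rcase_abs; lra. }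
  exists (map f (seq 0 len)).
  split. { intros E. apply (f_equal (@length R)) in E. rewrite length_map, length_seq in E.
    simpl in E. unfold len in E. lia. }
  split; [trivial|]. split; [rewrite length_map, length_seq, lenE; lra|].
  split; [trivial|]. intros a ha. apply in_map_iff in ha. destruct ha as [j [<- hj]].
  apply in_seq in hj. split; [apply hf|].
  destruct (posn j) as [t [ht ->]].
  assert (hj' : INR j + 1 <= INR len) by (rewrite <- S_INR; apply le_INR; lia).
  pose proof (pos_INR j) as j0.
  assert (iN : 0 < / N) by (apply Rinv_0_lt_compat; trivial).
  set (w := s * (IZR c - x * N)) in *.
  assert (/ N <= (w + INR j) / N <= L - / N).
  { split; apply (Rmult_le_reg_r N); trivial; field_simplify; lra. }
  destruct hs as [->| ->], (pow_m1_cases M) as [->| ->]; lra.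
Qed.

(** Not being selected means 1 / q_k <= D^tau, and D < 1 / q_{k+1} < 1 / Q. So the covering radius 1
    / q_k is already at most Q^(-tau). *)
Lemma S_c_unselected_cover (theta tau Q : R) (k : nat) (y : R) :
  0 < theta < 1 -> irrational theta -> 0 < tau -> (1 <= k)%nat ->
  ~ S_c theta tau (cf_q theta k) -> INR (cf_q theta k) <= Q < INR (cf_q theta (S k)) ->
  exists i, (1 <= i)%nat /\ INR i <= Q /\ dZ (INR i * theta - y) < Rpower Q (- tau).
Proof.
  intros Hth Hirr ht hk no [hQ1 hQ2].
  destruct (cf_covering theta k y Hth Hirr hk) as [i [hi hd]].
  exists i. split; [lia|]. split; [eapply Rle_trans; [|exact hQ1]; apply le_INR; lia|].
  assert (h : 1 <= INR (cf_q theta k) * Rpower (dZ (INR (cf_q theta k) * theta)) tau).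
  { apply Rnot_lt_le. intros h. apply no. exists k. auto. }
  rewrite dZ_cf_q in h by trivial.
  pose proof (cf_err_pos theta k Hth Hirr) as ep. pose proof (cf_err_upper theta k Hth Hirr) as up.
  set (e := cf_err theta k) in *. set (q := INR (cf_q theta k)) in *.
  set (q' := INR (cf_q theta (S k))) in *.
  assert (qp : 1 <= q) by (apply (le_INR 1), cf_q_pos; trivial).
  eapply Rlt_le_trans; [exact hd|].
  apply Rle_trans with (Rpower e tau).
  - apply (Rmult_le_reg_l q); [lra|]. rewrite Rinv_r; lra.
  - apply Rle_trans with (Rpower (/ q') tau).
    + apply Rle_Rpower_l; [lra|]. split; trivial.
      apply (Rmult_le_reg_l q'); [lra|]. rewrite Rinv_r; lra.
    + replace (Rpower (/ q') tau) with (Rpower q' (- tau)).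
      * apply Rpower_neg_antitone; lra.
      * unfold Rpower. rewrite ln_Rinv by lra. f_equal. ring.
Qed.

Lemma mult_lt_inv (a b : R) : 0 < b -> a * b < 1 -> a < / b.
Proof. intros hb h. apply (Rmult_lt_reg_r b); trivial. rewrite Rinv_l; lra. Qed.

Lemma inv_lt_pow (Q tau : R) : 1 <= Q -> tau <= 1 -> / Q <= Rpower Q (- tau).
Proof.
  intros hQ ht. rewrite <- (Rpower_1 Q) at 1 by lra. rewrite <- Rpower_Ropp.
  apply Rle_Rpower; lra.
Qed.

(* For q_m <= Q < q_{m+1} with q_m selected, walk from i along multiples of q_m towards y. *)
Lemma S_c_selected_near (theta tau Q x y : R) (k i : nat) (z : Z) :
  0 < theta < 1 -> irrational theta -> 0 < tau < 1 -> (1 <= k)%nat ->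
  let q := INR (cf_q theta k) in let D := cf_err theta k in
  Rpower q tau * D < 2 -> q <= Q < INR (cf_q theta (S k)) ->
  (1 <= i <= cf_q theta k)%nat -> x = INR i * theta - IZR z ->
  (-1) ^ k * (y - x) <= Rpower 5 (- tau) / 2 * ell tau q D ->
  - / INR (cf_q theta (S k)) <= (-1) ^ k * (y - x) ->
  exists i, (1 <= i)%nat /\ INR i <= Q /\ dZ (INR i * theta - frac y) < Rpower Q (- tau).
Proof.
  intros Hth Hirr ht hk q D h2 [hQ1 hQ2] hi hx hup hlo.
  assert (q1 : 1 <= q) by (apply (le_INR 1), cf_q_pos; trivial).
  assert (Dp : 0 < D) by (apply cf_err_pos; trivial).
  pose proof (cf_err_upper theta k Hth Hirr) as Dq. fold D in Dq.
  set (q' := INR (cf_q theta (S k))) in *. set (s := (-1) ^ k) in *.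
  set (t := s * (y - x)) in *.
  assert (iq : INR i <= q) by (apply le_INR; lia).
  assert (ss : s * s = 1) by (destruct (pow_m1_cases k) as [e|e]; fold s in e; rewrite e; ring).
  assert (sa : Rabs s = 1) by (apply pow_1_abs).
  pose proof (inv_lt_pow Q tau ltac:(lra) ltac:(lra)) as iQ.
  assert (q'Q : / q' < / Q) by (apply Rinv_lt_contravar; nra).
  assert (DQ : D < / Q).
  { eapply Rlt_trans; [|exact q'Q]. apply mult_lt_inv; lra. }
  assert (walk : forall j : nat, INR (i + j * cf_q theta k) <= Q ->
     Rabs (t - INR j * D) < Rpower Q (- tau) ->
     exists i, (1 <= i)%nat /\ INR i <= Q /\ dZ (INR i * theta - frac y) < Rpower Q (- tau)).
  { intros j hj hd. exists (i + j * cf_q theta k)%nat. split; [lia|]. split; trivial.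
    eapply Rle_lt_trans; [|exact hd].
    assert (E : x + INR j * (s * D) =
       INR (i + j * cf_q theta k) * theta - IZR (z + Z.of_nat j * cf_p theta k)).
    { unfold s, D. rewrite <- cf_signed_err by trivial.
      rewrite plus_INR, mult_INR, plus_IZR, mult_IZR, <- INR_IZR_INZ, hx. ring. }
    eapply Rle_trans; [apply (dZ_lift _ _ _ _ _ E)|].
    replace (y - (x + INR j * (s * D))) with (s * (t - INR j * D)).
    - rewrite Rabs_mult, sa. lra.
    - unfold t. rewrite Rmult_minus_distr_l, <- Rmult_assoc, ss. ring. }
  destruct (progression_step i (cf_q theta k) Q) as [j [hj1 hj2]].
  { apply cf_q_pos; trivial. }
  { lra. }
  (* At scale Q at most j steps are affordable. If y lies beyond them, all are taken and
     [jump_close] applies. If y is passed on the way, one stops just before it, at distance below D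
     < 1 / Q. If y lies slightly behind x, no step is taken and the distance is at most 1 / q' < 1 /
     Q. The last two cases use 1 / Q <= Q^(-tau), that is tau <= 1. *)
  destruct (Rle_lt_dec (INR j * D) t) as [c|c].
  - apply (walk j hj1). rewrite Rabs_right by lra.
    apply (jump_close tau q D (INR i) Q t j); try lra.
    rewrite plus_INR, mult_INR, S_INR in hj2. fold q in hj2. lra.
  - destruct (Rle_lt_dec 0 t) as [c0|c0].
    + destruct (base_Int_part (t / D)) as [b1 b2].
      assert (tD : 0 <= t / D) by (apply Rmult_le_pos; [lra|apply Rlt_le, Rinv_0_lt_compat; lra]).
      assert (I0 : (0 <= Int_part (t / D))%Z).
      { assert (-1 < Int_part (t / D))%Z by (apply lt_IZR; lra). lia. }
      set (j0 := Z.to_nat (Int_part (t / D))).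
      assert (j0E : INR j0 = IZR (Int_part (t / D))).
      { unfold j0. rewrite INR_IZR_INZ, Z2Nat.id by lia. trivial. }
      rewrite <- j0E in b1, b2.
      assert (tE : t = t / D * D) by (field; lra).
      assert (c1 : 0 <= t - INR j0 * D < D) by (split; nra).
      assert (jj : (j0 < j)%nat) by (apply INR_lt; nra).
      apply (walk j0).
      * eapply Rle_trans; [|exact hj1]. apply le_INR. nia.
      * rewrite Rabs_right; lra.
    + apply (walk 0%nat).
      * rewrite Nat.add_0_r. lra.
      * simpl INR. rewrite Rmult_0_l, Rminus_0_r, Rabs_left by trivial. lra.
Qed.

Lemma prod1_pos (f : nat -> R) (m : nat) :
  (forall j, (1 <= j)%nat -> 0 < f j) -> 0 < prod1 f m.
Proof.
  intros h. induction m as [|m IH]; simpl; [lra|]. apply Rmult_lt_0_compat; auto with arith.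
Qed.

(** Raise q D^tau < 1 to the powers tau and 1 / tau: q^tau D < D^(1 - tau^2) < 1 and q^(1/tau) D <
    1. The first is the hypothesis of [jump_close], the second gives the growth of n_k with rho = 1
    / tau > 1. *)
Lemma S_c_pow_bounds (tau q D : R) : 0 < tau < 1 -> 0 < q -> 0 < D < 1 ->
  q * Rpower D tau < 1 -> Rpower q tau * D < 2 /\ Rpower q (1 / tau) * D < 2.
Proof.
  intros ht hq hD h. pose proof (ln_neg D hD) as hn. pose proof ln_lt_2 as l2.
  apply ln_increasing in h; [|apply Rmult_lt_0_compat; [trivial|apply Rpower_pos]].
  rewrite ln_1, ln_mult, ln_Rpower in h by (trivial; apply Rpower_pos).
  split; apply ln_lt_inv; try lra; try (apply Rmult_lt_0_compat; [apply Rpower_pos|lra]);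
    rewrite ln_mult, ln_Rpower by (lra || apply Rpower_pos).
  - apply (Rmult_lt_compat_l tau) in h; [|lra]. assert (tau * tau < 1) by nra.
    assert ((1 - tau * tau) * ln D < 0) by nra. lra.
  - apply (Rmult_lt_reg_l tau); [lra|].
    replace (tau * (1 / tau * ln q + ln D)) with (ln q + tau * ln D) by (field; lra). nra.
Qed.

(** Here g_k = 1 / n_k and H_k is the numerator [num k] to the power tau/(tau+1): the quotient of
    consecutive numerators is n_{k+1}^(1/tau + 1) D_k / n_k, and its power is n_{k+1} l_k = l_k /
    g_{k+1}. Since l_k = (D_k / n_k)^(tau/(tau+1)), the exponent cancels in u_k. A child has to lie
    on the side (-1)^(m k) of its parent. *)
Lemma dimension_lt_1 (theta tau : R) (n : nat -> nat) :
  0 < theta < 1 -> irrational theta -> 0 < tau < 1 -> enumerates (S_c theta tau) n ->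
  exists d, is_dimH (U_set theta tau) d /\
    is_liminf (fun k =>
      ln (Rpower (INR (n k)) (1 / tau + 1) *
          prod1 (fun j => Rpower (INR (n j)) (1 / tau) * dZ (INR (n j) * theta)) (k - 1))
      / ln (INR (n k) / dZ (INR (n k) * theta))) d.
Proof.
  intros Hth Hirr ht hn.
  assert (hP : forall x, S_c theta tau x -> exists j, x = cf_q theta j).
  { intros x [j [hj _]]. exists j; trivial. }
  destruct (enumerates_selected theta (S_c theta tau) n Hth Hirr hP hn) as [m sel].
  set (N := fun k => INR (n k)). set (D := fun k => dZ (INR (n k) * theta)).
  set (l := fun k => ell tau (N k) (D k)).
  assert (facts : forall k, (2 <= k)%nat -> 1 <= N k /\ 0 < D k < 1 /\ D k = cf_err theta (m k) /\
    INR (cf_q theta (S (m k))) <= N (S k) /\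
    D k * INR (cf_q theta (S (m k))) < 1 <= 2 * D k * INR (cf_q theta (S (m k)))).
  { intros k hk. exact (selected_facts theta _ n m k Hth Hirr sel hk). }
  assert (cond : forall k, (2 <= k)%nat -> N k * Rpower (D k) tau < 1).
  { intros k hk. destruct (sel k hk) as [_ [_ [_ [_ [[j [_ h]] _]]]]]. exact h. }
  assert (bnd : forall k, (2 <= k)%nat ->
    Rpower (N k) tau * D k < 2 /\ Rpower (N k) (1 / tau) * D k < 2).
  { intros k hk. destruct (facts k hk) as [h1 [h2 _]]. apply S_c_pow_bounds; auto; lra. }
  assert (p5 : 0 < Rpower 5 (- tau)) by apply Rpower_pos.
  assert (p51 : Rpower 5 (- tau) <= 1).
  { rewrite <- (Rpower_O 5) by lra. apply Rle_Rpower; lra. }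
  (* Limit points are within 2 c0 l_k of the nodes, which must not exceed the 5^(-tau) l_k / 2 of
     [jump_close]; c0 <= 1/100 gives the smallness conditions on c0 l_k. *)
  set (c0 := Rpower 5 (- tau) / 100).
  assert (hc0 : 0 < c0 <= / 100) by (unfold c0; lra).
  (* From l_k >= M0 D_k one gets c0 l_k n_{k+1} >= 12 D_k n_{k+1} >= 6, the room that
     [grid_children] asks for. *)
  set (M0 := 12 / c0).
  assert (hM0 : 1200 <= M0).
  { unfold M0. apply (Rmult_le_reg_r c0); [lra|]. field_simplify; lra. }
  destruct (eventually_le n ((1 - tau) / tau) M0) as [K1 hK1].
  { intros k hk. destruct (sel k hk); trivial. }
  { apply Rdiv_lt_0_compat; lra. }
  set (K := max 2 K1).
  assert (lp : forall k, 0 < l k) by (intros; apply ell_pos).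
  assert (big : forall k, (K <= k)%nat -> M0 * D k <= l k).
  { intros k hk. specialize (hK1 k ltac:(lia)). destruct (facts k ltac:(lia)) as [h1 [h2 _]].
    eapply Rle_trans; [|apply ell_over_err; auto; try lra; apply cond; lia].
    apply Rmult_le_compat_r; [lra|exact hK1]. }
  assert (small : forall k, (2 <= k)%nat -> l k <= / N k).
  { intros k hk. destruct (facts k hk) as [h1 [h2 _]]. apply ell_upper_inv; auto; lra. }
  assert (gD : forall k, (2 <= k)%nat -> / N (S k) <= 2 * D k).
  { intros k hk. destruct (facts k hk) as [h1 [h2 [_ [h3 [_ h4]]]]].
    destruct (facts (S k) ltac:(lia)) as [h5 _].
    apply (Rmult_le_reg_r (N (S k))); [lra|]. rewrite Rinv_l by lra. nra. }
  assert (invN : forall k, (2 <= k)%nat -> 0 < / N k).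
  { intros k hk. destruct (facts k hk) as [h1 _]. apply Rinv_0_lt_compat; lra. }
  assert (Dpos : forall j, (1 <= j)%nat -> 0 < D j).
  { intros j hj. apply dZ_mult_pos; trivial.
    pose proof (enumerates_ge (S_c theta tau) n j) as ge.
    enough (j <= n j)%nat by lia. apply ge; trivial.
    intros x hx. destruct (hP x hx) as [i ->]. apply cf_q_pos; trivial. }
  set (f := fun j => Rpower (INR (n j)) (1 / tau) * dZ (INR (n j) * theta)).
  assert (fp : forall j, (1 <= j)%nat -> 0 < f j).
  { intros j hj. apply Rmult_lt_0_compat; [apply Rpower_pos|apply Dpos; trivial]. }
  set (num := fun k => Rpower (N k) (1 / tau + 1) * prod1 f (k - 1)).
  assert (np : forall k, 0 < num k).
  { intros k. apply Rmult_lt_0_compat; [apply Rpower_pos|apply prod1_pos; trivial]. }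
  set (H := fun k => Rpower (num k) (tau / (tau + 1))).
  apply (cantor_dimension (U_set theta tau) (fun i => INR i * theta) l (fun k => / N k) H _ n
    (fun k x => orbit_lift theta (n k) x) (fun k x x' => 0 <= (-1) ^ m k * (x' - x))
    c0 (c0 / 2) 4 K); try lra.
  - apply (superexp_small_of_growth n l 1 2); [lra| |].
    + intros k hk. destruct (sel k hk) as [h1 _]. destruct (facts k hk) as [h2 _].
      split; [lia|]. split; [trivial|]. specialize (small k hk).
      apply (Rmult_le_compat_r (N k)) in small; [|lra]. rewrite Rinv_l in small by lra. trivial.
    + intros A. apply (selected_growth theta (S_c theta tau) n m (1 / tau)); trivial.
      * apply (Rmult_lt_reg_r tau); [lra|]. field_simplify; lra.
      * intros k hk. apply bnd; trivial.
  - intros k hk. pose proof (lp k). pose proof (lp (S k)).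
    pose proof (small k ltac:(lia)). pose proof (small (S k) ltac:(lia)).
    pose proof (gD k ltac:(lia)). pose proof (big k hk). pose proof (invN k ltac:(lia)).
    destruct (facts k ltac:(lia)) as [h1 [h2 _]].
    assert (/ N k <= 1) by (rewrite <- Rinv_1; apply Rinv_le_contravar; lra).
    repeat split; nra.
  - intros k hk. split; [apply Rpower_pos|].
    destruct (facts k ltac:(lia)) as [h1 [h2 _]]. destruct (facts (S k) ltac:(lia)) as [h3 _].
    assert (pp : 0 < prod1 f (k - 1)) by (apply prod1_pos; trivial).
    assert (q0 : 0 < l k / / N (S k)) by (apply Rdiv_lt_0_compat; [trivial|apply invN; lia]).
    apply ln_inv; [apply Rpower_pos|apply Rmult_lt_0_compat; [apply Rpower_pos|trivial]|].
    rewrite ln_mult, ln_div, ln_Rinv by (trivial; lra || apply Rpower_pos || apply invN; lia).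
    unfold l. rewrite ln_ell by lra. unfold H. rewrite !ln_Rpower. unfold num.
    replace (S k - 1)%nat with (S (k - 1)) by lia. cbn [prod1].
    replace (S (k - 1)) with k by lia.
    assert (fk : 0 < f k) by (apply fp; lia).
    assert (fE : ln (f k) = 1 / tau * ln (N k) + ln (D k)).
    { rewrite <- ln_Rpower, <- ln_mult; [trivial|apply Rpower_pos|apply h2]. }
    rewrite !ln_mult, !ln_Rpower by (trivial; apply Rpower_pos || apply Rmult_lt_0_compat; trivial).
    rewrite fE. field. lra.
  - intros k hk. destruct (facts k ltac:(lia)) as [h1 [h2 _]].
    pose proof (ln_neg (D k) h2) as lD.
    assert (lN : 0 <= ln (N k)) by (rewrite <- ln_1; apply ln_le_mono; lra).
    change (ln (num k) / ln (N k / D k) = ln (H k) / - ln (l k)).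
    unfold H, l. rewrite ln_Rpower, ln_ell, ln_div by lra. field. lra.
  - intros k i j hk hi hj ne. apply (selected_separation theta _ n m k i j Hth Hirr sel); trivial.
    lia.
  - intros y hy. destruct (U_set_trapped theta tau _ n m y Hth Hirr sel ltac:(lra) hy)
      as [K2 [_ hK2]]. exists K2. exact hK2.
  - intros k hk. exists (INR 1 * theta - IZR 0), 1%nat, 0%Z. split; [|trivial].
    destruct (sel k ltac:(lia)); lia.
  - intros k x hk _. destruct (sel (S k) ltac:(lia)) as [_ [hm [hq _]]].
    destruct (facts k ltac:(lia)) as [_ [h2 _]].
    destruct (facts (S k) ltac:(lia)) as [h3 [h3' [h4 _]]].
    pose proof (big k hk) as b1. pose proof (big (S k) ltac:(lia)) as b2.
    pose proof (gD k ltac:(lia)) as g1. pose proof (small (S k) ltac:(lia)) as s1.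
    pose proof (lp k) as lk.
    assert (NE : N (S k) = INR (cf_q theta (m (S k)))) by (unfold N; rewrite hq; trivial).
    assert (gN : 1 <= 2 * D k * N (S k)).
    { apply (Rmult_le_compat_r (N (S k))) in g1; [|lra]. rewrite Rinv_l in g1; lra. }
    assert (sN : l (S k) * N (S k) <= 1).
    { apply (Rmult_le_compat_r (N (S k))) in s1; [|lra]. rewrite Rinv_l in s1; lra. }
    destruct (grid_children theta x (c0 * l k) ((-1) ^ m k) (m (S k)) Hth Hirr hm)
      as [ls [l1 [l2 [l3 [l4 l5]]]]].
    + apply pow_m1_cases.
    + rewrite <- NE, <- h4. nra.
    + rewrite <- NE.
      assert (12 * D k <= c0 * l k).
      { apply (Rmult_le_compat_l c0) in b1; [|lra].
        replace (c0 * (M0 * D k)) with (12 * D k) in b1 by (unfold M0; field; lra). trivial. }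
      nra.
    + rewrite <- NE in *. exists ls. split; [trivial|]. split; [trivial|]. split.
      { eapply Rle_trans; [|exact l3]. right. field. lra. }
      split; [trivial|]. intros a ha. destruct (l5 a ha) as [o1 [o2 o3]].
      rewrite hq. split; [trivial|]. split; [trivial|].
      destruct (pow_m1_cases (m k)) as [e|e]; rewrite e in o2, o3; apply Rabs_le; lra.
  - intros K2 x hK2 hx y hy. split; [apply frac_range|].
    exists (N K2). intros Q hQ.
    destruct (sel K2 ltac:(lia)) as [s1 [s2 [s3 _]]].
    (* Q is located among all convergent denominators, not only the selected ones: at unselected
       ones every point is approximated, and at selected ones the node of that level is used. *)
    destruct (bracket (cf_q theta) (m K2) Q) as [j [hj [hQ1 hQ2]]].
    { intros i _. apply cf_q_ge_index; trivial. }
    { rewrite <- s3. exact hQ. }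
    destruct (classic (S_c theta tau (cf_q theta j))) as [hS|hS].
    2:{ apply (S_c_unselected_cover theta tau Q j); trivial; lra || lia. }
    apply hn in hS. destruct hS as [k [hk1 hk2]].
    assert (hk : (K2 <= k)%nat).
    { apply Nat.nlt_ge. intros c. pose proof (enumerates_increasing _ n k K2 hn hk1 c).
      pose proof (cf_q_le theta (m K2) j Hth Hirr hj). lia. }
    destruct (sel k ltac:(lia)) as [_ [t2 [t3 _]]].
    assert (mj : m k = j).
    { destruct (lt_eq_lt_dec (m k) j) as [[c|c]|c]; trivial.
      - pose proof (cf_q_strict theta (m k) j Hth Hirr t2 c). lia.
      - pose proof (cf_q_strict theta j (m k) Hth Hirr ltac:(lia) c). lia. }
    subst j. destruct (hx k hk) as [[i [z [hi hz]]] [hch _]].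
    destruct (facts k ltac:(lia)) as [h1 [h2 [h3 [h4 h5]]]].
    destruct (facts (S k) ltac:(lia)) as [h6 _].
    assert (NE : N k = INR (cf_q theta (m k))) by (unfold N; rewrite t3; trivial).
    assert (sa : Rabs ((-1) ^ m k) = 1) by apply pow_1_abs.
    apply (S_c_selected_near theta tau Q (x k) y (m k) i z); trivial.
    + rewrite <- NE, <- h3. apply bnd. lia.
    + auto.
    + rewrite <- t3. trivial.
    + eapply Rle_trans; [apply Rle_abs|]. rewrite Rabs_mult, sa, Rmult_1_l.
      eapply Rle_trans; [apply hy; trivial|]. rewrite <- NE, <- h3. fold (l k).
      pose proof (lp k). unfold c0. nra.
    (* The child lies on the correct side of the node, and y is within 1 / n_{k+1} <= 1 / q_{m+1} of
       the child; so y can be on the wrong side of the node only by that much. *)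
    + assert (A1 : Rabs ((-1) ^ m k * (y - x (S k))) <= / INR (cf_q theta (S (m k)))).
      { rewrite Rabs_mult, sa, Rmult_1_l. eapply Rle_trans; [apply hy; lia|].
        apply Rle_trans with (/ N (S k)).
        - pose proof (small (S k) ltac:(lia)). pose proof (lp (S k)). nra.
        - apply Rinv_le_contravar; [|trivial]. apply lt_0_INR, cf_q_pos; trivial. }
      revert A1. unfold Rabs; destruct Rcase_abs; lra.
Qed.

(** * The range tau > 1 *)

(* While q_l^tau ||q_l theta|| >= 2, the index approximating y at scale q_l is still the
   only possible one at scale q_{l+1}. *)
Lemma persistent_index (theta tau y Q0 : R) (a b : nat) :
  0 < theta < 1 -> irrational theta -> 0 < tau ->
  (forall Q, Q0 <= Q -> exists i, (1 <= i)%nat /\ INR i <= Q /\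
     dZ (INR i * theta - y) < Rpower Q (- tau)) ->
  Q0 <= INR (cf_q theta a) -> (a <= b)%nat ->
  (forall j, (a <= j)%nat -> (j < b)%nat -> 2 <= Rpower (INR (cf_q theta j)) tau * cf_err theta j) ->
  exists i, (1 <= i <= cf_q theta a)%nat /\
    dZ (INR i * theta - y) < Rpower (INR (cf_q theta b)) (- tau).
Proof.
  intros Hth Hirr ht hQ hQ0 hab. induction hab as [|b hab IH]; intros hj.
  - destruct (hQ _ hQ0) as [i [i1 [i2 i3]]]. apply INR_le in i2. exists i; auto.
  - destruct IH as [i [i1 i2]]; [intros j h1 h2; apply hj; lia|].
    exists i. split; trivial.
    pose proof (cf_q_le theta a b Hth Hirr hab) as qab.
    destruct (cf_q_mono_pos theta b Hth Hirr) as [qb qbS].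
    destruct (hQ (INR (cf_q theta (S b)))) as [j [j1 [j2 j3]]].
    { eapply Rle_trans; [exact hQ0|]. apply le_INR; lia. }
    apply INR_le in j2.
    destruct (Nat.eq_dec i j) as [->|ne]; trivial. exfalso.
    pose proof (cf_separation theta b i j Hth Hirr ltac:(lia) ltac:(lia) ne) as sep.
    pose proof (dZ_triang (INR i * theta) y (INR j * theta)) as T.
    rewrite (dZ_minus_sym y (INR j * theta)) in T.
    assert (qp : 0 < INR (cf_q theta b)) by (apply lt_0_INR; lia).
    pose proof (Rpower_neg_antitone _ _ tau ht qp (le_INR _ _ qbS)) as mono.
    specialize (hj b hab ltac:(lia)).
    pose proof (Rpower_pos (INR (cf_q theta b)) tau) as pp.
    pose proof (Rpower_pos (INR (cf_q theta b)) (- tau)) as pn.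
    assert (E : Rpower (INR (cf_q theta b)) (- tau) * Rpower (INR (cf_q theta b)) tau = 1).
    { rewrite <- Rpower_plus, Rplus_opp_l, Rpower_O; trivial. }
    apply (Rmult_le_compat_l (Rpower (INR (cf_q theta b)) (- tau))) in hj; [|lra].
    rewrite <- Rmult_assoc, E in hj. lra.
Qed.

(** The children are all steps with j D <= L. Their indices do not exceed q_{k+1}, because (i + j q)
    D <= q D + q L <= 1/2 <= q_{k+1} D. *)
Lemma walk_children (theta x L : R) (k i : nat) (z : Z) :
  0 < theta < 1 -> irrational theta -> 0 < L -> (1 <= i <= cf_q theta k)%nat ->
  x = INR i * theta - IZR z ->
  let D := cf_err theta k in
  INR (cf_q theta k) * D + INR (cf_q theta k) * L <= / 2 ->
  exists ls, ls <> [] /\ NoDup ls /\ L / D <= INR (length ls) /\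
    (forall a b, In a ls -> In b ls -> a <> b -> D <= Rabs (a - b)) /\
    (forall a, In a ls -> exists (j : nat) (w : Z), (i + j * cf_q theta k <= cf_q theta (S k))%nat /\
       a = INR (i + j * cf_q theta k) * theta - IZR w /\
       a = x + INR j * ((-1) ^ k * D) /\ Rabs (a - x) <= L).
Proof.
  intros Hth Hirr hL hi hx D hqD.
  assert (Dp : 0 < D) by (apply cf_err_pos; trivial).
  pose proof (cf_err_lower theta k Hth Hirr) as lo. fold D in lo.
  assert (sa : Rabs ((-1) ^ k) = 1) by apply pow_1_abs.
  set (f := fun j : nat => x + INR j * ((-1) ^ k * D)).
  assert (LD : 0 < L / D) by (apply Rdiv_lt_0_compat; trivial).
  destruct (base_Int_part (L / D)) as [b1 b2].
  assert (I0 : (0 <= Int_part (L / D))%Z).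
  { assert (-1 < Int_part (L / D))%Z by (apply lt_IZR; lra). lia. }
  set (len := S (Z.to_nat (Int_part (L / D)))).
  assert (lenE : INR len = IZR (Int_part (L / D)) + 1).
  { unfold len. rewrite S_INR, INR_IZR_INZ, Z2Nat.id by lia. trivial. }
  destruct (separated_points f D len Dp) as [s1 s2].
  { intros u v huv. unfold f.
    replace (x + INR v * ((-1) ^ k * D) - (x + INR u * ((-1) ^ k * D)))
      with ((-1) ^ k * ((INR v - INR u) * D)) by ring.
    rewrite Rabs_mult, sa, Rmult_1_l. apply le_INR in huv. rewrite S_INR in huv.
    rewrite Rabs_right; nra. }
  exists (map f (seq 0 len)). split; [unfold len; simpl; discriminate|].
  split; [trivial|]. split; [rewrite length_map, length_seq; lra|]. split; [trivial|].
  intros a ha. apply in_map_iff in ha. destruct ha as [j [<- hj]]. apply in_seq in hj.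
  assert (jL : INR j * D <= L).
  { assert (INR j + 1 <= INR len) by (rewrite <- S_INR; apply le_INR; lia).
    replace L with (L / D * D) by (field; lra). apply Rmult_le_compat_r; lra. }
  exists j, (z + Z.of_nat j * cf_p theta k)%Z. split; [|split; [|split; [trivial|]]].
  - apply INR_le. rewrite plus_INR, mult_INR.
    assert (hi' : INR i <= INR (cf_q theta k)) by (apply le_INR; lia).
    apply (Rmult_le_reg_r D); trivial.
    assert (0 <= INR (cf_q theta k)) by apply pos_INR.
    assert (INR (cf_q theta k) * (INR j * D) <= INR (cf_q theta k) * L)
      by (apply Rmult_le_compat_l; trivial).
    nra.
  - unfold f, D. rewrite <- cf_signed_err by trivial.
    rewrite plus_INR, mult_INR, plus_IZR, mult_IZR, <- INR_IZR_INZ, hx. ring.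
  - unfold f. replace (x + INR j * ((-1) ^ k * D) - x) with ((-1) ^ k * (INR j * D)) by ring.
    rewrite Rabs_mult, sa, Rmult_1_l, Rabs_right; [trivial|].
    apply Rle_ge, Rmult_le_pos; [apply pos_INR|lra].
Qed.

(** The relation keeps the decomposition of the child's index: intermediate points (i + j' q) theta
    with j' < j serve the scales at which the child's own index is still too large. *)
Definition walk_child (theta : R) (k : nat) (x x' : R) : Prop :=
  exists (i j : nat) (z w : Z), (1 <= i <= cf_q theta k)%nat /\ x = INR i * theta - IZR z /\
    x' = INR (i + j * cf_q theta k) * theta - IZR w /\
    x' = x + INR j * ((-1) ^ k * cf_err theta k).

(** If the child's index is at most Q, the child itself approximates y, as e <= N^(-tau) < Q^(-tau).
    Otherwise only j' < j steps are affordable; y is within e <= D of the j-th one, so it is not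
    behind the j'-th, and [jump_close] applies. *)
Lemma walk_child_near (theta tau Q x x' y e N : R) (k : nat) :
  0 < theta < 1 -> irrational theta -> 0 < tau ->
  let q := INR (cf_q theta k) in let D := cf_err theta k in
  Rpower q tau * D < 2 -> q <= Q < N -> walk_child theta k x x' ->
  Rabs (y - x') <= e -> e <= D -> e <= Rpower N (- tau) ->
  Rabs (y - x) <= Rpower 5 (- tau) / 2 * ell tau q D ->
  exists i, (1 <= i)%nat /\ INR i <= Q /\ dZ (INR i * theta - frac y) < Rpower Q (- tau).
Proof.
  intros Hth Hirr ht q D h2 [hQ1 hQ2] [i [j [z [w [hi [hx [hw hx']]]]]]] he heD heN hyx.
  assert (q1 : 1 <= q) by (apply (le_INR 1), cf_q_pos; trivial).
  assert (Dp : 0 < D) by (apply cf_err_pos; trivial).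
  set (s := (-1) ^ k) in *.
  assert (ss : s * s = 1) by (destruct (pow_m1_cases k) as [c|c]; fold s in c; rewrite c; ring).
  assert (sa : Rabs s = 1) by (apply pow_1_abs).
  assert (iq : INR i <= q) by (apply le_INR; lia).
  destruct (Rle_lt_dec (INR (i + j * cf_q theta k)) Q) as [c|c].
  - exists (i + j * cf_q theta k)%nat. split; [lia|split; trivial].
    eapply Rle_lt_trans; [apply (dZ_lift _ _ _ _ _ hw)|].
    eapply Rle_lt_trans; [exact he|]. eapply Rle_lt_trans; [exact heN|].
    apply Rpower_neg_antitone_lt; lra.
  - destruct (progression_step i (cf_q theta k) Q) as [j' [hj1 hj2]].
    { apply cf_q_pos; trivial. }
    { lra. }
    assert (jj : (j' < j)%nat).
    { apply Nat.nle_gt. intros le. assert (le' : (i + j * cf_q theta k <= i + j' * cf_q theta k)%nat) by nia.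
      apply le_INR in le'. lra. }
    apply le_INR in jj. rewrite S_INR in jj.
    exists (i + j' * cf_q theta k)%nat. split; [lia|split; trivial].
    assert (E : x + INR j' * (s * D) =
       INR (i + j' * cf_q theta k) * theta - IZR (z + Z.of_nat j' * cf_p theta k)).
    { unfold s, D. rewrite <- cf_signed_err by trivial.
      rewrite plus_INR, mult_INR, plus_IZR, mult_IZR, <- INR_IZR_INZ, hx. ring. }
    eapply Rle_lt_trans; [apply (dZ_lift _ _ _ _ _ E)|].
    set (t := s * (y - x)).
    assert (tE : t = INR j * D + s * (y - x')).
    { unfold t. rewrite hx'. fold D. transitivity (INR j * D * (s * s) + s * (y - (x + INR j * (s * D)))).
      - ring.
      - rewrite ss. ring. }
    assert (se : - e <= s * (y - x')).
    { assert (A1 : Rabs (s * (y - x')) <= e) by (rewrite Rabs_mult, sa; lra).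
      revert A1; unfold Rabs; destruct Rcase_abs; lra. }
    assert (tj : INR j' * D <= t) by nra.
    replace (y - (x + INR j' * (s * D))) with (s * (t - INR j' * D)).
    2:{ unfold t. rewrite Rmult_minus_distr_l, <- Rmult_assoc, ss. ring. }
    rewrite Rabs_mult, sa, Rmult_1_l, Rabs_right by lra.
    apply (jump_close tau q D (INR i) Q t j'); trivial; try lra.
    + rewrite plus_INR, mult_INR, S_INR in hj2. fold q in hj2. lra.
    + eapply Rle_trans; [apply Rle_abs|]. unfold t. rewrite Rabs_mult, sa. lra.
Qed.

(** Here g_{k+1} = D_k and H_k is the product over j < k to the power -tau/(tau+1): each factor
    contributes n_k^(-tau/(tau+1)) D_k^(-1/(tau+1)) = l_k / D_k. For the upper bound it matters that
    level k needs only indices up to the denominator following n_{k-1}, whose orbit points are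
    D_{k-1}-separated, and not all indices up to n_k; this comes from [persistent_index]. *)
Lemma dimension_gt_1 (theta tau : R) (n : nat -> nat) :
  0 < theta < 1 -> irrational theta -> 1 < tau -> enumerates (S_d theta tau) n ->
  exists d, is_dimH (U_set theta tau) d /\
    is_liminf (fun k =>
      - ln (prod1 (fun j => INR (n j) * Rpower (dZ (INR (n j) * theta)) (1 / tau)) (k - 1))
      / ln (INR (n k) / dZ (INR (n k) * theta))) d.
Proof.
  intros Hth Hirr ht hn.
  assert (hP : forall x, S_d theta tau x -> exists j, x = cf_q theta j).
  { intros x [j [hj _]]. exists j; trivial. }
  destruct (enumerates_selected theta (S_d theta tau) n Hth Hirr hP hn) as [m sel].
  set (N := fun k => INR (n k)). set (D := fun k => dZ (INR (n k) * theta)).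
  set (l := fun k => ell tau (N k) (D k)).
  assert (facts : forall k, (2 <= k)%nat -> 1 <= N k /\ 0 < D k < 1 /\ D k = cf_err theta (m k) /\
    INR (cf_q theta (S (m k))) <= N (S k) /\
    D k * INR (cf_q theta (S (m k))) < 1 <= 2 * D k * INR (cf_q theta (S (m k)))).
  { intros k hk. exact (selected_facts theta _ n m k Hth Hirr sel hk). }
  assert (cond : forall k, (2 <= k)%nat -> Rpower (N k) tau * D k < 2).
  { intros k hk. destruct (sel k hk) as [_ [_ [_ [_ [[j [_ h]] _]]]]]. exact h. }
  assert (NE : forall k, (2 <= k)%nat -> N k = INR (cf_q theta (m k))).
  { intros k hk. destruct (sel k hk) as [_ [_ [h _]]]. unfold N. rewrite h; trivial. }
  assert (p5 : 0 < Rpower 5 (- tau)) by apply Rpower_pos.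
  assert (p51 : Rpower 5 (- tau) <= 1).
  { rewrite <- (Rpower_O 5) by lra. apply Rle_Rpower; lra. }
  set (c0 := Rpower 5 (- tau) / 100).
  assert (hc0 : 0 < c0 <= / 100) by (unfold c0; lra).
  (* n_k^(tau-1) >= 48 turns l_k <= 2 n_k^(-tau) into 24 l_k <= 1 / n_k, and then 12 l_{k+1} <= 1 /
     (2 n_{k+1}) <= D_k: pieces are much shorter than the gaps. *)
  destruct (eventually_le n (tau - 1) 48) as [K1 hK1].
  { intros k hk. destruct (sel k hk); trivial. }
  { lra. }
  (* The successor is needed because the gap at level k belongs to level k - 1, where the estimates
     must already hold. *)
  set (K := S (max 2 K1)).
  assert (lp : forall k, 0 < l k) by (intros; apply ell_pos).
  assert (low : forall k, (2 <= k)%nat -> D k <= 2 * l k).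
  { intros k hk. destruct (facts k hk) as [h1 [h2 _]]. apply ell_lower; auto; lra. }
  assert (up : forall k, (2 <= k)%nat -> l k <= 2 * Rpower (N k) (- tau)).
  { intros k hk. destruct (facts k hk) as [h1 [h2 _]]. apply ell_upper_pow; auto; lra. }
  assert (powN : forall k, (max 2 K1 <= k)%nat -> 48 * Rpower (N k) (- tau) <= / N k).
  { intros k hk. specialize (hK1 k ltac:(lia)). destruct (facts k ltac:(lia)) as [h1 _].
    fold (N k) in hK1.
    assert (E : / N k = Rpower (N k) (tau - 1) * Rpower (N k) (- tau)).
    { rewrite <- Rpower_plus. replace (tau - 1 + - tau) with (Ropp 1) by ring.
      rewrite Rpower_Ropp, Rpower_1; lra. }
    rewrite E. apply Rmult_le_compat_r; [apply Rlt_le, Rpower_pos|trivial]. }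
  assert (gD : forall k, (2 <= k)%nat -> / N (S k) <= 2 * D k).
  { intros k hk. destruct (facts k hk) as [h1 [h2 [_ [h3 [_ h4]]]]].
    destruct (facts (S k) ltac:(lia)) as [h5 _].
    apply (Rmult_le_reg_r (N (S k))); [lra|]. rewrite Rinv_l by lra. nra. }
  assert (lD : forall k, (max 2 K1 <= k)%nat -> 12 * l (S k) <= D k).
  { intros k hk. pose proof (up (S k) ltac:(lia)). pose proof (powN (S k) ltac:(lia)).
    pose proof (gD k ltac:(lia)). lra. }
  assert (Dpos : forall j, (1 <= j)%nat -> 0 < D j).
  { intros j hj. apply dZ_mult_pos; trivial.
    pose proof (enumerates_ge (S_d theta tau) n j) as ge.
    enough (j <= n j)%nat by lia. apply ge; trivial.
    intros x hx. destruct (hP x hx) as [i ->]. apply cf_q_pos; trivial. }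
  assert (Npos : forall j, (1 <= j)%nat -> 0 < N j).
  { intros j hj. apply lt_0_INR. pose proof (enumerates_ge (S_d theta tau) n j) as ge.
    enough (j <= n j)%nat by lia. apply ge; trivial.
    intros x hx. destruct (hP x hx) as [i ->]. apply cf_q_pos; trivial. }
  set (f := fun j => INR (n j) * Rpower (dZ (INR (n j) * theta)) (1 / tau)).
  assert (fp : forall j, (1 <= j)%nat -> 0 < f j).
  { intros j hj. apply Rmult_lt_0_compat; [apply Npos; trivial|apply Rpower_pos]. }
  set (H := fun k => Rpower (prod1 f (k - 1)) (- (tau / (tau + 1)))).
  assert (pp : forall k, 0 < prod1 f (k - 1)) by (intros; apply prod1_pos; trivial).
  apply (cantor_dimension (U_set theta tau) (fun i => INR i * theta) l (fun k => D (k - 1)%nat) H _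
    (fun k => cf_q theta (S (m (k - 1)%nat)))
    (fun k x => orbit_lift theta (n k) x) (fun k x x' => walk_child theta (m k) x x')
    c0 c0 2 K); try lra.
  - apply (superexp_small_of_growth n l 2 (max 2 K1)); [lra| |].
    + intros k hk. destruct (sel k ltac:(lia)) as [h1 _]. destruct (facts k ltac:(lia)) as [h2 _].
      split; [lia|]. split; [trivial|].
      pose proof (up k ltac:(lia)) as u. pose proof (powN k hk) as w.
      pose proof (Rpower_pos (N k) (- tau)). fold (N k).
      assert (u' : l k <= / N k) by lra.
      apply (Rmult_le_compat_r (N k)) in u'; [|lra]. rewrite Rinv_l in u' by lra. lra.
    + intros A. apply (selected_growth theta (S_d theta tau) n m tau); trivial.
  - intros k hk. pose proof (lp k). pose proof (lp (S k)).
    replace (S k - 1)%nat with k by lia.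
    pose proof (lD k ltac:(lia)) as a1. pose proof (lD (k - 1)%nat ltac:(lia)) as a2.
    replace (S (k - 1)) with k in a2 by lia.
    pose proof (low k ltac:(lia)). destruct (facts (k - 1)%nat ltac:(lia)) as [_ [h2 _]].
    repeat split; try nra; apply h2.
  - intros k hk. split; [apply Rpower_pos|].
    replace (S k - 1)%nat with k by lia.
    destruct (facts k ltac:(lia)) as [h1 [h2 _]]. pose proof (pp k) as ppk.
    assert (q0 : 0 < l k / D k) by (apply Rdiv_lt_0_compat; [trivial|lra]).
    apply ln_inv; [apply Rpower_pos|apply Rmult_lt_0_compat; [apply Rpower_pos|trivial]|].
    rewrite ln_mult, ln_div by (trivial; lra || apply Rpower_pos).
    unfold l. rewrite ln_ell by lra. unfold H. rewrite !ln_Rpower.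
    replace (S k - 1)%nat with (S (k - 1)) by lia. cbn [prod1].
    replace (S (k - 1)) with k by lia.
    assert (fk : 0 < f k) by (apply fp; lia).
    assert (fE : ln (f k) = ln (N k) + 1 / tau * ln (D k)).
    { rewrite <- ln_Rpower, <- ln_mult; [trivial|lra|apply Rpower_pos]. }
    rewrite ln_mult, fE by trivial. field. lra.
  - intros k hk. destruct (facts k ltac:(lia)) as [h1 [h2 _]].
    pose proof (ln_neg (D k) h2) as lnD.
    assert (lN : 0 <= ln (N k)) by (rewrite <- ln_1; apply ln_le_mono; lra).
    change (- ln (prod1 f (k - 1)) / ln (N k / D k) = ln (H k) / - ln (l k)).
    unfold H, l. rewrite ln_Rpower, ln_ell, ln_div by lra. field. lra.
  - intros k i j hk hi hj ne. destruct (facts (k - 1)%nat ltac:(lia)) as [_ [h2 [-> _]]].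
    pose proof (cf_separation theta (m (k - 1)%nat) i j Hth Hirr hi hj ne).
    pose proof (cf_err_pos theta (m (k - 1)%nat) Hth Hirr). lra.
  - intros y hy. destruct (U_set_trapped theta tau _ n m y Hth Hirr sel ltac:(lra) hy)
      as [K2 [hK2 hK2']].
    destruct hy as [_ [Q0 hQ]]. destruct (INR_unbounded Q0) as [K3 hK3].
    exists (S (max K (max K2 K3))). intros k hk.
    destruct (sel (k - 1)%nat ltac:(lia)) as [s1 [s2 [s3 [s4 [_ s5]]]]].
    replace (S (k - 1)) with k in * by lia.
    destruct (sel k ltac:(lia)) as [t1 [t2 [t3 _]]].
    destruct (persistent_index theta tau y Q0 (S (m (k - 1)%nat)) (m k)) as [i [i1 i2]];
      trivial; try lra.
    { apply Rlt_le. eapply Rlt_le_trans; [exact hK3|]. apply le_INR.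
      pose proof (cf_q_mono_pos theta (m (k - 1)%nat) Hth Hirr). lia. }
    { intros j j1 j2. apply Rnot_lt_le. intros c. apply (s5 j); trivial.
      exists j. split; trivial. rewrite dZ_cf_q by (trivial; lia). trivial. }
    destruct (hK2' k ltac:(lia)) as [i' [i1' i2']].
    exists i. split; [trivial|].
    (* The persistent index i has the small bound, the trapped index i' the small distance. Both are
       at most n_k and within 4 n_k^(-tau) of y, and 5 n_k^(-tau) in total is less than the spacing
       1 / (2 n_k). *)
    assert (Enn : i = i').
    { apply NNPP. intros ne.
      pose proof (cf_q_le theta (S (m (k - 1)%nat)) (m k) Hth Hirr s4) as qle.
      pose proof (selected_separation theta _ n m k i i' Hth Hirr sel ltac:(lia) ltac:(lia) i1' ne)
        as sep.
      pose proof (dZ_triang (INR i * theta) y (INR i' * theta)) as T.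
      rewrite <- NE in i2 by lia. fold (N k) in sep, i2'. fold (D k) in i2'.
      change (dZ (y - INR i' * theta) <= 2 * l k) in i2'.
      pose proof (up k ltac:(lia)). pose proof (powN k ltac:(lia)).
      pose proof (Rpower_pos (N k) (- tau)). lra. }
    subst i'. exact i2'.
  - intros k hk. exists (INR 1 * theta - IZR 0), 1%nat, 0%Z. split; [|trivial].
    destruct (sel k ltac:(lia)); lia.
  - intros k x hk [i [z [hi hx]]]. replace (S k - 1)%nat with k by lia.
    destruct (sel k ltac:(lia)) as [_ [hm [hq [hlt _]]]].
    destruct (sel (S k) ltac:(lia)) as [_ [_ [hq' _]]].
    destruct (facts k ltac:(lia)) as [h1 [h2 [h3 _]]].
    pose proof (lp k) as lk. pose proof (up k ltac:(lia)) as u. pose proof (powN k ltac:(lia)) as w.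
    pose proof (low k ltac:(lia)) as lo.
    assert (lN : 24 * l k * N k <= 1).
    { assert (u' : 24 * l k <= / N k) by lra.
      apply (Rmult_le_compat_r (N k)) in u'; [|lra]. rewrite Rinv_l in u' by lra. trivial. }
    destruct (walk_children theta x (c0 * l k) (m k) i z Hth Hirr) as [ls [l1 [l2 [l3 [l4 l5]]]]];
      trivial.
    + nra.
    + rewrite <- hq; trivial.
    + rewrite <- h3, <- NE by lia. nra.
    + rewrite <- h3 in *. exists ls. split; [trivial|]. split; [trivial|]. split.
      { eapply Rle_trans; [|exact l3]. right. field. lra. }
      split.
      { intros a b ha hb ne. eapply Rle_trans; [|apply l4; trivial]. lra. }
      intros a ha. destruct (l5 a ha) as [j [v [j1 [j2 [j3 j4]]]]]. split; [|split; trivial].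
      * exists (i + j * cf_q theta (m k))%nat, v. split; [|trivial].
        rewrite hq'. pose proof (cf_q_le theta (S (m k)) (m (S k)) Hth Hirr hlt). lia.
      * exists i, j, z, v. rewrite <- hq, <- h3. rewrite hq at 2. auto.
  - intros K2 x hK2 hx y hy. split; [apply frac_range|].
    exists (N K2). intros Q hQ.
    destruct (bracket n K2 Q) as [k [hk [hQ1 hQ2]]]; trivial.
    { intros k hk. destruct (sel k ltac:(lia)); trivial. }
    destruct (hx k hk) as [_ [hch _]]. destruct (facts k ltac:(lia)) as [h1 [h2 [h3 _]]].
    pose proof (lp k). pose proof (lp (S k)). pose proof (lD k ltac:(lia)) as a1.
    pose proof (up (S k) ltac:(lia)) as a2.
    pose proof (Rpower_pos (N (S k)) (- tau)).
    apply (walk_child_near theta tau Q (x k) (x (S k)) y (2 * (c0 * l (S k))) (N (S k)) (m k));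
      trivial; try lra.
    + rewrite <- h3, <- NE by lia. apply cond; lia.
    + rewrite <- NE by lia. auto.
    + apply hy; lia.
    + rewrite <- h3. nra.
    + nra.
    + eapply Rle_trans; [apply hy; trivial|]. rewrite <- h3, <- NE by lia. fold (l k).
      unfold c0. nra.
Qed.

(** * The four ranges of tau together *)

Theorem theorem1 (theta : R) (Hth : 0 < theta < 1) (Hirr : irrational theta)
  (Hw : w_gt theta 1) :
  (* (a) *)
  (forall tau, 0 < tau -> w_lt theta (1 / tau) ->
     forall y, 0 <= y < 1 -> U_set theta tau y) /\
  (* (b) *)
  (forall tau, w_lt theta tau ->
     forall y, U_set theta tau y <->
       exists i : nat, (1 <= i)%nat /\ y = frac (INR i * theta)) /\
  (* (c) *)
  (forall tau, w_gt theta (1 / tau) -> tau < 1 -> 0 < tau ->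
     forall n : nat -> nat, enumerates (S_c theta tau) n ->
     exists d, is_dimH (U_set theta tau) d /\
       is_liminf (fun k =>
         ln (Rpower (INR (n k)) (1 / tau + 1) *
             prod1 (fun j => Rpower (INR (n j)) (1 / tau) * dZ (INR (n j) * theta)) (k - 1))
         / ln (INR (n k) / dZ (INR (n k) * theta))) d) /\
  (* (d) *)
  (forall tau, 1 < tau -> w_gt theta tau ->
     forall n : nat -> nat, enumerates (S_d theta tau) n ->
     exists d, is_dimH (U_set theta tau) d /\
       is_liminf (fun k =>
         - ln (prod1 (fun j => INR (n j) * Rpower (dZ (INR (n j) * theta)) (1 / tau)) (k - 1))
         / ln (INR (n k) / dZ (INR (n k) * theta))) d).
Proof.
  split; [|split; [|split]].
  - intros tau ht hw. apply uniform_all; trivial.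
  (* An element of the set of exponents forces its upper bound, and with it tau, to be positive. *)
  - intros tau hw. destruct Hw as [s [hs _]]. apply uniform_orbit; trivial. exists s; trivial.
  - intros tau _ h1 h0 n hn. apply dimension_lt_1; auto.
  - intros tau h1 _ n hn. apply dimension_gt_1; trivial.
Qed.
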